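(* Let $G\in\mathcal{C}$, let $C$ be a proper separator of $G$ with full components $L,R$, let $F$ be an optimal $(C,c_1,c_2)$-frame, let $H$ be an $F$-hole, let $c_3\in C\setminus\{c_1,c_2\}$ be $F$-light, and let $P=p_k\text{-}\cdots\text{-}p_1\text{-}c_3\text{-}q_1\text{-}\cdots\text{-}q_j$ be a $c_3$-butterfly. Then $c_3$ is not a central vertex of $P$; that is, $k\le1$ or $j\le 1$.
   Context: All graphs are finite and simple; paths are induced paths; a hole is an induced cycle of length at least four. $\mathcal{C}$ is the class of graphs containing no theta, pyramid, prism or turtle as an induced subgraph (theta: two nonadjacent vertices joined by three otherwise disjoint paths, any two inducing a hole; pyramid: a vertex $a$ joined to the three vertices $b_i$ of a triangle by paths disjoint except at $a$, any two inducing a hole; prism: two disjoint triangles $\{a_i\},\{b_i\}$ joined by disjoint paths $a_i$–$b_i$, any two inducing a hole; turtle: a hole formed by disjoint paths $P_1$ from $a_1$ to $b_1$ and $P_2$ from $a_2$ to $b_2$ with edges $a_1a_2,b_1b_2$, plus adjacent vertices $x,y$, $x$ having $\ge3$ neighbors in $P_1$ and none in $P_2$, $y$ having $\ge3$ neighbors in $P_2$ and none in $P_1$). A minimal separator $C$ of $G$ is a set such that $G\setminus C$ has two distinct components $L,R$ with $N(L)=N(R)=C$; it is proper if it is not a clique, in which case $G\setminus C$ has exactly two such components $L,R$ (the full components). For $c_1,c_2\in C$, a $(C,c_1,c_2)$-hole is a hole $H$ with $V(H)\cap C=\{c_1,c_2\}$ whose two $c_1$–$c_2$ paths $H_L,H_R$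 satisfy $H_L^*\subseteq L$, $H_R^*\subseteq R$ ($P^*$ is the interior of a path $P$). Its frame is $(c_1,c_2,\ell_1',\ell_1,r_1,r_1',\ell_2',\ell_2,r_2,r_2')$, where $\ell_1,\ell_2$ are the neighbors of $c_1,c_2$ in $H_L$, $\ell_i'$ is the neighbor of $\ell_i$ in $H_L^*$ if $\ell_1\neq\ell_2$ and $\ell_1'=\ell_2'=\ell_1=\ell_2$ otherwise, and $r_1,r_2,r_1',r_2'$ are analogous in $H_R$. A $(C,c_1,c_2)$-frame is the frame of some $(C,c_1,c_2)$-hole; an $F$-hole is a $(C,c_1,c_2)$-hole with frame $F$. For $u\notin V(H)$, $u$ is major for $H$ if it has a neighbor in $H$ and its neighbors in $H$ are not contained in any three-vertex subpath of $H$. A $w$-sector is a subpath $Q=x\text{-}\cdots\text{-}y$ of $H$ with $x,y$ adjacent to $w$ and no interior vertex adjacent to $w$; an extended neighborhood of $w$ is $Q\cup(\{x',y'\}\cap N(w))$ with $x',y'$ the neighbors of $x,y$ in $H\setminus V(Q)$; $a,b\in V(H)$ are distant with respect to $w$ if no extended neighborhood of $w$ contains both. $v$ is $(c_1,c_2)$-heavy with respect to $H$ if it is major for $H$ and $c_1,c_2$ are distant in $H$ with respect to $v$; $v$ is $F$-heavy if it is $(c_1,c_2)$-heavy with respect to some $F$-hole, and $F$-light otherwise; the potential of $F$ is the number of $F$-heavy vertices. $\mathrm{dist}_L(c_1,c_2)$ (resp. $\mathrm{dist}_R$) is the length of a shortest path from $c_1$ to $c_2$ with interior in $L$ (resp.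 $R$), and $\mathrm{dist}(c_1,c_2)=\min(\mathrm{dist}_L,\mathrm{dist}_R)$. $(c_1,c_2)$ is a long pair if $\mathrm{dist}(c_1,c_2)\ge4$, and a $(C,c_1,c_2)$-frame is long if $(c_1,c_2)$ is a long pair. $C$ is rich if it has a long pair, and poor otherwise. A $(C,c_1,c_2)$-frame $F$ is optimal if either $C$ is rich and $F$ has maximum potential among all long frames of $C$, or $C$ is poor and $\mathrm{dist}(c_1,c_2)$ is maximum over all non-adjacent pairs of vertices of $C$. A path $p_0\text{-}\cdots\text{-}p_m$ is a path from $p_0$ to $Z$ through $Y$ if $\{p_1,\dots,p_m\}\subseteq Y$, $\{p_0,\dots,p_{m-1}\}$ has no neighbor in $Z$, and $p_m$ has a neighbor in $Z$. A $c_3$-butterfly is a path $P=p_k\text{-}\cdots\text{-}p_1\text{-}c_3\text{-}q_1\text{-}\cdots\text{-}q_j$ where $c_3\text{-}p_1\text{-}\cdots\text{-}p_k$ is a shortest path from $c_3$ to $H_L^*$ through $L$ and $c_3\text{-}q_1\text{-}\cdots\text{-}q_j$ is a shortest path from $c_3$ to $H_R^*$ through $R$ (possibly $k=0$ or $j=0$, i.e. $p_k=c_3$ or $q_j=c_3$). $c_3$ is a central vertex of $P$ if $c_3\notin\{p_k,p_{k-1},q_j,q_{j-1}\}$ (with $p_0=q_0=c_3$), i.e. $k\ge2$ and $j\ge2$. *)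

(* Defs.v *)
(* Finite simple graphs: a symmetric irreflexive relation
   e on a finType T (vertex set = all of T). *)
From Stdlib Require Import ClassicalEpsilon.
From mathcomp Require Import all_boot.

Set Implicit Arguments.
Unset Strict Implicit.
Unset Printing Implicit Defensive.

Definition pbool (P : Prop) : bool :=
  if excluded_middle_informative P then true else false.

Section Graph.
Variable T : finType.
Variable e : rel T.

Definition indpath (p : seq T) : Prop :=
  0 < size p /\ uniq p /\
  forall (x0 : T) i j, i < size p -> j < size p ->
    e (nth x0 p i) (nth x0 p j) = (i == j.+1) || (j == i.+1).

Definition is_hole (h : seq T) : Prop :=
  4 <= size h /\ uniq h /\
  forall (x0 : T) i j, i < size h -> j < size h ->
    e (nth x0 h i) (nth x0 h j) =
      (i == j.+1 %% size h) || (j == i.+1 %% size h).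

Definition induces_hole (S : {set T}) : Prop :=
  exists h, is_hole h /\ [set x in h] = S.

Definition path_from_to (p : seq T) (a b : T) : Prop :=
  indpath p /\ head a p = a /\ last a p = b.

Definition vset (p : seq T) : {set T} := [set x in p].

Definition has_theta : Prop :=
  exists a b P1 P2 P3,
    a != b /\ ~~ e a b /\
    path_from_to P1 a b /\ path_from_to P2 a b /\ path_from_to P3 a b /\
    vset P1 :&: vset P2 = [set a; b] /\
    vset P1 :&: vset P3 = [set a; b] /\
    vset P2 :&: vset P3 = [set a; b] /\
    induces_hole (vset P1 :|: vset P2) /\
    induces_hole (vset P1 :|: vset P3) /\
    induces_hole (vset P2 :|: vset P3).

Definition has_pyramid : Prop :=
  exists a b1 b2 b3 P1 P2 P3,
    e b1 b2 /\ e b1 b3 /\ e b2 b3 /\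
    path_from_to P1 a b1 /\ path_from_to P2 a b2 /\ path_from_to P3 a b3 /\
    vset P1 :&: vset P2 = [set a] /\
    vset P1 :&: vset P3 = [set a] /\
    vset P2 :&: vset P3 = [set a] /\
    induces_hole (vset P1 :|: vset P2) /\
    induces_hole (vset P1 :|: vset P3) /\
    induces_hole (vset P2 :|: vset P3).

Definition has_prism : Prop :=
  exists a1 a2 a3 b1 b2 b3 P1 P2 P3,
    uniq [:: a1; a2; a3; b1; b2; b3] /\
    e a1 a2 /\ e a1 a3 /\ e a2 a3 /\
    e b1 b2 /\ e b1 b3 /\ e b2 b3 /\
    path_from_to P1 a1 b1 /\ path_from_to P2 a2 b2 /\ path_from_to P3 a3 b3 /\
    vset P1 :&: vset P2 = set0 /\
    vset P1 :&: vset P3 = set0 /\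
    vset P2 :&: vset P3 = set0 /\
    induces_hole (vset P1 :|: vset P2) /\
    induces_hole (vset P1 :|: vset P3) /\
    induces_hole (vset P2 :|: vset P3).

Definition has_turtle : Prop :=
  exists a1 b1 a2 b2 P1 P2 x y,
    path_from_to P1 a1 b1 /\ path_from_to P2 a2 b2 /\
    vset P1 :&: vset P2 = set0 /\
    e a1 a2 /\ e b1 b2 /\
    induces_hole (vset P1 :|: vset P2) /\
    e x y /\
    x \notin vset P1 :|: vset P2 /\ y \notin vset P1 :|: vset P2 /\
    3 <= #|[set z in P1 | e x z]| /\ [set z in P2 | e x z] = set0 /\
    3 <= #|[set z in P2 | e y z]| /\ [set z in P1 | e y z] = set0.

Definition in_classC : Prop :=
  ~ has_theta /\ ~ has_pyramid /\ ~ has_prism /\ ~ has_turtle.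

Definition is_component (S K : {set T}) : Prop :=
  exists x, x \in S /\
    K = [set y | connect (fun u v => [&& e u v, u \in S & v \in S]) x y].

Definition nbhd (K : {set T}) : {set T} :=
  [set v | (v \notin K) && [exists u in K, e v u]].

Definition is_clique (C : {set T}) : Prop :=
  forall x y, x \in C -> y \in C -> x != y -> e x y.

Definition proper_separator (C L R : {set T}) : Prop :=
  is_component (~: C) L /\ is_component (~: C) R /\ L != R /\
  nbhd L = C /\ nbhd R = C /\ ~ is_clique C.

Variables C L R : {set T}.

(* The hole c1 - hl - c2 - (rev hr) - c1 ; H_L = c1-hl-c2, H_R = c1-hr-c2 *)
Definition hole_of (c1 c2 : T) (hl hr : seq T) : seq T :=
  c1 :: hl ++ c2 :: rev hr.

Definition CHole (c1 c2 : T) (hl hr : seq T) : Prop :=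
  c1 \in C /\ c2 \in C /\ is_hole (hole_of c1 c2 hl hr) /\
  all (mem L) hl /\ all (mem R) hr.

(* l1 = neighbour of c1 in H_L, l2 = neighbour of c2 in H_L,
   l1' = neighbour of l1 in H_L^* if l1 <> l2, and l1' = l2' = l1 = l2 otherwise *)
Definition side_frame (x0 : T) (s : seq T) : T * T * T * T :=
  let a := head x0 s in
  let b := last x0 s in
  if 1 < size s then (a, nth x0 s 1, b, nth x0 s (size s).-2)
  else (a, a, b, b).

Definition frame_of (c1 c2 : T) (hl hr : seq T) : seq T :=
  let: (l1, l1', l2, l2') := side_frame c1 hl in
  let: (r1, r1', r2, r2') := side_frame c1 hr in
  [:: c1; c2; l1'; l1; r1; r1'; l2'; l2; r2; r2'].

Definition is_frame (c1 c2 : T) (F : seq T) : Prop :=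
  exists hl hr, CHole c1 c2 hl hr /\ frame_of c1 c2 hl hr = F.

Definition F_hole (F : seq T) (hl hr : seq T) : Prop :=
  exists c1 c2, CHole c1 c2 hl hr /\ frame_of c1 c2 hl hr = F.

Definition hv (x0 : T) (h : seq T) (k : nat) : T := nth x0 h (k %% size h).

Definition major (x0 : T) (h : seq T) (u : T) : Prop :=
  u \notin h /\ has (e u) h /\
  forall i, i < size h ->
    exists2 z, z \in h & e u z /\
      z \notin [:: hv x0 h (i + size h).-1; hv x0 h i; hv x0 h i.+1].

Definition arc (x0 : T) (h : seq T) (i m : nat) : seq T :=
  [seq hv x0 h (i + k) | k <- iota 0 m].

(* arc h i m is a w-sector (x = h_i, y = h_{i+m-1}, x <> y) *)
Definition sector (x0 : T) (h : seq T) (w : T) (i m : nat) : Prop :=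
  i < size h /\ 2 <= m /\ m <= (size h).-1 /\
  e w (hv x0 h i) /\ e w (hv x0 h (i + m.-1)) /\
  forall k, 0 < k -> k < m.-1 -> ~~ e w (hv x0 h (i + k)).

Definition ext_nbhd (x0 : T) (h : seq T) (w : T) (i m : nat) : {set T} :=
  vset (arc x0 h i m) :|:
  [set z in [:: hv x0 h (i + size h).-1; hv x0 h (i + m)] | e w z].

Definition distant (x0 : T) (h : seq T) (w a b : T) : Prop :=
  forall i m, sector x0 h w i m -> ~ (a \in ext_nbhd x0 h w i m /\ b \in ext_nbhd x0 h w i m).

Definition heavy_wrt (h : seq T) (c1 c2 v : T) : Prop :=
  major c1 h v /\ distant c1 h v c1 c2.

Definition F_heavy (F : seq T) (v : T) : Prop :=
  exists c1 c2 hl hr, CHole c1 c2 hl hr /\ frame_of c1 c2 hl hr = F /\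
    heavy_wrt (hole_of c1 c2 hl hr) c1 c2 v.

Definition F_light (F : seq T) (v : T) : Prop := ~ F_heavy F v.

Definition potential (F : seq T) : nat := #|[set v | pbool (F_heavy F v)]|.

Definition LR_path (c1 c2 : T) (p : seq T) : Prop :=
  (all (mem L) p \/ all (mem R) p) /\ indpath (c1 :: p ++ [:: c2]).

Definition dist_is (c1 c2 : T) (d : nat) : Prop :=
  (exists p, LR_path c1 c2 p /\ (size p).+1 = d) /\
  (forall p, LR_path c1 c2 p -> d <= (size p).+1).

Definition long_pair (c1 c2 : T) : Prop :=
  c1 != c2 /\ forall p, LR_path c1 c2 p -> 4 <= (size p).+1.

Definition rich : Prop :=
  exists c1 c2, c1 \in C /\ c2 \in C /\ long_pair c1 c2.

Definition optimal_frame (c1 c2 : T) (F : seq T) : Prop :=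
  is_frame c1 c2 F /\
  ( (rich /\ long_pair c1 c2 /\
     forall c1' c2' F', is_frame c1' c2' F' -> long_pair c1' c2' ->
       potential F' <= potential F)
  \/ (~ rich /\ ~~ e c1 c2 /\
      exists d, dist_is c1 c2 d /\
        forall c1' c2' d', c1' \in C -> c2' \in C -> c1' != c2' -> ~~ e c1' c2' ->
          dist_is c1' c2' d' -> d' <= d)).

Definition path_through (Y : {set T}) (Z : seq T) (p0 : T) (ps : seq T) : Prop :=
  indpath (p0 :: ps) /\ all (mem Y) ps /\
  all (fun x => ~~ has (e x) Z) (belast p0 ps) /\ has (e (last p0 ps)) Z.

Definition shortest_path_through (Y : {set T}) (Z : seq T) (p0 : T) (ps : seq T) : Prop :=
  path_through Y Z p0 ps /\
  forall ps', path_through Y Z p0 ps' -> size ps <= size ps'.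

(* P = p_k - ... - p_1 - c3 - q_1 - ... - q_j with ps = [p_1..p_k], qs = [q_1..q_j],
   relative to the hole (hl, hr): H_L^* = hl, H_R^* = hr *)
Definition butterfly (hl hr : seq T) (c3 : T) (ps qs : seq T) : Prop :=
  indpath (rev ps ++ c3 :: qs) /\
  shortest_path_through L hl c3 ps /\ shortest_path_through R hr c3 qs.

Definition central (ps qs : seq T) : Prop := 2 <= size ps /\ 2 <= size qs.

End Graph.

(* Main.v *)
(* Call "attachment lemma" the following fact: if a hole is split into two paths p and q, one
   end of a path w off the hole has neighbours in p only, the other in q only, and its interior
   has none, then each end has exactly one neighbour, and these two are adjacent; all else is
   a theta, a pyramid, a prism or (for an edge w between two wheel centres) a turtle.

   Suppose that c3 is central. If both c1 and c2 were joined to c3 by paths whose interiors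
   miss the two sides of H and their neighbourhoods, there would be a theta, so say c2 is
   not. Attachment to H, of the butterfly or of a path from c1 to p_k or q_j, shows that c2 is
   adjacent to neither p_k nor q_j (up to exchanging c1 and c2), while p_k is adjacent to c1 or has l1 as its only
   neighbour in H_L (and likewise on the right). The same applied to other paths
   through c3 shows that (c3, c2) is a long pair, which settles the poor case.

   In the rich case let H' be the hole through c3 and c2 made of the butterfly and of the
   parts of H_L and H_R towards c2. Then c1 is heavy for H', and every F-heavy vertex v is
   heavy for H' too: otherwise a path from v, through the discarded part of H, attaches to H'
   at p_k and its neighbour in H_L on one side and elsewhere on the other. So the frame of H'
   has larger potential than F. *)

(* The attachment lemma leaves the cut of the hole free, and nearly every step consists in choosing
   that cut. Usually it is made so that the two neighbours which the lemma declares adjacent lie in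
   [L] and in [R], between which there are no edges, or so that one end is forced to have two
   neighbours. The poor case is a bootstrap. That [c3] and [c2] are not joined freely already puts
   them at distance at least three; by maximality [c1] and [c2] are then at distance at least three,
   so they have no common neighbour in [L] or [R], and this is what the finer analysis needs to
   raise three to four. The rich case meets two obstacles: heaviness is defined by sectors of the
   whole cycle, and [F]-heavy refers to any hole with frame [F], not to [H] alone. Both disappear
   with the criterion [good], which asks for a suitable neighbour on each side separately, so that
   sides can be replaced one at a time. The growth of the potential is strict because [c1] lies on
   [H] and so is not [F]-heavy. *)
Require Import Defs.
From Stdlib Require Import ClassicalEpsilon.
From mathcomp Require Import all_boot zify.

Set Implicit Arguments.
Unset Strict Implicit.
Unset Printing Implicit Defensive.

(** * Induced paths and holes *)

(* [simpl] identifies the carriers of [T] as a finType and as an eqType. *)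
Ltac slia := simpl in *; lia.

Section InducedPaths.
Variables (T : finType) (e : rel T).
Hypotheses (e_sym : symmetric e) (e_irr : irreflexive e).

Definition nonadj (x y : T) : bool := (x != y) && ~~ e x y.

Lemma edge_neq x y : e x y -> x != y.
Proof. by apply: contraTneq => ->; rewrite e_irr. Qed.

Fixpoint ipath (s : seq T) : bool :=
  if s is x :: t then
    if t is y :: t' then [&& e x y, all (nonadj x) t' & ipath t] else true
  else false.

Lemma ipath2 x y s : ipath (x :: y :: s) = [&& e x y, all (nonadj x) s & ipath (y :: s)].
Proof. by []. Qed.

Lemma ipath_ne s : ipath s -> 0 < size s.
Proof. by case: s. Qed.

Lemma ipath_uniq s : ipath s -> uniq s.
Proof.
elim: s => // x [|y s] IH // ; rewrite ipath2 => /and3P[exy /allP al /IH us].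
rewrite [uniq _]/= -/(uniq (y :: s)) us andbT inE negb_or edge_neq //=.
by apply/negP=> /al; rewrite /nonadj eqxx.
Qed.

Lemma indpathP p : indpath e p <-> ipath p.
Proof.
split.
  case=> sp [up H]; elim: p sp up H => // x [|y s] IH // _ up H.
  rewrite ipath2; apply/and3P; split.
  - by have := H x 0 1 isT isT => /= ->.
  - apply/(all_nthP x) => i lti; rewrite /nonadj; apply/andP; split.
      apply: contraTneq up => ->.
      by rewrite /= !inE negb_and negbK mem_nth ?orbT.
    have /= := H x 0 i.+2 isT; rewrite !ltnS => /(_ lti) ->.
    by lia.
  - apply: IH => //; first by case/andP: up.
    by move=> x0 i j si sj; have /= := H x0 i.+1 j.+1; rewrite !ltnS => ->.
move=> ipp; split; first exact: ipath_ne; split; first exact: ipath_uniq.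
move=> x0; elim: p ipp => // x [|y s] IH.
  by move=> _ [|i] [|j] //= _ _; rewrite e_irr.
rewrite ipath2 => /and3P[exy /allP al /IH {}IH] [|i] [|j] si sj.
- by rewrite e_irr.
- case: j sj => [|j] sj; first by rewrite /= exy.
  have/al: nth x0 s j \in s by rewrite mem_nth.
  by rewrite /= => /andP[_ /negPf->]; lia.
- case: i si => [|i] si; first by rewrite /= e_sym exy.
  have/al: nth x0 s i \in s by rewrite mem_nth.
  by rewrite /= e_sym => /andP[_ /negPf->]; lia.
- by rewrite [LHS]/= IH //.
Qed.

(** The defaults of [last] and [head] never matter here, since [x] and [y] witness that the
    sequences are nonempty. *)
Definition join (s t : seq T) := forall x y, x \in s -> y \in t ->
  x != y /\ e x y = (x == last x s) && (y == head y t).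

Lemma ipath_cat (s t : seq T) : s != [::] -> t != [::] ->
  ipath (s ++ t) <-> [/\ ipath s, ipath t & join s t].
Proof.
elim: s => // x s IH _ tn0.
case: s IH => [_|y s IH].
  case: t tn0 => // y t _; rewrite cat1s ipath2; split.
    move=> /and3P[exy /allP al ipt]; split=> // x' z; rewrite inE => /eqP->.
    rewrite inE /= eqxx => /orP[/eqP->|/[dup] zt /al/andP[-> /negPf->]].
      by rewrite eqxx edge_neq.
    split=> //; apply/esym/negbTE; apply: contraTneq zt => ->.
    by case/andP: (ipath_uniq ipt).
  case=> _ ipt J; apply/and3P; split=> //.
    by have [|//|_ ->] := J x y; rewrite ?inE ?eqxx //.
  apply/allP=> z zt; have [|//|xz exz] := J x z; rewrite ?inE ?eqxx ?zt ?orbT //.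
  rewrite /nonadj xz exz /= eqxx /=; apply: contraTneq zt => ->.
  by case/andP: (ipath_uniq ipt).
rewrite 2!cat_cons ipath2 -cat_cons; split.
  case/and3P=> exy; rewrite all_cat => /andP[als alt] /IH [//|//|ips ipt J].
  split=> //; first by rewrite ipath2 exy als.
  move=> u z; rewrite inE => /orP[/eqP->|us] zt; last first.
    by have [//|//|-> ->] := J u z.
  have /andP[-> /negPf->] := allP alt _ zt; split=> //.
  apply/esym/negbTE; rewrite negb_and; apply/orP; left.
  move: (ips) => /=; have := mem_last y s.
  have: uniq (x :: y :: s) by rewrite ipath_uniq // ipath2 exy als.
  by case/andP=> xn _ yl _; apply: contraNneq xn => ->.
case=> + ipt J; rewrite ipath2 => /and3P[exy als ips]; apply/and3P; split=> //.
  rewrite all_cat als; apply/allP=> z zt.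
  have [|//|xz] := J x z; rewrite ?inE ?eqxx // => exz; rewrite /nonadj xz exz.
  rewrite negb_and; apply/orP; left.
  have := mem_last y s.
  have: uniq (x :: y :: s) by rewrite ipath_uniq // ipath2 exy als.
  by case/andP=> xn _ yl; apply: contraNneq xn => -> /=.
apply/IH => //; split=> // u z us zt; have [||-> ->//] := J u z => //.
by rewrite inE us orbT.
Qed.

Lemma head_rev (x : T) s : head x (rev s) = last x s.
Proof. by case/lastP: s => // s y; rewrite rev_rcons last_rcons. Qed.

Lemma last_rev (x : T) s : last x (rev s) = head x s.
Proof. by rewrite -head_rev revK. Qed.

Lemma mem_last0 (x y : T) s : x \in s -> last y s \in s.
Proof. by case: s => //= a s _; rewrite mem_last. Qed.

Lemma rev_nil (s : seq T) : (rev s == [::]) = (s == [::]).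
Proof. by rewrite -!size_eq0 size_rev. Qed.

Lemma last_irr (x y : T) s : s != [::] -> last x s = last y s.
Proof. by case: s. Qed.

Lemma head_irr (x y : T) s : s != [::] -> head x s = head y s.
Proof. by case: s. Qed.

Lemma mem_ne (x : T) (s : seq T) : x \in s -> s != [::].
Proof. by case: s. Qed.

Lemma join_rev s t : join s t -> join (rev t) (rev s).
Proof.
move=> J x y; rewrite !mem_rev => xt ys; have [yx eyx] := J _ _ ys xt.
by rewrite eq_sym yx e_sym eyx last_rev head_rev andbC.
Qed.

Lemma ipath_rev s : ipath (rev s) = ipath s.
Proof.
suff H t : ipath t -> ipath (rev t) by apply/idP/idP => [/H|/H //]; rewrite revK.
elim: t => // x t IH; case: (altP (t =P [::])) => [->|tn] //.
rewrite -cat1s => /ipath_cat[] // _ /IH ipt J; rewrite rev_cat.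
by apply/ipath_cat; rewrite ?rev_nil //; split=> //; apply: join_rev.
Qed.

Definition tjoin (p q : seq T) := forall x y, x \in p -> y \in q ->
  x != y /\ e x y = (x == head x p) && (y == head y q)
                   || (x == last x p) && (y == last y q).

(* By [is_hole_split], this says that the cycle [p ++ rev q] is a hole. *)
Definition hole_split (p q : seq T) := [/\ ipath p, ipath q, 4 <= size p + size q & tjoin p q].

Lemma index_head (x : T) s : x \in s -> (x == head x s) = (index x s == 0).
Proof. by case: s => //= y s; rewrite eq_sym; case: eqP. Qed.

Lemma index_last (x : T) s : uniq s -> x \in s ->
  (x == last x s) = (index x s == (size s).-1).
Proof.
move=> us xs; rewrite -nth_last; have sn := xs; rewrite -index_mem in sn.
by rewrite -[X in X == _](nth_index x xs) nth_uniq //=; slia.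
Qed.

(** Cyclic successors without [%%], in a form that [lia] can use. *)
Lemma modS N i : i < N -> i.+1 %% N = if i.+1 == N then 0 else i.+1.
Proof.
by move=> iN; case: eqP => [->|ne]; rewrite ?modnn // modn_small //; lia.
Qed.

Lemma is_hole_split (p q : seq T) : p != [::] -> q != [::] -> is_hole e (p ++ rev q) <-> hole_split p q.
Proof.
move=> pn qn; have p0 : 0 < size p by rewrite lt0n size_eq0.
have q0 : 0 < size q by rewrite lt0n size_eq0.
split.
  case; rewrite size_cat size_rev => s4 [u H].
  move: (u); rewrite cat_uniq rev_uniq => /and3P[up /hasPn dis uq].
  split=> //.
  - apply/indpathP; split=> //; split=> // x0 i j ilt jlt.
    have := H x0 i j; rewrite !nth_cat ilt jlt => ->; rewrite ?size_cat ?size_rev; try slia.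
    by rewrite !modS; try slia; do 2?case: ifP => *; slia.
  - rewrite -ipath_rev; apply/indpathP; split; first by rewrite size_rev.
    split=> [|x0 i j]; first by rewrite rev_uniq.
    rewrite size_rev => ilt jlt.
    have := H x0 (size p + i) (size p + j); rewrite !nth_cat !ltnNge !leq_addr /= !addKn.
    move=> ->; rewrite ?size_cat ?size_rev; try slia.
    by rewrite !modS; try slia; do 2?case: ifP => *; slia.
  move=> x y xp yq; split.
    by apply: contraTneq xp => ->; apply: dis; rewrite mem_rev.
  have xi := xp; rewrite -index_mem in xi; have yi := yq; rewrite -index_mem in yi.
  rewrite !index_head // !index_last //.
  have j0 : index y q < size q by [].
  (* In [p ++ rev q], the vertex of index [j] in [q] stands at position [size p + size q - j.+1]. *)
  have := H x (index x p) (size p + size q - (index y q).+1).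
  rewrite !nth_cat xi nth_index // ifF; last by apply/negbTE; slia.
  rewrite nth_rev; last by slia.
  have -> : size q - (size p + size q - (index y q).+1 - size p).+1 = index y q by slia.
  rewrite nth_index // => ->; try slia.
  by rewrite !modS; try slia; do 2?case: ifP => *; slia.
case=> ipp ipq s4 J; rewrite /is_hole size_cat size_rev; split=> //.
have up := ipath_uniq ipp; have uq := ipath_uniq ipq.
have u : uniq (p ++ rev q).
  rewrite cat_uniq up rev_uniq uq andbT /=; apply/hasPn => y; rewrite mem_rev => yq.
  by apply/negP => yp; have [/eqP] := J y y yp yq.
split=> // x0.
have Hpq i j : i < size p -> size p <= j < size p + size q ->
  e (nth x0 (p ++ rev q) i) (nth x0 (p ++ rev q) j) =
      (i == j.+1 %% (size p + size q)) || (j == i.+1 %% (size p + size q)).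
  move=> ipp' jq; rewrite !nth_cat ipp' ifF; last by apply/negbTE; slia.
  rewrite nth_rev; last by slia.
  have [||_ ->] := J (nth x0 p i) (nth x0 q (size q - (j - size p).+1));
    rewrite ?mem_nth //; try slia.
  rewrite !index_head ?index_last ?mem_nth ?index_uniq //; try slia.
  by rewrite !modS; try slia; do 2?case: ifP => *; slia.
move=> i j si sj; case: (ltnP i (size p)) => ilt; case: (ltnP j (size p)) => jlt.
- rewrite !nth_cat ilt jlt; have /indpathP[_ [_ ->]] // := ipp.
  by rewrite !modS; try slia; do 2?case: ifP => *; slia.
- by rewrite Hpq ?jlt.
- by rewrite e_sym Hpq ?ilt 1?orbC.
- rewrite !nth_cat !ifF; try by apply/negbTE; slia.
  have /indpathP[_ [_ H]] : ipath (rev q) by rewrite ipath_rev.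
  rewrite H ?size_rev ?modS; try slia; do 2?case: ifP => *; slia.
Qed.

End InducedPaths.

(** * Thetas, pyramids and prisms from a hole and a path *)

Ltac bool_cases :=
  repeat match goal with
  | |- context [?z == ?a] => case: (z == a)
  | |- context [?z \in ?s] => case: (z \in s)
  end; by [].

(** Proves equalities of vertex sets elementwise: [I z] says that [z] lies in at most one of the
    pieces, so only Boolean cases remain. *)
Ltac set_excl I :=
  let z := fresh "z" in
  apply/setP=> z; have := I z;
  rewrite !inE ?mem_cat ?mem_rev ?mem_rcons ?inE ?mem_cat ?mem_rev ?mem_rcons ?inE; bool_cases.

Section ThreePaths.
Variables (T : finType) (e : rel T).
Hypotheses (e_sym : symmetric e) (e_irr : irreflexive e).

Notation ipath := (ipath e).
Notation hole_split := (hole_split e).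

Lemma hole_split_sym p q : hole_split p q -> hole_split q p.
Proof.
case=> ipp ipq s4 J; split=> //; first by rewrite addnC.
by move=> x y xq yp; have [yx exy] := J y x yp xq; rewrite eq_sym yx e_sym exy !(andbC (x == _)).
Qed.

Lemma hole_split_rev p q : hole_split p q -> hole_split (rev p) (rev q).
Proof.
case=> ipp ipq s4 J; split; rewrite ?(ipath_rev e_sym e_irr) ?size_rev //.
move=> x y; rewrite !mem_rev => xp yq; have [-> ->] := J x y xp yq.
by rewrite !head_rev !last_rev orbC.
Qed.

Lemma hole_split_ne p q : hole_split p q -> p != [::] /\ q != [::].
Proof. by case=> /ipath_ne + /ipath_ne; case: p; case: q. Qed.

Lemma hole_split_shift s1 s2 q : s1 != [::] -> hole_split (s1 ++ s2) q -> hole_split s1 (q ++ rev s2).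
Proof.
move=> n1 H; have [n2 n3] := hole_split_ne H; apply/(is_hole_split e_sym e_irr) => //.
  by case: (q) n3.
by rewrite rev_cat revK catA; apply/(is_hole_split e_sym e_irr).
Qed.

Lemma hole_split_hole p q : hole_split p q -> induces_hole e (vset p :|: vset q).
Proof.
move=> H; have [n2 n3] := hole_split_ne H; exists (p ++ rev q); split.
  by apply/(is_hole_split e_sym e_irr).
by apply/setP=> z; rewrite !inE mem_cat mem_rev.
Qed.

Lemma induces_hole_eq A B : induces_hole e A -> A = B -> induces_hole e B.
Proof. by move=> ? <-. Qed.

Lemma hole_split_uniq p q : hole_split p q -> uniq (p ++ q).
Proof.
case=> /(ipath_uniq e_irr) up /(ipath_uniq e_irr) uq _ J; rewrite cat_uniq up uq andbT.
by apply/hasPn => y yq; apply/negP => yp; have [/eqP] := J y y yp yq.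
Qed.

Lemma ipath_catl s t : s != [::] -> ipath (s ++ t) -> ipath s.
Proof.
move=> sn; case: (altP (t =P [::])) => [->|tn]; first by rewrite cats0.
by case/(ipath_cat e_irr).
Qed.

Lemma ipath_catr s t : t != [::] -> ipath (s ++ t) -> ipath t.
Proof.
move=> tn; case: (altP (s =P [::])) => [->|sn] //.
by case/(ipath_cat e_irr).
Qed.

Lemma uniq_cat_notin (s t : seq T) x : uniq (s ++ t) -> x \in s -> x \in t -> False.
Proof. by rewrite cat_uniq => /and3P[_ /hasPn H _] xs /H; rewrite xs. Qed.

Lemma head_cat (x : T) s t : head x (s ++ t) = head (head x t) s.
Proof. by case: s. Qed.

(** The path [w] closes the arc formed by [p1] and [q1] through their heads. One of [p2], [q2] must
    be nonempty, for otherwise the last vertices of [p1] and [q1] would be adjacent and give a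
    chord. *)
Lemma arc_hole p1 p2 q1 q2 w : hole_split (p1 ++ p2) (q1 ++ q2) ->
  p1 != [::] -> q1 != [::] -> (p2 != [::]) || (q2 != [::]) -> ipath w ->
  4 <= size w + (size p1 + size q1) ->
  (forall x y, x \in w -> y \in p1 ->
     x != y /\ e x y = (x == head x w) && (y == last y p1)) ->
  (forall x y, x \in w -> y \in q1 ->
     x != y /\ e x y = (x == last x w) && (y == last y q1)) ->
  hole_split w (rev p1 ++ q1).
Proof.
move=> H n1 n2 n3 ipw s4 wp wq; have [ipp ipq _ J] := H.
have ip1 : ipath p1 by apply: ipath_catl ipp.
have iq1 : ipath q1 by apply: ipath_catl ipq.
split=> //; last 2 first.
- by rewrite size_cat size_rev.
- move=> x y xw; rewrite mem_cat mem_rev head_cat last_cat => /orP[yp|yq].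
    have [-> ->] := wp x y xw yp; split=> //.
    have -> : head (head y q1) (rev p1) = last y p1.
      by rewrite head_rev (last_irr _ y n1).
    rewrite -[LHS]orbF; congr orb; apply/esym/negbTE/negP => /andP[_ /eqP yl].
    apply: (@uniq_cat_notin (p1 ++ p2) (q1 ++ q2) y); rewrite ?mem_cat ?yp //.
      exact: hole_split_uniq H.
    rewrite [X in X \in _]yl (last_irr _ y n2) (mem_last0 y (x := head y q1)) //.
    by case: (q1) n2 => //= a s _; rewrite inE eqxx.
  have [-> ->] := wq x y xw yq; split=> //.
  rewrite (last_irr (last y (rev p1)) y n2) [X in _ = X || _](_ : _ = false) //.
  apply/negbTE/negP => /andP[_ /eqP yl].
  apply: (@uniq_cat_notin (p1 ++ p2) (q1 ++ q2) y); rewrite ?mem_cat ?yq //.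
    exact: hole_split_uniq H.
  rewrite [X in X \in _]yl (head_irr _ y) ?rev_nil // head_rev (mem_last0 y (x := head y p1)) //.
  by case: (p1) n1 => //= a s _; rewrite inE eqxx.
apply/(ipath_cat e_irr); rewrite ?rev_nil //; split=> //.
  by rewrite (ipath_rev e_sym e_irr).
move=> x y; rewrite mem_rev => xp yq.
have [|| -> ->] := J x y; rewrite ?mem_cat ?xp ?yq //; split=> //.
rewrite last_rev head_cat head_cat !(head_irr _ x n1) !(head_irr _ y n2).
rewrite -[RHS]orbF; congr orb; apply/negbTE/negP => /andP[/eqP xl /eqP yl].
have up : uniq (p1 ++ p2) by apply: ipath_uniq ipp.
have uq : uniq (q1 ++ q2) by apply: ipath_uniq ipq.
case/orP: n3 => n3.
  apply: (uniq_cat_notin up xp); rewrite xl last_cat (last_irr _ x n3).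
  by rewrite (mem_last0 x (x := head x p2)) //; case: (p2) n3 => //= a s _; rewrite inE eqxx.
apply: (uniq_cat_notin uq yq); rewrite yl last_cat (last_irr _ y n3).
by rewrite (mem_last0 y (x := head y q2)) //; case: (q2) n3 => //= a s _; rewrite inE eqxx.
Qed.

Lemma uniq_cat_mem (z : T) s t : uniq (s ++ t) ->
  (z \in s) + (z \in t) = (z \in s ++ t) :> nat.
Proof.
by rewrite cat_uniq mem_cat => /and3P[_ /hasPn /(_ z) + _]; case: (z \in t) => [/(_ isT)/negPf->|_] //; rewrite orbF addn0.
Qed.

(** Disjointness of all the pieces at once, as an inequality between sums of Booleans; this is the
    form that [set_excl] consumes. *)
Lemma uniq_excl (z a c : T) s t s' t' w :
  uniq ((s ++ a :: t) ++ (s' ++ c :: t') ++ w) ->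
  (z \in s) + (z == a) + (z \in t) + ((z \in s') + (z == c) + (z \in t'))
  + (z \in w) <= 1.
Proof.
rewrite -(cat1s a) -(cat1s c) => U.
have := leq_b1 (z \in (s ++ [:: a] ++ t) ++ (s' ++ [:: c] ++ t') ++ w).
rewrite -(uniq_cat_mem z U); move: U; rewrite cat_uniq => /and3P[U1 _ U2].
rewrite -(uniq_cat_mem z U1) -(uniq_cat_mem z U2).
move: U1; rewrite cat_uniq => /and3P[_ _ U1]; rewrite -(uniq_cat_mem z U1).
move: U2; rewrite cat_uniq => /and3P[U2 _ _]; rewrite -(uniq_cat_mem z U2).
move: U2; rewrite cat_uniq => /and3P[_ _ U2]; rewrite -(uniq_cat_mem z U2).
by rewrite !inE !addnA.
Qed.

Lemma size_pair (s t : seq T) : (s != [::]) || (t != [::]) -> 0 < size s + size t.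
Proof. by case: s t => [|? ?] [|? ?]. Qed.

(** The three paths from [a] to [c] are the two arcs of the hole and [a], [w], [c]. Non-adjacency of
    [a] and [c] gives both arcs an interior vertex, so all three cycles have length at least
    four. *)
Lemma theta_base s a t s' c t' w :
  hole_split (s ++ a :: t) (s' ++ c :: t') -> ipath w -> ~~ e a c ->
  (forall x y, x \in w -> y \in s ++ a :: t ->
     x != y /\ e x y = (x == head x w) && (y == a)) ->
  (forall x y, x \in w -> y \in s' ++ c :: t' ->
     x != y /\ e x y = (x == last x w) && (y == c)) ->
  has_theta e.
Proof.
move=> H ipw eac wp wq; have [_ _ _ J] := H.
have [ap cq] : a \in s ++ a :: t /\ c \in s' ++ c :: t'.
  by rewrite !mem_cat !inE !eqxx !orbT.
have [ac eacE] := J a c ap cq; rewrite (negPf eac) in eacE.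
have w0 := ipath_ne ipw.
have t0 : (t != [::]) || (t' != [::]).
  rewrite -negb_and; apply/negP => /andP[/eqP t0 /eqP t'0].
  by move: eacE; rewrite t0 t'0 !last_cat /= !eqxx orbT.
have s0 : (s != [::]) || (s' != [::]).
  rewrite -negb_and; apply/negP => /andP[/eqP t0' /eqP t'0].
  by move: eacE; rewrite t0' t'0 /= !eqxx.
have H1 : hole_split w (rev (rcons s a) ++ rcons s' c).
  apply: (@arc_hole _ t _ t'); rewrite ?cat_rcons //; try by rewrite -size_eq0 size_rcons.
  - by move: w0 (size_pair s0); rewrite !size_rcons; clear; lia.
  - move=> x y xw yp; rewrite last_rcons; apply: wp => //.
    by rewrite -cat_rcons mem_cat yp.
  - move=> x y xw yp; rewrite last_rcons; apply: wq => //.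
    by rewrite -cat_rcons mem_cat yp.
(* The other arc is obtained from [arc_hole] by reading both sides backwards. *)
have H2 : hole_split w (rev (rev (a :: t)) ++ rev (c :: t')).
  apply: (@arc_hole _ (rev s) _ (rev s')); rewrite ?rev_nil -?rev_cat //; try exact: hole_split_rev.
  - by move: w0 (size_pair t0); rewrite !size_rev /=; clear; lia.
  - move=> x y xw; rewrite mem_rev last_rev => yp; apply: wp => //.
    by rewrite mem_cat yp orbT.
  - move=> x y xw; rewrite mem_rev last_rev => yp; apply: wq => //.
    by rewrite mem_cat yp orbT.
rewrite revK in H2.
have U : uniq ((s ++ a :: t) ++ (s' ++ c :: t') ++ w).
  rewrite (catA (s ++ a :: t)) cat_uniq (hole_split_uniq H) (ipath_uniq e_irr ipw) andbT.
  apply/hasPn => x xw; apply/negP; rewrite mem_cat => /orP[] xx.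
    by have [/eqP] := wp x x xw xx.
  by have [/eqP] := wq x x xw xx.
have ipaw : ipath (a :: rcons w c).
  rewrite -cats1 -cat_cons; apply/(ipath_cat e_irr) => //.
  have ipaw : ipath (a :: w).
    rewrite -cat1s; apply/(ipath_cat e_irr) => //; first by case: (w) w0.
    split=> // x y; rewrite inE => /eqP-> yw; have [ya exa] := wp y a yw ap.
    by rewrite eq_sym ya e_sym exa /= !eqxx andbT.
  split=> // x y; rewrite inE => + /[!inE] /eqP->.
  case/orP=> [/eqP->|xw].
    rewrite ac (negPf eac) /= eqxx andbT; split=> //; apply/esym/negbTE.
    apply: contraTneq U => al; have aw: a \in w.
      by rewrite al; case: (w) w0 => //= b l _; rewrite mem_last.
    apply/negP => U.
    apply: (@uniq_cat_notin (s ++ a :: t) _ a U) => //.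
    by rewrite mem_cat aw orbT.
  have [xc ->] := wq x c xw cq; rewrite xc /= eqxx !andbT; split=> //.
  by case: (w) w0.
have I z := uniq_excl z U.
have [_ ip1 _ _] := H1; have [_ ip2' _ _] := H2.
exists a, c, (rev (rcons s a) ++ rcons s' c), ((a :: t) ++ rev (c :: t')), (a :: rcons w c).
split; first by rewrite ac.
split; first by [].
split; [split; [exact/(indpathP e_sym e_irr)|split]|].
- by rewrite rev_rcons.
- by rewrite last_cat last_rcons.
split; [split; [exact/(indpathP e_sym e_irr)|split]|].
- by [].
- by rewrite last_cat rev_cons last_rcons.
split; [split; [exact/(indpathP e_sym e_irr)|split]|].
- by [].
- by rewrite /= last_rcons.
split; first by set_excl I.
split; first by set_excl I.
split; first by set_excl I.
split; [|split].
- by apply: (induces_hole_eq (hole_split_hole H)); set_excl I.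
- by apply: (induces_hole_eq (hole_split_hole H1)); set_excl I.
- by apply: (induces_hole_eq (hole_split_hole H2)); set_excl I.
Qed.

Lemma off_uniq p q w : hole_split p q -> ipath w ->
  (forall x y, x \in w -> y \in p ++ q -> x != y) -> uniq (p ++ q ++ w).
Proof.
move=> H ipw wpq; rewrite catA cat_uniq (hole_split_uniq H) (ipath_uniq e_irr ipw) andbT.
by apply/hasPn => x xw; apply/negP => /(wpq _ _ xw) /eqP.
Qed.

Lemma ipath_consl a w : ipath w -> (forall x, x \in w -> x != a /\ e x a = (x == head x w)) ->
  ipath (a :: w).
Proof.
move=> ipw wa; rewrite -cat1s; apply/(ipath_cat e_irr) => //.
  by case: (w) (ipath_ne ipw).
split=> // x y; rewrite inE => /eqP-> yw; have [ya exa] := wa y yw.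
by rewrite eq_sym ya e_sym exa /= eqxx.
Qed.

Lemma ipath_edge u v x y : ipath (rcons u x ++ y :: v) -> e x y.
Proof.
case/(ipath_cat e_irr) => //; first by rewrite -size_eq0 size_rcons.
move=> _ _ J; have [||_ ->] := J x y; rewrite ?mem_rcons ?inE ?eqxx //.
by rewrite last_rcons /= !eqxx.
Qed.

Lemma rcons_cat_neq (s t : seq T) c d : uniq (rcons s c ++ d :: t) ->
  (forall y, y \in rcons s c -> (y == d) = false) /\
  (forall y, y \in d :: t -> (y == c) = false).
Proof.
move=> U; split=> y yin; apply/negbTE; apply/eqP => E; subst y.
  by apply: (uniq_cat_notin U yin); rewrite inE eqxx.
by apply: (uniq_cat_notin U _ yin); rewrite mem_rcons inE eqxx.
Qed.

(** The apex is [a] and the triangle is [c], [d] and the last vertex of [w]. The size hypotheses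
    exclude that [w] is a single vertex forming a triangle with [a] and [c], or with [a] and [d]. *)
Lemma pyramid_base s a t s' c d t' w :
  hole_split (s ++ a :: t) (rcons s' c ++ d :: t') -> ipath w ->
  4 <= size w + ((size s).+1 + (size s').+1) ->
  4 <= size w + ((size t).+1 + (size t').+1) ->
  (forall x y, x \in w -> y \in s ++ a :: t ->
     x != y /\ e x y = (x == head x w) && (y == a)) ->
  (forall x y, x \in w -> y \in rcons s' c ++ d :: t' ->
     x != y /\ e x y = (x == last x w) && ((y == c) || (y == d))) ->
  has_pyramid e.
Proof.
move=> H ipw sz1 sz2 wp wq; have [_ ipq _ J] := H.
have [uq1 uq2] := rcons_cat_neq (ipath_uniq e_irr ipq).
have ap : a \in s ++ a :: t by rewrite mem_cat !inE eqxx orbT.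
have cq : c \in rcons s' c ++ d :: t' by rewrite mem_cat mem_rcons !inE eqxx.
have dq : d \in rcons s' c ++ d :: t' by rewrite mem_cat !inE eqxx orbT.
have w0 := ipath_ne ipw.
have U : uniq ((s ++ a :: t) ++ (rcons s' c ++ d :: t') ++ w).
  apply: off_uniq => // x y xw; rewrite mem_cat => /orP[yp|yq].
    by have [] := wp x y xw yp.
  by have [] := wq x y xw yq.
rewrite (cat_rcons c s') in U; have I z := uniq_excl z U; rewrite -cat_rcons in U.
have H1 : hole_split w (rev (rcons s a) ++ rcons s' c).
  apply: (@arc_hole _ t _ (d :: t')); rewrite ?cat_rcons ?orbT //;
    try by rewrite -size_eq0 size_rcons.
  - by move: H; rewrite cat_rcons.
  - by rewrite !size_rcons.
  - move=> x y xw yp; rewrite last_rcons; apply: wp => //.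
    by rewrite -cat_rcons mem_cat yp.
  - move=> x y xw yp; rewrite last_rcons.
    have [||-> ->] := wq x y => //; first by rewrite mem_cat yp.
    by rewrite (uq1 _ yp) orbF.
have H2 : hole_split w (rev (rev (a :: t)) ++ rev (d :: t')).
  apply: (@arc_hole _ (rev s) _ (rev (rcons s' c))); rewrite ?rev_nil -?rev_cat //.
  - exact: hole_split_rev.
  - by rewrite -(size_eq0 (rcons _ _)) size_rcons orbT.
  - by rewrite !size_rev.
  - move=> x y xw; rewrite mem_rev last_rev => yp; apply: wp => //.
    by rewrite mem_cat yp orbT.
  - move=> x y xw; rewrite mem_rev last_rev => yp.
    have [||-> ->] := wq x y => //; first by rewrite mem_cat yp orbT.
    by rewrite (uq2 _ yp).
rewrite revK in H2.
have ipaw : ipath (a :: w).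
  apply: ipath_consl => // x xw; have [-> ->] := wp x a xw ap.
  by rewrite eqxx andbT.
have lw : last a w \in w by case: (w) w0 => //= b l _; rewrite mem_last.
have ecd : e c d := ipath_edge ipq.
have [_ ip1 _ _] := H1; have [_ ip2' _ _] := H2.
exists a, c, d, (last a w), (rev (rcons s a) ++ rcons s' c), ((a :: t) ++ rev (d :: t')), (a :: w).
split; first by [].
have ll : last a w == last (last a w) w by case: (w) w0.
split; first by rewrite e_sym; have [_ ->] := wq _ _ lw cq; rewrite eqxx ll.
split; first by rewrite e_sym; have [_ ->] := wq _ _ lw dq; rewrite eqxx orbT ll.
split; [split; [exact/(indpathP e_sym e_irr)|split]|].
- by rewrite rev_rcons.
- by rewrite last_cat last_rcons.
split; [split; [exact/(indpathP e_sym e_irr)|split]|].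
- by [].
- by rewrite last_cat rev_cons last_rcons.
split; [split; [exact/(indpathP e_sym e_irr)|split]|]; try by [].
split; first by set_excl I.
split; first by set_excl I.
split; first by set_excl I.
split; [|split].
- by apply: (induces_hole_eq (hole_split_hole H)); set_excl I.
- by apply: (induces_hole_eq (hole_split_hole H1)); set_excl I.
- by apply: (induces_hole_eq (hole_split_hole H2)); set_excl I.
Qed.

(** The triangles are [a], [b], head of [w] and [c], [d], last of [w]; they are disjoint because [w]
    has at least two vertices. *)
Lemma prism_base s a b t s' c d t' w :
  hole_split (rcons s a ++ b :: t) (rcons s' c ++ d :: t') -> ipath w -> 2 <= size w ->
  (forall x y, x \in w -> y \in rcons s a ++ b :: t ->
     x != y /\ e x y = (x == head x w) && ((y == a) || (y == b))) ->
  (forall x y, x \in w -> y \in rcons s' c ++ d :: t' ->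
     x != y /\ e x y = (x == last x w) && ((y == c) || (y == d))) ->
  has_prism e.
Proof.
move=> H ipw sz wp wq; have [ipp ipq _ J] := H.
have [up1 up2] := rcons_cat_neq (ipath_uniq e_irr ipp).
have [uq1 uq2] := rcons_cat_neq (ipath_uniq e_irr ipq).
have ap : a \in rcons s a ++ b :: t by rewrite mem_cat mem_rcons !inE eqxx.
have bp : b \in rcons s a ++ b :: t by rewrite mem_cat !inE eqxx orbT.
have cq : c \in rcons s' c ++ d :: t' by rewrite mem_cat mem_rcons !inE eqxx.
have dq : d \in rcons s' c ++ d :: t' by rewrite mem_cat !inE eqxx orbT.
have w0 := ipath_ne ipw.
have U : uniq ((rcons s a ++ b :: t) ++ (rcons s' c ++ d :: t') ++ w).
  apply: off_uniq => // x y xw; rewrite mem_cat => /orP[yp|yq].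
    by have [] := wp x y xw yp.
  by have [] := wq x y xw yq.
rewrite (cat_rcons c s') (cat_rcons a s) in U; have I z := uniq_excl z U.
have ne (u : seq T) v : rcons u v != [::] by rewrite -size_eq0 size_rcons.
have H1 : hole_split w (rev (rcons s a) ++ rcons s' c).
  apply: (@arc_hole _ (b :: t) _ (d :: t')); rewrite ?ne //.
  - by rewrite !size_rcons; move: sz; clear; lia.
  - move=> x y xw yp; rewrite last_rcons.
    have [||-> ->] := wp x y => //; first by rewrite mem_cat yp.
    by rewrite (up1 _ yp) orbF.
  - move=> x y xw yp; rewrite last_rcons.
    have [||-> ->] := wq x y => //; first by rewrite mem_cat yp.
    by rewrite (uq1 _ yp) orbF.
have H2 : hole_split w (rev (rev (b :: t)) ++ rev (d :: t')).
  apply: (@arc_hole _ (rev (rcons s a)) _ (rev (rcons s' c))); rewrite ?rev_nil -?rev_cat ?ne //.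
  - exact: hole_split_rev.
  - by rewrite !size_rev /=; move: sz; clear; lia.
  - move=> x y xw; rewrite mem_rev last_rev => yp.
    have [||-> ->] := wp x y => //; first by rewrite mem_cat yp orbT.
    by rewrite (up2 _ yp).
  - move=> x y xw; rewrite mem_rev last_rev => yp.
    have [||-> ->] := wq x y => //; first by rewrite mem_cat yp orbT.
    by rewrite (uq2 _ yp).
rewrite revK in H2.
have [_ ip1 _ _] := H1; have [_ ip2' _ _] := H2.
have hw : head a w \in w by case: (w) w0 => //= x l _; rewrite inE eqxx.
have lw : last a w \in w by case: (w) w0 => //= x l _; rewrite mem_last.
have hh : head a w == head (head a w) w by case: (w) w0 => //=.
have ll : last a w == last (last a w) w by case: (w) w0.
exists a, b, (head a w), c, d, (last a w), (rev (rcons s a) ++ rcons s' c), ((b :: t) ++ rev (d :: t')), w.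
split.
  have hl : head a w != last a w.
    by case: (w) sz (ipath_uniq e_irr ipw) => [|x [|y l]] //= _ /andP[+ _]; apply: contraNneq => ->; rewrite mem_last.
  have [h1 _] := wp _ _ hw ap; have [h2 _] := wp _ _ hw bp; have [h3 _] := wq _ _ hw cq; have [h4 _] := wq _ _ hw dq.
  have [l1 _] := wp _ _ lw ap; have [l2 _] := wp _ _ lw bp; have [l3 _] := wq _ _ lw cq; have [l4 _] := wq _ _ lw dq.
  have ab := edge_neq e_irr (ipath_edge ipp); have cd := edge_neq e_irr (ipath_edge ipq).
  have [ac _] := J _ _ ap cq; have [ad _] := J _ _ ap dq.
  have [bc _] := J _ _ bp cq; have [bd _] := J _ _ bp dq.
  rewrite /= !inE !negb_or hl (eq_sym a (head _ _)) h1 (eq_sym b (head _ _)) h2 h3 h4.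
  rewrite (eq_sym a (last _ _)) l1 (eq_sym b (last _ _)) l2 (eq_sym c (last _ _)) l3 (eq_sym d (last _ _)) l4.
  by rewrite ab cd ac ad bc bd.
split; first exact: ipath_edge ipp.
split; first by rewrite e_sym; have [_ ->] := wp _ _ hw ap; rewrite eqxx hh.
split; first by rewrite e_sym; have [_ ->] := wp _ _ hw bp; rewrite eqxx orbT hh.
split; first exact: ipath_edge ipq.
split; first by rewrite e_sym; have [_ ->] := wq _ _ lw cq; rewrite eqxx ll.
split; first by rewrite e_sym; have [_ ->] := wq _ _ lw dq; rewrite eqxx orbT ll.
split; [split; [exact/(indpathP e_sym e_irr)|split]|].
- by rewrite rev_rcons.
- by rewrite last_cat last_rcons.
split; [split; [exact/(indpathP e_sym e_irr)|split]|].
- by [].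
- by rewrite last_cat rev_cons last_rcons.
split; [split; [exact/(indpathP e_sym e_irr)|split]|].
- by case: (w) w0.
- by case: (w) w0.
split; first by set_excl I.
split; first by set_excl I.
split; first by set_excl I.
split; [|split].
- by apply: (induces_hole_eq (hole_split_hole H)); set_excl I.
- by apply: (induces_hole_eq (hole_split_hole H1)); set_excl I.
- by apply: (induces_hole_eq (hole_split_hole H2)); set_excl I.
Qed.

End ThreePaths.

(** * Paths attached to a hole *)

Section Attachments.
Variables (T : finType) (e : rel T).
Hypotheses (e_sym : symmetric e) (e_irr : irreflexive e).

Notation ipath := (ipath e).
Notation hole_split := (hole_split e).

Lemma split_first (P : pred T) s : has P s ->
  exists u z v, [/\ s = u ++ z :: v, P z & forall y, y \in u -> ~~ P y].
Proof.
elim: s => //= x s IH; case Px: (P x) => /=; first by exists [::], x, s.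
case/IH=> u [z [v [-> Pz Pu]]]; exists (x :: u), z, v; split=> // y.
by rewrite inE => /orP[/eqP->|/Pu //]; rewrite Px.
Qed.

Lemma split_last (P : pred T) s : has P s ->
  exists u z v, [/\ s = u ++ z :: v, P z & forall y, y \in v -> ~~ P y].
Proof.
rewrite -has_rev => /split_first[u [z [v [E Pz Pu]]]].
exists (rev v), z, (rev u); split=> // [|y].
  by rewrite -[s]revK E rev_cat rev_cons -cats1 -catA.
by rewrite mem_rev; apply: Pu.
Qed.

Definition single_on u p := exists s a t, p = s ++ a :: t /\
  forall y, y \in p -> e u y = (y == a).
Definition edge_on u p := exists s a b t, p = rcons s a ++ b :: t /\
  forall y, y \in p -> e u y = (y == a) || (y == b).
(** Here [a] and [b] are the first and last neighbours of [u] on [p]; nothing is said about its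
    neighbours in [m], which makes the three cases exhaustive. *)
Definition far_on u p := exists s a m b t, [/\ p = s ++ a :: m ++ b :: t, m != [::],
  e u a, e u b & forall y, y \in s ++ t -> ~~ e u y].

Lemma on_cases u p : has (e u) p -> [\/ single_on u p, edge_on u p | far_on u p].
Proof.
case/split_first=> s [a [t' [-> ua us]]].
have nea y : ~~ e u y -> (y == a) = false by apply: contraNF => /eqP->.
case: (boolP (has (e u) t')) => [/split_last[m [b [t [-> ub ut]]]]|/hasPn ut]; last first.
  constructor 1; exists s, a, t'; split=> // y; rewrite mem_cat inE.
  case/or3P=> [/us uy|/eqP->|/ut uy]; rewrite ?eqxx ?ua //; by rewrite nea // (negPf uy).
have neb y : ~~ e u y -> (y == b) = false by apply: contraNF => /eqP->.
case: m => [|c m]; last first.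
  constructor 3; exists s, a, (c :: m), b, t; split=> // y; rewrite mem_cat.
  by case/orP=> [/us|/ut].
constructor 2; exists s, a, b, t; split=> [|y]; first by rewrite cat_rcons.
rewrite mem_cat !inE.
case/or4P=> [/us uy|/eqP->|/eqP->|/ut uy]; rewrite ?eqxx ?orbT ?ua ?ub //;
  by rewrite nea // neb // (negPf uy).
Qed.

Lemma hole_split_replace s a m b t q u : hole_split (s ++ a :: m ++ b :: t) q -> m != [::] ->
  e u a -> e u b -> (forall y, y \in s ++ a :: m ++ b :: t ++ q -> u != y) ->
  (forall y, y \in s ++ t -> ~~ e u y) -> (forall y, y \in q -> ~~ e u y) ->
  hole_split (s ++ a :: u :: b :: t) q.
Proof.
move=> [ipp ipq s4 J] mn ua ub uoff ust uq.
have q0 := ipath_ne ipq.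
have ne1 : rcons s a != [::] by rewrite -size_eq0 size_rcons.
have ipp' := ipp; rewrite -cat_rcons in ipp'.
have /(ipath_cat e_irr)[//||ips ipt Jst] := ipp'; first by case: (m) mn.
have ipbt : ipath (b :: t) by apply: ipath_catr ipt.
have H y : y \in s ++ a :: b :: t -> y \in s ++ a :: m ++ b :: t.
  by rewrite !mem_cat !inE !mem_cat !inE => /or4P[] ->; rewrite ?orbT.
split=> //; last 2 first.
- by rewrite size_cat /=; move: q0; clear; lia.
- move=> x y; rewrite mem_cat !inE => xin yq.
  have E : (x == u) || (x \in s ++ a :: b :: t).
    by rewrite mem_cat !inE; case/or4P: xin => ->; rewrite ?orbT // ; case/orP: xin => ->; rewrite ?orbT.
  rewrite head_cat last_cat /= -[head a s]/(head (head x (a :: m ++ b :: t)) s) -head_cat.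
  rewrite -[last b t]/(last x (b :: t)).
  case/orP: E => [/eqP E|xp]; last first.
    have [|-> ->] := J x y _ yq; first exact: H.
    by rewrite !head_cat !last_cat /= last_cat.
  rewrite E (negPf (uq _ yq)); split.
    by apply: uoff; rewrite !mem_cat !inE !mem_cat !inE mem_cat yq !orbT.
  apply/esym/negbTE; rewrite negb_or !negb_and; apply/andP; split; apply/orP; left; apply: uoff.
    rewrite head_cat /= mem_cat; case: (s) => [|v l]; by rewrite /= ?inE ?eqxx.
  by rewrite mem_cat in_cons mem_cat -cat_cons mem_cat (mem_last b t) !orbT.
have [uip uimt] := (ipath_uniq e_irr ips, ipath_uniq e_irr ipt).
have u0 y : y \in s ++ a :: m ++ b :: t -> (u != y) * (y != u).
  move=> yin; suff uy : u != y by rewrite uy eq_sym uy.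
  by apply: uoff; rewrite -(cat_cons b) (catA m) -cat_cons catA mem_cat yin.
rewrite -cat_rcons; apply/(ipath_cat e_irr) => //; split=> //.
  apply: (ipath_consl e_sym e_irr) => // x xbt.
  rewrite u0; last by rewrite mem_cat !inE !mem_cat xbt !orbT.
  split=> //; rewrite e_sym; move: xbt; rewrite inE => /orP[/eqP->|xt].
    by rewrite ub /= eqxx.
  rewrite (negPf (ust _ _)) ?mem_cat ?xt ?orbT //; apply/esym/negbTE.
  by apply: contraNneq (ust x _) => [->//|]; rewrite mem_cat xt orbT.
move=> x y xs; rewrite inE last_rcons => /orP[/eqP->|ybt].
  rewrite u0; last by rewrite -cat_rcons mem_cat xs.
  rewrite /= eqxx andbT e_sym; split=> //.
  move: xs; rewrite mem_rcons inE => /orP[/eqP->|xs]; first by rewrite ua eqxx.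
  rewrite (negPf (ust _ _)) ?mem_cat ?xs //; apply/esym/negbTE.
  by apply: contraNneq (ust x _) => [->//|]; rewrite mem_cat xs.
have ymt : y \in m ++ b :: t by rewrite mem_cat ybt orbT.
have [-> ->] := Jst x y xs ymt; split=> //.
have yu : (y == u) = false.
  by apply/negbTE; rewrite u0 // mem_cat inE ymt !orbT.
rewrite /= yu andbF; apply/negbTE; rewrite negb_and; apply/orP; right.
apply/eqP => yh; apply: (uniq_cat_notin uimt _ ybt); rewrite yh head_cat.
by case: (m) mn => //= v l _; rewrite inE eqxx.
Qed.

Lemma ipath_far s a m b t : ipath (s ++ a :: m ++ b :: t) -> m != [::] -> ~~ e a b.
Proof.
rewrite -cat_rcons => ipp mn; have /(ipath_cat e_irr)[||_ ipt J] := ipp.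
- by rewrite -size_eq0 size_rcons.
- by case: (m).
have [||_ ->] := J a b; rewrite ?mem_rcons ?mem_cat ?inE ?eqxx ?orbT //.
rewrite negb_and; apply/orP; right; apply/eqP => bh.
apply: (uniq_cat_notin (ipath_uniq e_irr ipt) (x := b)); last by rewrite inE eqxx.
by rewrite bh head_cat; case: (m) mn => //= v l _; rewrite inE eqxx.
Qed.

(** The third path of the theta is [a], [v], [b]. *)
Lemma two_nbrs_theta s a m b t q v : hole_split (s ++ a :: m ++ b :: t) q -> m != [::] ->
  (forall y, y \in s ++ a :: m ++ b :: t ->
     v != y /\ e v y = (y == a) || (y == b)) ->
  (forall y, y \in q -> v != y /\ ~~ e v y) -> has_theta e.
Proof.
move=> H mn vp vq; have [ipp _ _ _] := H.
(* The hole is cut again just before [b], because [theta_base] wants the two ends of the theta on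
   different sides. *)
have H' : hole_split (s ++ a :: m) ((q ++ rev t) ++ b :: [::]).
  rewrite -catA cats1 -rev_cons; apply: (hole_split_shift e_sym e_irr).
    by rewrite -size_eq0 size_cat /= addnS.
  by rewrite -catA.
have E : s ++ a :: m ++ b :: t = (s ++ a :: m) ++ b :: t by rewrite -catA.
have ipp' := ipp; rewrite E in ipp'; have up := ipath_uniq e_irr ipp'.
have inq y : y \in (q ++ rev t) ++ [:: b] -> (y \in b :: t) || (y \in q).
  by rewrite !mem_cat mem_rev !inE => /orP[/orP[]|] ->; rewrite ?orbT.
apply: (@theta_base _ e e_sym e_irr s a m (q ++ rev t) b [::] [:: v]) => //.
- exact: ipath_far ipp mn.
- move=> x y; rewrite inE => /eqP-> yp /=; rewrite eqxx.
  have [|-> ->] := vp y; first by rewrite E mem_cat yp.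
  split=> //; rewrite [y == b](_ : _ = false) ?orbF //; apply/eqP => yb.
  by apply: (uniq_cat_notin up yp); rewrite yb inE eqxx.
move=> x y; rewrite inE => /eqP-> /inq /orP[yb|yq] /=; rewrite eqxx.
  have [|-> ->] := vp y; first by rewrite E mem_cat yb orbT.
  split=> //; rewrite [y == a](_ : _ = false) ?orFb //; apply/eqP => ya.
  by apply: (uniq_cat_notin up _ yb); rewrite ya mem_cat inE eqxx orbT.
have [-> /negPf->] := vq y yq; split=> //; apply/esym/negbTE/eqP => yb.
have [_ _ _ J] := H; have [||/eqP nb _] := J b y; rewrite ?mem_cat ?inE ?mem_cat ?inE ?eqxx ?orbT //.
by case: nb.
Qed.

Definition links p q w := [/\ ipath w, 1 < size w,
  forall x y, x \in w -> y \in p ++ q -> x != y,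
  forall x y, x \in w -> y \in p -> e x y -> x = head x w &
  forall x y, x \in w -> y \in q -> e x y -> x = last x w].

Lemma links_rev p q w : links p q w -> links q p (rev w).
Proof.
case=> ipw sw off wp wq; split; rewrite ?(ipath_rev e_sym e_irr) ?size_rev //.
- by move=> x y; rewrite mem_rev => xw; rewrite mem_cat orbC -mem_cat; apply: off.
- by move=> x y; rewrite mem_rev head_rev; apply: wq.
- by move=> x y; rewrite mem_rev last_rev; apply: wp.
Qed.

Lemma links_single p q u w' a : links p q (u :: w') -> (forall y, y \in p -> e u y = (y == a)) ->
  forall x y, x \in u :: w' -> y \in p ->
  x != y /\ e x y = (x == head x (u :: w')) && (y == a).
Proof.
case=> ipw sw off wp wq ua x y xw yp; split.
  by apply: off => //; rewrite mem_cat yp.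
have := wp x y xw yp; rewrite /=; case: eqP => [->|xu]; first by rewrite ua.
by case: (e x y) => // /(_ isT).
Qed.

Lemma links_edge p q u w' a b : links p q (u :: w') ->
  (forall y, y \in p -> e u y = (y == a) || (y == b)) ->
  forall x y, x \in u :: w' -> y \in p ->
  x != y /\ e x y = (x == head x (u :: w')) && ((y == a) || (y == b)).
Proof.
case=> ipw sw off wp wq ua x y xw yp; split.
  by apply: off => //; rewrite mem_cat yp.
have := wp x y xw yp; rewrite /=; case: eqP => [->|xu]; first by rewrite ua.
by case: (e x y) => // /(_ isT).
Qed.

(** Once [u] replaces [m] on the hole, the rest of the path sees that side in [u] only. This lowers
    a far end to a single neighbour. *)
Lemma links_behead p q u v w' s a m b t : links p q (u :: v :: w') ->
  p = s ++ a :: m ++ b :: t ->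
  ipath (v :: w') /\ (forall x y, x \in v :: w' -> y \in s ++ a :: u :: b :: t ->
    x != y /\ e x y = (x == v) && (y == u)) /\
  (forall y, y \in q -> ~~ e u y).
Proof.
case=> ipw _ off wp wq E; have := ipw; rewrite ipath2 => /and3P[euv /allP al ipv].
have uw : u \notin v :: w' by case/andP: (ipath_uniq e_irr ipw).
split=> //; split.
  move=> x y xw yin; have xu : x != u by apply: contraNneq uw => <-.
  have xin : x \in u :: v :: w' by rewrite inE xw orbT.
  have [->|yu] := eqVneq y u.
    split=> //; rewrite andbT; move: xw; rewrite inE => /orP[/eqP->|xw'].
      by rewrite eqxx e_sym.
    have /andP[_ /negPf] := al x xw'; rewrite e_sym => ->.
    apply/esym/negbTE; apply: contraTneq xw' => ->.
    by case/andP: (ipath_uniq e_irr ipv).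
  have yp : y \in p.
    by move: yin; rewrite E !mem_cat !inE mem_cat inE (negPf yu) /= => /or4P[] ->; rewrite ?orbT.
  split; first by apply: off => //; rewrite mem_cat yp.
  rewrite andbF; apply/negbTE/negP => /(wp _ _ xin yp) /= xu'.
  by rewrite xu' eqxx in xu.
move=> y yq; apply/negP => /(wq u y (mem_head _ _) yq) /= ul.
by move: uw; rewrite {1}ul mem_last.
Qed.

Hypothesis GC : in_classC e.

Lemma no_theta : ~ has_theta e. Proof. by case: GC. Qed.
Lemma no_pyramid : ~ has_pyramid e. Proof. by case: GC => ? []. Qed.
Lemma no_prism : ~ has_prism e. Proof. by case: GC => ? [? []]. Qed.
Lemma no_turtle : ~ has_turtle e. Proof. by case: GC => ? [? []]. Qed.

(** With [z] moved onto the hole, the shorter path has the single neighbour [z] on that side. A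
    single neighbour opposite gives a theta, since [z] sees nothing there; an edge gives a
    pyramid. *)
Lemma attach_far_near p q z v r : hole_split q p -> links q p (z :: v :: r) -> far_on z q ->
  single_on (last v r) p \/ edge_on (last v r) p -> False.
Proof.
move=> H lk [s [a [m [b [t [E mn za zb zst]]]]]] near.
have [ipv [vq' zp]] := links_behead lk E.
have [ipw _ off wq wp] := lk.
have H' : hole_split ((rcons s a) ++ z :: b :: t) p.
  rewrite cat_rcons; apply: (@hole_split_replace s a m b t) => //; first by rewrite -E.
  move=> y yin; apply: off; first exact: mem_head.
  by rewrite E -!(cat_cons, catA).
rewrite -cat_rcons in vq'.
have vp x y : x \in v :: r -> y \in p -> x != y /\ e x y = (x == last x (v :: r)) && e (last v r) y.
  move=> xw yp; have xin : x \in z :: v :: r by rewrite inE xw orbT.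
  split; first by apply: off => //; rewrite mem_cat yp orbT.
  have /= := wp x y xin yp; case: eqP => [->|nx] //.
  by case: (e x y) => // /(_ isT).
case: near => [[s' [c [t' [E' lc]]]]|[s' [c [d [t' [E' lc]]]]]].
  apply: no_theta; apply: (@theta_base _ e e_sym e_irr (rcons s a) z (b :: t) s' c t' (v :: r)) => //.
  - by rewrite -E'.
  - by apply: zp; rewrite E' mem_cat inE eqxx orbT.
  - by move=> x y xw; rewrite -E' => yp; have [-> ->] := vp x y xw yp; rewrite lc.
apply: no_pyramid; apply: (@pyramid_base _ e e_sym e_irr (rcons s a) z (b :: t) s' c d t' (v :: r)) => //.
- by rewrite -E'.
- by rewrite size_rcons /=; clear; lia.
- by rewrite /=; clear; lia.
- by move=> x y xw; rewrite -E' => yp; have [-> ->] := vp x y xw yp; rewrite lc.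
Qed.

(** Exactly two such neighbours would give a theta. The third one is what a turtle asks for. *)
Lemma far_third p q u : hole_split p q -> far_on u p ->
  (forall y, y \in p ++ q -> u != y) -> (forall y, y \in q -> ~~ e u y) ->
  2 < #|[set y in p | e u y]|.
Proof.
move=> H [s [a [m [b [t [E mn ua ub ust]]]]]] off uq; have [ipp _ _ _] := H.
have [hm|/hasPn hm] := boolP (has (e u) m); last first.
  case: no_theta; apply: (@two_nbrs_theta s a m b t q u) => //; first by rewrite -E.
  - move=> y; rewrite -E => yp; split; first by apply: off; rewrite mem_cat yp.
    have nab x : ~~ e u x -> (x == a) || (x == b) = false.
      by move=> ux; apply/negbTE; apply: contra ux => /orP[] /eqP->.
    move: yp; rewrite E mem_cat !inE mem_cat inE => /or4P[ys|/eqP->|ym|].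
    + by rewrite nab ?(negPf (ust _ _)) ?ust // mem_cat ys.
    + by rewrite ua eqxx.
    + by rewrite nab ?(negPf (hm _ _)) ?hm.
    case/orP=> [/eqP->|yt]; first by rewrite ub eqxx orbT.
    by rewrite nab ?(negPf (ust _ _)) ?ust // mem_cat yt orbT.
  - by move=> y yq; split; [apply: off; rewrite mem_cat yq orbT|apply: uq].
have [c cm uc] := hasP hm.
have up := ipath_uniq e_irr ipp; rewrite E in up.
have : [set a; b; c] \subset [set y in p | e u y].
  apply/subsetP => y; rewrite !inE E mem_cat !inE mem_cat inE.
  by case/orP=> [/orP[]|] /eqP->; rewrite ?eqxx ?cm ?orbT ?ua ?ub ?uc.
move/subset_leq_card; apply: leq_trans.
move: up; rewrite cat_uniq cons_uniq => /and3P[_ _ /andP[am um]].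
move: um; rewrite cat_uniq => /and3P[_ /hasPn bm _].
rewrite setUC cardsU1 cards2 !inE.
have ab : a != b by apply: contraNneq am => ->; rewrite mem_cat inE eqxx orbT.
have ca : c != a by apply: contraNneq am => <-; rewrite mem_cat cm.
have cb : c != b by apply: contraTneq cm => ->; apply: bm; rewrite inE eqxx.
by rewrite (negPf ca) (negPf cb) ab.
Qed.

Lemma rev_path_ends (u l : T) w : exists v r,
  rev (u :: rcons w l) = l :: v :: r /\ last v r = u.
Proof.
rewrite rev_cons rev_rcons rcons_cons; case: (rev w) => [|v r]; first by exists u, [::].
by exists v, (rcons r u); rewrite last_rcons.
Qed.

(* Each end of the path [u :: w] sees one vertex, one edge, or two nonadjacent
   vertices of its side; unless both see one vertex and these are adjacent, every
   combination is a theta, a pyramid or a prism, except that an edge [u :: w] with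
   two wheel ends gives a turtle. *)
Theorem attach p q u w : hole_split p q -> links p q (u :: w) ->
  has (e u) p -> has (e (last u w)) q ->
  exists y z, [/\ y \in p, z \in q, e y z,
    forall y', y' \in p -> e u y' = (y' == y) &
    forall z', z' \in q -> e (last u w) z' = (z' == z)].
Proof.
move=> H lk; have [ipw sw off wp wq] := lk.
have lk' := links_rev lk; have H' := hole_split_sym e_sym H.
case/lastP: w sw lk lk' ipw off wp wq => // w l _ lk lk' ipw off wp wq.
rewrite last_rcons in wq *.
have [v [r [Er lr]]] := rev_path_ends u l w; rewrite Er in lk'.
have [v' [r' [Er' lr']]] : exists v' r', u :: rcons w l = u :: v' :: r' /\ last v' r' = l.
  by case: (w) => [|x t]; [exists l, [::]|exists x, (rcons t l); rewrite /= last_rcons].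
case/on_cases => Np; case/on_cases => Nq.
- have [s [a [t [E Na]]]] := Np; have [s' [c [t' [E' Nc]]]] := Nq.
  exists a, c; have ap : a \in p by rewrite E mem_cat inE eqxx orbT.
  have cq : c \in q by rewrite E' mem_cat inE eqxx orbT.
  split=> //; apply/negPn/negP => nac; apply: no_theta.
  apply: (@theta_base _ e e_sym e_irr s a t s' c t' (u :: rcons w l)) => //.
  + by rewrite -E -E'.
  + by rewrite -E; apply: (links_single lk).
  rewrite -E' => x y xw yq; have := links_single lk' Nc (x := x) (y := y).
  rewrite -Er mem_rev head_rev => /(_ xw yq) [-> ->]; by rewrite /= last_rcons.
- have [s [a [t [E Na]]]] := Np; have [s' [c [d [t' [E' Nc]]]]] := Nq.
  case: no_pyramid.
  apply: (@pyramid_base _ e e_sym e_irr s a t s' c d t' (u :: rcons w l)) => //.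
  + by rewrite -E -E'.
  + by rewrite /= size_rcons; clear; lia.
  + by rewrite /= size_rcons; clear; lia.
  + by rewrite -E; apply: (links_single lk).
  rewrite -E' => x y xw yq; have := links_edge lk' Nc (x := x) (y := y).
  rewrite -Er mem_rev head_rev => /(_ xw yq) [-> ->]; by rewrite /= last_rcons.
- by case: (attach_far_near H' lk' Nq); left; rewrite lr.
- have [s' [c [t' [E' Nc]]]] := Nq; have [s [a [b [t [E Na]]]]] := Np.
  case: no_pyramid.
  apply: (@pyramid_base _ e e_sym e_irr s' c t' s a b t (l :: v :: r)) => //.
  + by rewrite -E -E'.
  + by rewrite -Er (ipath_rev e_sym e_irr).
  + by rewrite /=; clear; lia.
  + by rewrite /=; clear; lia.
  + by rewrite -E'; apply: (links_single lk').
  rewrite -E => x y xw yp; have := links_edge lk Na (x := x) (y := y).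
  by rewrite -mem_rev Er -last_rev Er => /(_ xw yp) [-> ->].
- have [s' [c [d [t' [E' Nc]]]]] := Nq; have [s [a [b [t [E Na]]]]] := Np.
  case: no_prism.
  apply: (@prism_base _ e e_sym e_irr s a b t s' c d t' (u :: rcons w l)) => //.
  + by rewrite -E -E'.
  + by rewrite /= size_rcons.
  + by rewrite -E; apply: (links_edge lk).
  rewrite -E' => x y xw yq; have := links_edge lk' Nc (x := x) (y := y).
  rewrite -Er mem_rev head_rev => /(_ xw yq) [-> ->]; by rewrite /= last_rcons.
- by case: (attach_far_near H' lk' Nq); right; rewrite lr.
- by rewrite Er' in lk; case: (attach_far_near H lk Np); left; rewrite lr'.
- by rewrite Er' in lk; case: (attach_far_near H lk Np); right; rewrite lr'.
have [s [a [m [b [t [E mn ua ub ust]]]]]] := Np.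
rewrite Er' in lk ipw off wp wq.
have [ipv [vp' uq]] := links_behead lk E.
(* Both ends are far. If the path is one edge, this is a turtle. Otherwise [u] is moved onto the
   hole, and the rest of the path has a single neighbour at one end and is far at the other. *)
case: r' => [|v2 r'] in lr' Er' lk ipw off wp wq ipv vp'.
  rewrite /= in lr'; subst v'.
  have lp y : y \in p -> ~~ e l y.
    move=> yp; apply/negP => /(wp l y _ yp); rewrite !inE eqxx orbT => /(_ isT) /= lu.
    by move: (ipath_uniq e_irr ipw); rewrite lu /= inE eqxx.
  case: no_turtle.
  have [ipp ipq _ J] := H.
  have pn := ipath_ne ipp; have qn := ipath_ne ipq.
  have [hp hq] : head u p \in p /\ head u q \in q.
    by case: (p) (q) pn qn => //= x ? [] //= y ? _ _; rewrite !inE !eqxx.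
  have [lap laq] : last u p \in p /\ last u q \in q.
    by case: (p) (q) pn qn => //= x ? [] //= y ? _ _; rewrite !mem_last.
  exists (head u p), (last u p), (head u q), (last u q), p, q, u, l.
  split; first by split; [exact/(indpathP e_sym e_irr)|case: (p) pn].
  split; first by split; [exact/(indpathP e_sym e_irr)|case: (q) qn].
  split.
    apply/setP=> x; rewrite !inE; apply/negP => /andP[xp xq].
    exact: (uniq_cat_notin (hole_split_uniq e_irr H) xp xq).
  split; first by have [_ ->] := J _ _ hp hq; case: (p) (q) pn qn => //= x ? [] //= y ? _ _; rewrite !eqxx.
  split; first by have [_ ->] := J _ _ lap laq; case: (p) (q) pn qn => //= x ? [] //= y ? _ _; rewrite !eqxx orbT.
  split; first exact: (hole_split_hole e_sym e_irr H).
  split; first by move: ipw; rewrite ipath2 => /and3P[].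
  have offb x : x \in [:: u; l] -> x \notin vset p :|: vset q.
    by move=> xw; rewrite !inE -mem_cat; apply/negP => xpq; have /eqP := off x x xw xpq.
  split; first by apply: offb; rewrite inE eqxx.
  split; first by apply: offb; rewrite !inE eqxx orbT.
  split; first by apply: far_third H Np _ uq => y; apply: off; rewrite inE eqxx.
  split; first by apply/setP=> x; rewrite !inE; apply/negP => /andP[/uq/negPf->].
  split; last by apply/setP=> x; rewrite !inE; apply/negP => /andP[/lp/negPf->].
  by apply: far_third H' Nq _ lp => y; rewrite mem_cat orbC -mem_cat; apply: off; rewrite !inE eqxx orbT.
have Hu : hole_split (s ++ a :: u :: b :: t) q.
  apply: (@hole_split_replace s a m b t) => //; first by rewrite -E.
  move=> y yin; apply: off; first exact: mem_head.
  by rewrite E -!(cat_cons, catA).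
have lku : links (s ++ a :: u :: b :: t) q (v' :: v2 :: r').
  split=> //.
  - move=> x y xw; rewrite mem_cat => /orP[yp|yq]; first by have [] := vp' x y xw yp.
    by apply: off; [rewrite inE xw orbT|rewrite mem_cat yq orbT].
  - by move=> x y xw yp; have [_ ->] := vp' x y xw yp; case/andP=> /eqP.
  - by move=> x y xw yq; apply: (wq x y _ yq); rewrite inE xw orbT.
have := links_rev lku.
have [v3 [r3 [E3 l3]]] : exists v3 r3, rev (v' :: v2 :: r') = l :: v3 :: r3 /\ last v3 r3 = v'.
  rewrite -lr'; case/lastP: (r') => [|r4 l4]; first by exists v', [::].
  by rewrite last_cons last_rcons -rcons_cons; apply: rev_path_ends.
rewrite E3 => lku'; case: (attach_far_near (hole_split_sym e_sym Hu) lku' Nq); left.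
rewrite l3; exists (rcons s a), u, (b :: t); split; first by rewrite cat_rcons.
by move=> y yin; have [||_ ->] := vp' v' y; rewrite ?inE ?eqxx.
Qed.
End Attachments.

(** * Extracting induced paths; holes across a separator *)

Section Connections.
Variables (T : finType) (e : rel T).
Hypotheses (e_sym : symmetric e) (e_irr : irreflexive e).

Notation ipath := (ipath e).
Notation hole_split := (hole_split e).

(** By induction: the shortened tail is cut at its last vertex that is equal or adjacent to [x]. *)
Lemma shorten_ipath x s : path e x s ->
  exists t, [/\ ipath (x :: t), last x t = last x s & {subset x :: t <= x :: s}].
Proof.
elim: s x => [|y s IH] x; first by exists [::]; split.
case/andP=> exy /IH[t [ipt lt st]].
have : has [pred z | (z == x) || e x z] (y :: t) by rewrite /= exy orbT.
case/split_last=> u [z [v [E /orP Pz Pv]]].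
have ipz : ipath (z :: v) by apply: (@ipath_catr _ e e_irr u); rewrite -?E.
have lz : last x (z :: v) = last y s by rewrite -lt -[last y t]/(last x (y :: t)) E last_cat.
have sz : {subset z :: v <= y :: s} by move=> w wz; apply: st; rewrite E mem_cat wz orbT.
case: (eqVneq z x) Pz ipz lz sz => [->|zx] Pz ipz lz sz.
  exists v; split=> // w; rewrite !inE => /orP[->//|wv]; have := sz w; rewrite !inE wv orbT.
  by move=> /(_ isT) ->; rewrite orbT.
case: Pz => // exz; exists (z :: v); split=> //.
  rewrite ipath2 exz ipz andbT; apply/allP => w /Pv /=; rewrite negb_or eq_sym => /andP[? ?].
  by rewrite /nonadj; apply/andP.
by move=> w; rewrite in_cons => /orP[/eqP->|/sz]; rewrite (in_cons x) ?eqxx // => ->; rewrite orbT.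
Qed.

Definition within (X : pred T) (x y : T) : bool := [&& e x y, X x & X y].

Lemma within_sym X x y : connect (within X) x y = connect (within X) y x.
Proof. by apply: sym_connect_sym => u v; rewrite /within e_sym [X u && _]andbC. Qed.

Lemma within_closed X x y : connect (within X) x y -> X x -> X y.
Proof.
case/connectP=> s + ->; elim: s x => //= y' s IH x /andP[/and3P[_ _ Xy] /IH H] _.
exact: H.
Qed.

Lemma path_within (X : pred T) x s z : path e x s -> all X (x :: s) -> z \in x :: s ->
  connect (within X) x z.
Proof.
elim: s x => [|y s IH] x; first by rewrite inE => _ _ /eqP->; apply: connect0.
case/andP=> exy pys /andP[Xx al]; rewrite in_cons => /orP[/eqP->|zin].
  exact: connect0.
have Xy : X y by case/andP: al.
by apply: connect_trans (IH _ pys al zin); apply: connect1; rewrite /within exy Xx Xy.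
Qed.

(** An induced path from [x] to [y] is cut at its last vertex in [al], and the remainder at its
    first vertex in [be]; hence only the two ends, which may coincide, satisfy these predicates. *)
Lemma conn_ipath (X al be : pred T) x y : connect (within X) x y -> X x -> al x -> be y ->
  exists d0 d, [/\ ipath (d0 :: d), forall u, u \in d0 :: d -> X u /\ connect (within X) x u,
    al d0 /\ be (last d0 d),
    forall u, u \in d0 :: d -> al u -> u = d0 &
    forall u, u \in d0 :: d -> be u -> u = last d0 d].
Proof.
case/connectP=> s ps -> Xx ax bl.
have alX : all X (x :: s).
  rewrite /= Xx; elim: s x ps {Xx ax bl} => //= z s IH x /andP[/and3P[_ _ ->] /IH]; exact.
have pes : path e x s by apply: sub_path ps => u v /and3P[].
have [t [ipt lt st]] := shorten_ipath pes; rewrite -lt in bl.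
have pr u : u \in x :: t -> X u /\ connect (within X) x u.
  by move=> /st us; split; [apply: (allP alX)|apply: path_within us].
have : has al (x :: t) by rewrite /= ax.
case/split_last=> u [d0 [v [E a0 av]]].
have : has be (d0 :: v).
  apply/hasP; exists (last x t) => //.
  by rewrite -[last x t]/(last x (x :: t)) E last_cat /= mem_last.
case/split_first=> u' [z [v' [E' bz bu]]].
have ipz : ipath (rcons u' z).
  apply: (@ipath_catl _ e e_irr _ v'); first by rewrite -size_eq0 size_rcons.
  by rewrite cat_rcons -E'; apply: (@ipath_catr _ e e_irr u); rewrite -?E.
have sub w : w \in rcons u' z -> w \in d0 :: v.
  by rewrite E' mem_rcons mem_cat !inE => /orP[]->; rewrite ?orbT.
have [d Ed] : exists d, rcons u' z = d0 :: d.
  by case: (u') E' => [|k l] /= [-> _]; [exists [::]|exists (rcons l z)].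
have lz : last d0 d = z by rewrite -[LHS]/(last d0 (d0 :: d)) -Ed last_rcons.
exists d0, d; rewrite lz -Ed; split=> //.
- by move=> w /sub wd; apply: pr; rewrite E mem_cat wd orbT.
- by move=> w /sub; rewrite inE => /orP[/eqP->//|/av/negPf->].
- by move=> w; rewrite mem_rcons inE => /orP[/eqP->//|/bu/negPf->].
Qed.

Lemma hole_split_shiftl s1 s2 q : s2 != [::] -> hole_split (s1 ++ s2) q -> hole_split s2 (rev s1 ++ q).
Proof.
move=> n2 /(hole_split_rev e_sym e_irr); rewrite rev_cat => /(hole_split_shift e_sym e_irr).
by rewrite rev_nil => /(_ n2) /(hole_split_rev e_sym e_irr); rewrite rev_cat !revK.
Qed.

Definition anticomplete (A B : {set T}) := forall x y, x \in A -> y \in B ->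
  x != y /\ ~~ e x y.

Lemma anticomplete_sym A B : anticomplete A B -> anticomplete B A.
Proof. by move=> H x y xB yA; have [] := H y x yA xB; rewrite eq_sym e_sym. Qed.

(* The hole [a], [s], [b], [rev q], with one side in [A] and the other in [B]. *)
Definition sep_hole (A B : {set T}) a b s q := [/\ hole_split (a :: s) (rcons q b),
  s != [::], q != [::], {subset s <= A} & {subset q <= B}].

Section Splits.
Variables (A B : {set T}) (a b : T) (s q : seq T).
Hypothesis H : sep_hole A B a b s q.

Lemma sep_hole_split00 : hole_split s (a :: rcons q b).
Proof. by case: H => H1 sn _ _ _; apply: (@hole_split_shiftl [:: a] s). Qed.

Lemma sep_hole_split11 : hole_split (a :: rcons s b) q.
Proof.
case: H => H1 _ qn _ _; apply: (hole_split_sym e_sym).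
have := hole_split_sym e_sym H1; rewrite -cats1 => /(hole_split_shift e_sym e_irr) => /(_ qn).
by rewrite cats1.
Qed.

(** The Booleans, read by [nseq] as 0 or 1, say which of [a] and [b] go with [s]. In applications
    the choice follows the neighbourhoods of the ends of an attached path. *)
Lemma sep_hole_split (b1 b2 : bool) : hole_split (nseq b1 a ++ s ++ nseq b2 b) (nseq (~~ b1) a ++ q ++ nseq (~~ b2) b).
Proof.
case: b1 b2 => [] [] /=; rewrite ?cats0 ?cats1.
- exact: sep_hole_split11.
- by case: H.
- by apply: (@hole_split_shiftl [:: a]); [rewrite -size_eq0 size_rcons|exact: sep_hole_split11].
- exact: sep_hole_split00.
Qed.

Lemma sep_hole_ip : ipath (a :: rcons s b). Proof. by case: sep_hole_split11. Qed.
Lemma sep_hole_ip2 : ipath (a :: rcons q b). Proof. by case: sep_hole_split00. Qed.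

Lemma sep_hole_swap : sep_hole B A a b q s.
Proof.
case: H => H1 ? ? ? ?; split=> //; apply: (hole_split_sym e_sym).
by apply: (@hole_split_shiftl [:: a]); [rewrite -size_eq0 size_rcons|exact: sep_hole_split11].
Qed.

Lemma sep_hole_rev : sep_hole A B b a (rev s) (rev q).
Proof.
case: H => H1 sn qn sA qB; split; rewrite ?rev_nil //.
- rewrite -rev_cons -rev_rcons; apply: (hole_split_rev e_sym e_irr).
  by case: sep_hole_swap => /(hole_split_sym e_sym).
- by move=> x; rewrite mem_rev; apply: sA.
- by move=> x; rewrite mem_rev; apply: qB.
Qed.

Lemma sep_hole_nonadj : a != b /\ ~~ e a b.
Proof.
have := sep_hole_ip; case: H => _ sn _ _ _; case: s sn => // x t _.
rewrite rcons_cons ipath2 => /and3P[_ /allP/(_ b)]; rewrite mem_rcons inE eqxx.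
by move=> /(_ isT) /andP[].
Qed.

End Splits.

Lemma sep_hole_middle A B a b s1 s2 s3 q : sep_hole A B a b (s1 ++ s2 ++ s3) q ->
  s2 != [::] -> hole_split s2 (rev s1 ++ (a :: rcons q b) ++ rev s3).
Proof.
move=> /sep_hole_split00 H n2; apply: (hole_split_shiftl n2).
apply: (hole_split_shift e_sym e_irr); last by rewrite -catA.
by rewrite -size_eq0 size_cat addn_eq0 !size_eq0 negb_and n2 orbT.
Qed.

(** Since no edge joins [A] to [B], any two induced paths from [a] to [b] through them close up to a
    hole. This is what allows one side to be exchanged while the other stays. *)
Lemma sep_hole_intro A B a b s q : anticomplete A B -> s != [::] -> q != [::] ->
  {subset s <= A} -> {subset q <= B} -> ipath (a :: rcons s b) -> ipath (a :: rcons q b) ->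
  sep_hole A B a b s q.
Proof.
move=> AB sn qn sA qB ips ipq; split=> //.
have ipas : ipath (a :: s) by apply: (@ipath_catl _ e e_irr _ [:: b]); rewrite // cats1.
have ipqb : ipath (rcons q b).
  by apply: (@ipath_catr _ e e_irr [:: a]); rewrite // -size_eq0 size_rcons.
split=> //.
  by rewrite size_rcons; case: s q sn qn {ips ipq sA qB ipas ipqb} => [|? ?] [|? ?] //= _ _; lia.
move=> x y; rewrite inE mem_rcons inE => xin yin.
have ua := ipath_uniq e_irr ips; have uq := ipath_uniq e_irr ipq.
have as1 x' : x' \in a :: s -> x' != b /\ e x' b = (x' == last a s).
  move=> xs; have := ips; rewrite -cats1 -cat_cons => /(ipath_cat e_irr)[] // _ _ J.
  by have [||-> ->] := J x' b; rewrite ?inE //= eqxx andbT.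
have aq1 y' : y' \in rcons q b -> a != y' /\ e a y' = (y' == head b q).
  move=> yq; have := ipq; rewrite -cat1s => /(ipath_cat e_irr)[] //.
    by rewrite -size_eq0 size_rcons.
  move=> _ _ J; have [||-> ->] := J a y'; rewrite ?inE ?eqxx //=.
  by split=> //; case: (q) qn.
have hq : (x == head x (a :: s)) && (y == head y (rcons q b)) = (x == a) && (y == head b q).
  by rewrite /=; case: (q) qn.
rewrite hq last_rcons [last x _]/=.
have nas z : z \in s -> (z == a) = false.
  by move=> zs; apply/negbTE; apply: contraTneq ua => <-; rewrite /= mem_rcons inE zs orbT.
have nqb z : z \in q -> (z == b) = false.
  by move=> zs; apply/negbTE; apply: contraTneq uq => <-; rewrite /= rcons_uniq zs andbF.
case/orP: yin => [/eqP->|yq].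
  have [|-> ->] := as1 x; first by rewrite inE.
  split=> //; rewrite eqxx andbT [b == _]eq_sym (nqb (head b q)) ?andbF //.
  by case: (q) qn => //= z l _; rewrite inE eqxx.
case/orP: xin => [/eqP->|xs].
  have [|-> ->] := aq1 y; first by rewrite mem_rcons inE yq orbT.
  by rewrite eqxx (nqb y yq) andbF orbF.
rewrite (nas x xs) (nqb y yq) andbF.
by have [-> /negPf->] := AB x y (sA _ xs) (qB _ yq).
Qed.

End Connections.

(** * Paths from [c3] to the hole *)

Section Links.
Variables (T : finType) (e : rel T).
Hypotheses (e_sym : symmetric e) (e_irr : irreflexive e) (GC : in_classC e).

Notation ipath := (ipath e).
Notation hole_split := (hole_split e).
Notation sep_hole := (sep_hole e).
Notation within := (within e).

Definition hset (s t : seq T) : {set T} := [set x in s ++ t].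

Lemma hsetC s t : hset s t = hset t s.
Proof. by apply/setP=> x; rewrite !inE !mem_cat orbC. Qed.

Lemma hset_rev s t : hset (rev s) (rev t) = hset s t.
Proof. by apply/setP=> x; rewrite !inE !mem_cat !mem_rev. Qed.

Definition free (S : {set T}) (x : T) : bool := (x \notin S) && [forall y in S, ~~ e x y].

Lemma freeP (S : {set T}) x : reflect (x \notin S /\ forall y, y \in S -> ~~ e x y) (free S x).
Proof.
by apply: (iffP andP) => -[? H]; split=> //; [apply/forall_inP|apply/forall_inP].
Qed.

(* Some path from [c] to [c3] has its interior disjoint from [S] and without neighbours in
   [S], the set of interior vertices of the two sides. *)
Definition linked (S : {set T}) c3 c := exists2 u, connect (within (free S)) c3 u & e c u.

(* The last clause is what remains of [c3] being central: a vertex next to [c3] never ends a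
   path from [c3] to a side. *)
Definition setup (L R : {set T}) c1 c2 hl hr c3 := [/\ anticomplete e L R,
  sep_hole L R c1 c2 hl hr, [/\ c1 \notin L :|: R, c2 \notin L :|: R & c3 \notin L :|: R],
  free (hset hl hr) c3 &
  (forall y, y \in L -> e c3 y -> ~~ has (e y) hl) /\
  (forall y, y \in R -> e c3 y -> ~~ has (e y) hr)].

(** With [setup_rev], the two symmetries that let later statements be proved for one side and one
    end only. *)
Lemma setup_swap L R c1 c2 hl hr c3 : setup L R c1 c2 hl hr c3 -> setup R L c1 c2 hr hl c3.
Proof.
case=> LR H cs f3 [cL cR]; split=> //; first exact: anticomplete_sym.
- exact: sep_hole_swap.
- by rewrite setUC.
- by rewrite hsetC.
Qed.

Lemma setup_rev L R c1 c2 hl hr c3 : setup L R c1 c2 hl hr c3 ->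
  setup L R c2 c1 (rev hl) (rev hr) c3.
Proof.
case=> LR H [? ? ?] f3 [cL cR]; split=> //; first exact: sep_hole_rev.
- by rewrite hset_rev.
- by split=> y yL e3y; rewrite has_rev; [apply: cL|apply: cR].
Qed.

Section OneSetup.
Variables (L R : {set T}) (c1 c2 : T) (hl hr : seq T) (c3 : T).
Hypothesis St : setup L R c1 c2 hl hr c3.
Notation S := (hset hl hr).

Lemma free_hl x y : free S x -> y \in hl -> ~~ e x y.
Proof. by move=> /freeP[_ H] yl; apply: H; rewrite inE mem_cat yl. Qed.

Lemma free_hr x y : free S x -> y \in hr -> ~~ e x y.
Proof. by move=> /freeP[_ H] yl; apply: H; rewrite inE mem_cat yl orbT. Qed.

Lemma free_L x : x \in L -> x \notin hl -> ~~ has (e x) hl -> free S x.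
Proof.
have [LR [_ _ _ lL rR] _ _ _] := St => xL xl /hasPn xnl; apply/freeP; split.
  rewrite inE mem_cat (negPf xl) /=; apply/negP => /rR xR.
  by have [/eqP] := LR x x xL xR.
move=> y; rewrite inE mem_cat => /orP[/xnl //|/rR yR].
by have [] := LR x y xL yR.
Qed.

Lemma step_free y : y \in L -> e c3 y -> free S y.
Proof.
have [_ _ _ f3 [cL _]] := St => yL e3y; apply: free_L => //; last exact: cL.
by apply: contraL e3y; apply: free_hl.
Qed.

Lemma first_nbr : exists2 y, y \in hl & e c1 y.
Proof.
have [_ H _ _ _] := St; have [_ ln _ _ _] := H.
have := sep_hole_ip e_sym e_irr H; case: (hl) ln => // y t _ /and3P[e1y _ _].
by exists y; rewrite ?inE ?eqxx.
Qed.

Lemma last_nbr : exists2 y, y \in hl & e c2 y.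
Proof.
have [_ H _ _ _] := St; have [_ ln _ _ _] := H.
have := sep_hole_ip e_sym e_irr (sep_hole_rev e_sym e_irr H).
have := rev_nil hl; case E: (rev hl) => [|y t] + /= ; first by rewrite eqxx (negPf ln).
by move=> _ /and3P[e1y _ _]; exists y; rewrite // -mem_rev E inE eqxx.
Qed.

Lemma free_neq1 y : free S y -> y != c1.
Proof.
move=> fy; apply: contraTneq fy => ->.
by have [z zl e1z] := first_nbr; apply: contraL e1z => /free_hl; apply.
Qed.

Lemma free_neq2 y : free S y -> y != c2.
Proof.
move=> fy; apply: contraTneq fy => ->.
by have [z zl e1z] := last_nbr; apply: contraL e1z => /free_hl; apply.
Qed.

(** A path from [c1] to [c2] through free vertices forms a theta with the two sides of the hole. *)
Lemma both_linked : linked S c3 c1 -> linked S c3 c2 -> False.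
Proof.
case=> u cu e1 [v cv e2].
have [LR H [n1 n2 n3] f3 _] := St; have [H1 ln rn lL rR] := H.
have [c12 ec12] := sep_hole_nonadj e_sym e_irr H.
have cuv : connect (within (free S)) u v.
  by apply: connect_trans cv; rewrite (within_sym e_sym).
have fu : free S u := within_closed cu f3.
have [d0 [d [ipd fd [a0 bl] ua ub]]] := conn_ipath e_irr cuv fu e1 e2.
apply: (no_theta GC); rewrite -cats1 in H1.
have off x y : x \in d0 :: d -> y \in c1 :: hl ++ hr ++ [:: c2] -> x != y.
  move=> xd; have [fx _] := fd x xd; rewrite !inE !mem_cat inE.
  case/or4P=> [/eqP->|yl|yr|/eqP->].
  - exact: free_neq1.
  - by apply: contraTneq fx => ->; apply/negP => /freeP[]; rewrite inE mem_cat yl.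
  - by apply: contraTneq fx => ->; apply/negP => /freeP[]; rewrite inE mem_cat yr orbT.
  - exact: free_neq2.
apply: (@theta_base _ e e_sym e_irr [::] c1 hl hr c2 [::] (d0 :: d)) => //= x y xd yin.
  split; first by apply: off; rewrite // -cat_cons mem_cat yin.
  have [fx _] := fd x xd.
  move: yin; rewrite inE; case: (eqVneq y c1) => [->|yc] /= yl; last first.
    by rewrite andbF; apply/negbTE/free_hl.
  rewrite andbT; apply/idP/eqP => [|->]; last by rewrite e_sym.
  by rewrite e_sym; apply: ua.
split; first by apply: off; rewrite // inE mem_cat yin !orbT.
have [fx _] := fd x xd.
move: yin; rewrite mem_cat inE; case: (eqVneq y c2) => [->|yc] /= yl; last first.
  by rewrite andbF; apply/negbTE/free_hr => //; rewrite orbF in yl.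
rewrite andbT; apply/idP/eqP => [|->]; last by rewrite e_sym.
by rewrite e_sym; apply: ub.
Qed.

Lemma ipath_path x s : ipath (x :: s) -> path e x s.
Proof. by elim: s x => //= y s IH x /and3P[-> _ /IH]. Qed.

Lemma avoid_path y s t : path e y s -> all (fun x => ~~ has (e x) t) (belast y s) ->
  forall x, x \in s -> x \notin t.
Proof.
elim: s y => //= z s IH y /andP[eyz pzs] /andP[/hasPn ny al] x.
rewrite inE => /orP[/eqP->|xs]; last exact: (IH z).
by apply: contraL eyz => /ny.
Qed.

Lemma reach_facts ps : path_through e L hl c3 ps -> exists ps0 pk,
  [/\ ps = rcons ps0 pk, ps0 != [::], ipath (c3 :: ps), {subset ps <= L} &
   [/\ forall x, x \in c3 :: ps0 -> free S x /\ connect (within (free S)) c3 x,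
       pk \notin S & has (e pk) hl]].
Proof.
have [LR [_ ln rn lL rR] _ f3 [cL _]] := St.
case=> /(indpathP e_sym e_irr) ipp [/allP pL [al hl3]].
have psn : ps != [::].
  by apply: contraTneq hl3 => -> /=; apply/hasPn => y; apply: free_hl.
have pth := ipath_path ipp; have av := avoid_path pth al.
case/lastP: ps psn ipp pL al hl3 pth av => // ps0 pk _ ipp pL al hl3 pth av.
rewrite belast_rcons in al; rewrite last_rcons in hl3.
have ps0L x : x \in ps0 -> x \in L by move=> xp; apply: pL; rewrite mem_rcons inE xp orbT.
exists ps0, pk; split=> //.
  (* Were [ps0] empty, [pk] would be a neighbour of [c3] with a neighbour in [hl], which [setup]
     forbids. *)
  apply: contraTneq hl3 => p0; apply: cL; first by apply: pL; rewrite mem_rcons mem_head.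
  by move: pth; rewrite p0 /= andbT.
have fr : all (free S) (c3 :: ps0).
  rewrite /= f3; apply/allP => x xp; apply: free_L; first exact: ps0L.
    by apply: av; rewrite mem_rcons inE xp orbT.
  by apply: (allP al); rewrite inE xp orbT.
split=> //.
  move=> x xp; split; first exact: (allP fr).
  by apply: path_within fr xp; move: pth; rewrite rcons_path => /andP[].
rewrite inE mem_cat negb_or av ?mem_rcons ?mem_head //=.
apply/negP => /rR kR; have [|/eqP//] := LR pk pk _ kR.
by apply: pL; rewrite mem_rcons mem_head.
Qed.

(** For nonadjacent [c1] and [c2] this says that they are at distance at least three through [L] and
    through [R]. *)
Definition common_free := forall u, u \in L :|: R -> ~~ (e c1 u && e c2 u).

(* [attach] applies to the path from [c1] along the link to the far end of [ps]. *)
Lemma linked_reach ps : common_free -> linked S c3 c1 -> ~ linked S c3 c2 ->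
  path_through e L hl c3 ps ->
  ~~ e c2 (last c3 ps) /\ (e c1 (last c3 ps) \/
    forall y, y \in hl -> e (last c3 ps) y = (y == head c1 hl)).
Proof.
move=> CF [u cu e1] nl2 /reach_facts[ps0 [pk [E n0 ipp pL [fr kS khl]]]].
rewrite E last_rcons; have [LR H [n1 n2 n3] f3 _] := St; have [H1 ln rn lL rR] := H.
have kL : pk \in L by apply: pL; rewrite E mem_rcons mem_head.
have [e1k|e1k] := boolP (e c1 pk).
  split; last by left.
  by have := CF pk; rewrite inE kL e1k => /(_ isT).
have [r Er] : exists r, r \in c3 :: ps0 /\ e pk r.
  exists (last c3 ps0); rewrite mem_last; split=> //; rewrite e_sym.
  by have := ipath_path ipp; rewrite E rcons_path => /andP[].
have [rp ekr] := Er; have [fr' cr] := fr r rp.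
have cur : connect (within (free S)) u r.
  by apply: connect_trans cr; rewrite (within_sym e_sym).
have fu : free S u := within_closed cu f3.
have [d0 [d [ipd fd [a0 bl] ua ub]]] := conn_ipath e_irr cur fu e1 ekr.
have fdk x : x \in d0 :: d -> free S x /\ ~~ e c2 x.
  move=> xd; have [fx cx] := fd x xd; split=> //.
  by apply/negP => e2x; apply: nl2; exists x => //; apply: connect_trans cx.
have kfree : ~~ free S pk.
  by have [y yl eky] := hasP khl; apply: contraL eky => /free_hl; apply.
have ipw : ipath (rcons (d0 :: d) pk).
  rewrite -cats1; apply/(ipath_cat e_irr) => //; split=> // x y xd; rewrite inE => /eqP->.
  have [fx _] := fdk x xd; rewrite /= eqxx andbT e_sym; split.
    by apply: contraTneq fx => ->.
  by apply/idP/eqP => [/(ub x xd)//|->].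
have kc1 : pk != c1 by apply: contraNneq n1 => <-; rewrite inE kL.
have kc2 : pk != c2 by apply: contraNneq n2 => <-; rewrite inE kL.
have nS x y : x \notin S -> y \in S -> x != y by move=> xS yS; apply: contraNneq xS => ->.
have [H01 _ _ _ _] := sep_hole_swap e_sym e_irr H.
have clP y : y \in c1 :: hr -> y = c1 \/ y \in hr by rewrite inE => /orP[/eqP|]; [left|right].
(* [c1] is placed with [hr] and [c2] with [hl]: in the first part [d0] sees only [c1] and [pk] sees
   nothing, while all free vertices of the path miss the second part, as [c2] is not linked. *)
have lk : links e (c1 :: hr) (rcons hl c2) (d0 :: rcons d pk).
  split=> //; first by rewrite /= size_rcons.
  - move=> x y; rewrite -rcons_cons mem_rcons in_cons => xd.
    rewrite mem_cat mem_rcons !in_cons => yin.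
    have {}yin : [\/ y = c1, y = c2 | y \in S].
      case/orP: yin => [/orP[/eqP|yr]|/orP[/eqP|yl]].
      + by constructor 1.
      + by constructor 3; rewrite inE mem_cat yr orbT.
      + by constructor 2.
      + by constructor 3; rewrite inE mem_cat yl.
    case/orP: xd => [/eqP->|/fdk[fx _]]; case: yin => [->|->|yS] //.
    + exact: nS.
    + exact: free_neq1.
    + exact: free_neq2.
    + by apply: nS yS; case/freeP: fx.
  - move=> x y; rewrite -rcons_cons mem_rcons in_cons => /orP[/eqP->|xd] /clP[->|yr].
    + by rewrite e_sym (negPf e1k).
    + by have [_ /negPf->] := LR pk y kL (rR _ yr).
    + by rewrite e_sym => /(ua x xd).
    + by have [fx _] := fdk x xd; rewrite (negPf (free_hr fx yr)).
  - move=> x y; rewrite -rcons_cons mem_rcons in_cons last_rcons => /orP[/eqP->//|xd].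
    have [fx e2x] := fdk x xd; rewrite mem_rcons inE => /orP[/eqP->|yl].
      by rewrite e_sym (negPf e2x).
    by rewrite (negPf (free_hl fx yl)).
have := attach e_sym e_irr GC H01 lk; rewrite last_rcons has_rcons khl orbT.
case=> [|//|y [z [yin zin eyz Ny Nz]]]; first by rewrite /= e_sym a0.
have yc : c1 = y by apply/eqP; rewrite -Ny ?mem_head // e_sym.
subst y; have [x xl ekx] := hasP khl.
have zx : x = z by apply/eqP; rewrite -Nz // mem_rcons inE xl orbT.
subst z; split.
  rewrite e_sym Nz ?mem_rcons ?mem_head //; apply: contraNneq n2 => ->.
  by rewrite inE lL.
have xh : x = head c1 hl.
  have := sep_hole_ip e_sym e_irr H; case E': (hl) xl => [//|z t] xl /and3P[_ /allP al _].
  move: xl; rewrite inE => /orP[/eqP//|xt]; have := al x.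
  by rewrite mem_rcons inE xt orbT /nonadj eyz andbF => /(_ isT).
by right=> y yl; rewrite Nz ?xh // mem_rcons inE yl orbT.
Qed.

Lemma mem_nseq_b (b : bool) (c x : T) : (x \in nseq b c) = b && (x == c).
Proof. by case: b; rewrite //= inE. Qed.

End OneSetup.

Lemma ipath_around (L R : {set T}) c (p q : seq T) : anticomplete e L R -> c \notin L :|: R ->
  {subset p <= L} -> {subset q <= R} -> p != [::] ->
  ipath (c :: p) -> ipath (c :: q) -> ipath (rev p ++ c :: q).
Proof.
move=> LR cn pL qR pn ipp ipq; have := ipp; rewrite -cat1s => /(ipath_cat e_irr)[] // _ ip0 J.
apply/(ipath_cat e_irr); rewrite ?rev_nil //; split; rewrite ?(ipath_rev e_sym e_irr) //.
move=> x y; rewrite mem_rev last_rev => xp; rewrite inE => /orP[/eqP->|yq].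
  by have [||+ +] := J c x; rewrite ?inE ?eqxx //= andbT eq_sym e_sym => -> ->.
have [-> /negPf->] := LR x y (pL _ xp) (qR _ yq); split=> //.
rewrite andbC /=; apply/esym/negbTE; rewrite negb_and; apply/orP; left.
by apply: contraNneq cn => <-; rewrite inE (qR _ yq) orbT.
Qed.

(* Unless the ends of the path through [c3] share a neighbour among [c1], [c2], the hole
   splits into two paths separating their neighbourhoods. *)
Lemma unlinked_reach L R c1 c2 hl hr c3 ps qs : setup L R c1 c2 hl hr c3 ->
  ~ linked (hset hl hr) c3 c1 -> ~ linked (hset hl hr) c3 c2 ->
  path_through e L hl c3 ps -> path_through e R hr c3 qs ->
  e c1 (last c3 ps) && e c1 (last c3 qs) || e c2 (last c3 ps) && e c2 (last c3 qs).
Proof.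
move=> St nl1 nl2 Rp Rq; have St' := setup_swap St.
have [ps0 [pk [Ep pn0 ipp pL [fp kS khl]]]] := reach_facts St Rp.
have [qs0 [qk [Eq qn0 ipq qR [fq qS qhr]]]] := reach_facts St' Rq.
rewrite (hsetC hr) in qS fq.
rewrite Ep Eq !last_rcons; apply/negPn/negP => nor.
have [LR H [n1 n2 n3] f3 _] := St; have [_ ln rn lL rR] := H.
have pne : rev (rcons ps0 pk) ++ c3 :: rcons qs0 qk = pk :: (rev ps0 ++ c3 :: rcons qs0 qk).
  by rewrite rev_rcons.
have ipw : ipath (pk :: (rev ps0 ++ c3 :: rcons qs0 qk)).
  rewrite -pne -Ep -Eq; apply: ipath_around LR n3 pL qR _ ipp ipq.
  by rewrite Ep -size_eq0 size_rcons.
have kL : pk \in L by apply: pL; rewrite Ep mem_rcons mem_head.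
have qkR : qk \in R by apply: qR; rewrite Eq mem_rcons mem_head.
have wP x : x \in pk :: (rev ps0 ++ c3 :: rcons qs0 qk) ->
   [\/ x = pk, x = qk | [/\ free (hset hl hr) x, ~~ e c1 x & ~~ e c2 x]].
  have U z : free (hset hl hr) z /\ connect (within (free (hset hl hr))) c3 z ->
       [/\ free (hset hl hr) z, ~~ e c1 z & ~~ e c2 z].
    move=> [fz cz]; split=> //; apply/negP => ez; [apply: nl1|apply: nl2];
      by exists z.
  rewrite inE => /orP[/eqP|]; first by constructor 1.
  rewrite mem_cat inE mem_rev mem_rcons inE => /or4P[xp|/eqP->|/eqP|xq].
  - by constructor 3; apply/U/fp; rewrite inE xp orbT.
  - by constructor 3; apply/U/fp; rewrite inE eqxx.
  - by constructor 2.
  - by constructor 3; apply/U/fq; rewrite inE xq orbT.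
have nS x y : x \notin hset hl hr -> y \in hset hl hr -> x != y.
  by move=> xS yS; apply: contraNneq xS => ->.
have inLn x y : x \in L :|: R -> y \notin L :|: R -> x != y.
  by move=> xS; apply: contraNneq => <-.
have kLR : pk \in L :|: R by rewrite inE kL.
have qLR : qk \in L :|: R by rewrite inE qkR orbT.
(* Each of [c1], [c2] goes with [hl] exactly when [pk] sees it. By the negated conclusion [qk] then
   does not, so each end sees its own part only. *)
pose b1 := e c1 pk; pose b2 := e c2 pk.
have H1 := sep_hole_split e_sym e_irr H b1 b2.
have lk : links e (nseq b1 c1 ++ hl ++ nseq b2 c2) (nseq (~~ b1) c1 ++ hr ++ nseq (~~ b2) c2)
   (pk :: (rev ps0 ++ c3 :: rcons qs0 qk)).
  split=> //.
  - by rewrite /= size_cat /= size_rcons addnS.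
  - move=> x y /wP xw; rewrite !mem_cat !mem_nseq_b => yin.
    have {yin} : [\/ y = c1, y = c2 | y \in hset hl hr].
      rewrite inE mem_cat.
      case: eqP yin => [|_]; first by constructor 1.
      case: eqP => [|_]; first by constructor 2.
      by rewrite !andbF /= !orbF => ?; constructor 3.
    case: xw => [->|->|[fx _ _]]; case=> [->|->|yS].
    + exact: inLn.
    + exact: inLn.
    + exact: nS.
    + exact: inLn.
    + exact: inLn.
    + exact: nS.
    + exact: free_neq1 St _ fx.
    + exact: free_neq2 St _ fx.
    + by apply: nS yS; case/freeP: fx.
  - move=> x y /wP xw; rewrite !mem_cat !mem_nseq_b => yin exy.
    case: xw => [//|Ex|[fx e1x e2x]]; first subst x.
      case/or3P: yin => [/andP[b1t /eqP Ey]|yl|/andP[b2t /eqP Ey]].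
      + by case/negP: nor; rewrite -/b1 b1t /= -Ey (e_sym y qk) exy.
      + by have [_ /negP[]] := LR y qk (lL _ yl) qkR; rewrite e_sym.
      + by case/negP: nor; rewrite -/b2 b2t /= -Ey (e_sym y qk) exy orbT.
    case/or3P: yin => [/andP[_ /eqP Ey]|yl|/andP[_ /eqP Ey]].
    + by case/negP: e1x; rewrite -Ey e_sym.
    + by case/negP: (free_hl fx yl).
    + by case/negP: e2x; rewrite -Ey e_sym.
  move=> x y /wP xw; rewrite !mem_cat !mem_nseq_b => yin exy.
  rewrite /= last_cat /= last_rcons.
  case: xw => [Ex|//|[fx e1x e2x]]; first subst x.
    case/or3P: yin => [/andP[b1t /eqP Ey]|yl|/andP[b2t /eqP Ey]].
    + by case/negP: b1t; rewrite /b1 -Ey e_sym.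
    + by have [_ /negP[]] := LR pk y kL (rR _ yl).
    + by case/negP: b2t; rewrite /b2 -Ey e_sym.
  case/or3P: yin => [/andP[_ /eqP Ey]|yl|/andP[_ /eqP Ey]].
  + by case/negP: e1x; rewrite -Ey e_sym.
  + by case/negP: (free_hr fx yl).
  + by case/negP: e2x; rewrite -Ey e_sym.
have := attach e_sym e_irr GC H1 lk; rewrite last_cat /= last_rcons.
case.
- by rewrite !has_cat khl orbT.
- by rewrite !has_cat qhr orbT.
move=> y [z [yin zin eyz Ny Nz]].
(* The unique neighbours are forced to be those in [hl] and in [hr], so an edge would join [L] to
   [R]. *)
have [y' y'l eky] := hasP khl; have [z' z'r eqz] := hasP qhr.
have := Ny y'; rewrite !mem_cat y'l orbT eky => /(_ isT)/esym/eqP Ey; subst y'.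
have := Nz z'; rewrite !mem_cat z'r orbT eqz => /(_ isT)/esym/eqP Ez; subst z'.
by have [_ /negP[]] := LR y z (lL _ y'l) (rR _ z'r).
Qed.

(** The vertex following [c3] is still free, so a shorter path would link [c3] to [c2]. With two
    interior vertices the second one must touch [hl], and the path is itself a leg ending next to
    [c2]. *)
Lemma side_far L R c1 c2 hl hr c3 p : setup L R c1 c2 hl hr c3 ->
  ~ linked (hset hl hr) c3 c2 -> all (mem L) p -> ipath (c3 :: p ++ [:: c2]) ->
  2 <= size p /\ (size p = 2 ->
    exists ps, path_through e L hl c3 ps /\ e c2 (last c3 ps)).
Proof.
move=> St nl2; have [_ _ _ f3 [cL _]] := St.
have nl u : connect (within (free (hset hl hr))) c3 u -> ~~ e c2 u.
  by move=> cu; apply/negP => e2; apply: nl2; exists u.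
case: p => [|y [|x p]].
- by move=> _ /andP[e32 _]; case/negP: (nl c3 (connect0 _ _)); rewrite e_sym.
- rewrite /= !andbT => yL /and3P[e3y _ ey2].
  have fy := step_free St yL e3y.
  have cy : connect (within (free (hset hl hr))) c3 y by apply: connect1; rewrite /within e3y f3 fy.
  by case/negP: (nl y cy); rewrite e_sym.
move=> al ipp; split=> // -[/size0nil p0]; subst p.
move: al ipp => /= /and3P[yL xL _]; rewrite !andbT.
case/and5P=> e3y /andP[n3x _] eyx _ ex2.
have fy := step_free St yL e3y.
have cy : connect (within (free (hset hl hr))) c3 y by apply: connect1; rewrite /within e3y f3 fy.
have xhl : x \notin hl by apply: contraL eyx => /(free_hl fy).
have [hx|hx] := boolP (has (e x) hl); last first.
  have fx := free_L St xL xhl hx.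
  have cx : connect (within (free (hset hl hr))) c3 x.
    by apply: connect_trans cy _; apply: connect1; rewrite /within eyx fx fy.
  by case/negP: (nl x cx); rewrite e_sym.
exists [:: y; x]; split; last by rewrite /= e_sym.
split; first by apply/(indpathP e_sym e_irr); rewrite /= e3y n3x eyx.
split; first by rewrite /= yL xL.
split=> //=; rewrite andbT; apply/andP; split; apply/hasPn => z zl; [exact: free_hl f3 zl|exact: free_hl fy zl].
Qed.

Lemma far_dist L R c1 c2 hl hr c3 p : setup L R c1 c2 hl hr c3 ->
  ~ linked (hset hl hr) c3 c2 -> LR_path e L R c3 c2 p ->
  2 <= size p /\ (size p = 2 ->
    (exists ps, path_through e L hl c3 ps /\ e c2 (last c3 ps)) \/
    (exists qs, path_through e R hr c3 qs /\ e c2 (last c3 qs))).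
Proof.
move=> St nl2 [[] al /(indpathP e_sym e_irr) ipp].
  by have [? H] := side_far St nl2 al ipp; split=> // /H; left.
rewrite hsetC in nl2.
by have [? H] := side_far (setup_swap St) nl2 al ipp; split=> // /H; right.
Qed.

Lemma reach_last L R c1 c2 hl hr c3 ps : setup L R c1 c2 hl hr c3 ->
  path_through e L hl c3 ps -> last c3 ps \in L.
Proof.
move=> St /(reach_facts St)[ps0 [pk [E _ _ pL _]]].
by rewrite E last_rcons; apply: pL; rewrite E mem_rcons mem_head.
Qed.

(** The bound comes from [far_dist]: two interior vertices would form a leg ending next to [c2]. If
    [c1] is linked, [linked_reach] for this leg forbids it; otherwise [unlinked_reach], with this
    leg in place of the given one on its side, yields a common neighbour of [c1] and [c2]. *)
Lemma far_pair L R c1 c2 hl hr c3 ps qs : setup L R c1 c2 hl hr c3 ->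
  common_free L R c1 c2 -> ~ linked (hset hl hr) c3 c2 ->
  path_through e L hl c3 ps -> path_through e R hr c3 qs ->
  linked (hset hl hr) c3 c1 \/
    ~ linked (hset hl hr) c3 c1 /\ e c1 (last c3 ps) && e c1 (last c3 qs) ->
  [/\ ~~ e c2 (last c3 ps), ~~ e c2 (last c3 qs),
    e c1 (last c3 ps) \/ forall y, y \in hl -> e (last c3 ps) y = (y == head c1 hl),
    e c1 (last c3 qs) \/ forall y, y \in hr -> e (last c3 qs) y = (y == head c1 hr) &
    forall p, LR_path e L R c3 c2 p -> 3 <= size p].
Proof.
move=> St CF nl2 Rp Rq; have St' := setup_swap St.
have nl2' : ~ linked (hset hr hl) c3 c2 by rewrite hsetC.
have CF' : common_free R L c1 c2 by move=> u; rewrite setUC; apply: CF.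
have CFL u : u \in L -> e c1 u -> ~~ e c2 u.
  by move=> uL e1; have := CF u; rewrite inE uL e1 => /(_ isT).
have CFR u : u \in R -> e c1 u -> ~~ e c2 u.
  by move=> uR e1; have := CF u; rewrite inE uR orbT e1 => /(_ isT).
case=> [l1|[nl1 /andP[e1p e1q]]].
  have l1' : linked (hset hr hl) c3 c1 by rewrite hsetC.
  have [p2 p1] := linked_reach St CF l1 nl2 Rp.
  have [q2 q1] := linked_reach St' CF' l1' nl2' Rq.
  split=> // p pp; have [p2' pE] := far_dist St nl2 pp.
  move: p2'; rewrite leq_eqVlt => /orP[/eqP/esym sp|//].
  case: (pE sp) => -[ps' [Rp' e2]].
    by have [/negP[]] := linked_reach St CF l1 nl2 Rp'.
  by have [/negP[]] := linked_reach St' CF' l1' nl2' Rp'.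
have pL := reach_last St Rp; have qR := reach_last St' Rq.
split; [exact: CFL|exact: CFR|by left|by left|].
move=> p pp; have [p2' pE] := far_dist St nl2 pp.
move: p2'; rewrite leq_eqVlt => /orP[/eqP/esym sp|//].
case: (pE sp) => -[ps' [Rp' e2]].
  have := unlinked_reach St nl1 nl2 Rp' Rq; rewrite (negPf (CFR _ qR e1q)) andbF orbF.
  by case/andP=> /(CFL _ (reach_last St Rp')); rewrite e2.
have := unlinked_reach St nl1 nl2 Rp Rp'; rewrite (negPf (CFL _ pL e1p)) /= orbF.
by case/andP=> _ /(CFR _ (reach_last St' Rp')); rewrite e2.
Qed.

End Links.

(** * Heavy vertices *)

Section Positions.
Variables (T : finType) (e : rel T) (x0 : T) (h : seq T) (v : T).
Hypothesis h_gt0 : 0 < size h.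
Notation N := (size h).
Notation hv := (hv x0 h).
Notation g t := (e v (hv t)).

Lemma hv_mod k : hv (k %% N) = hv k.
Proof. by rewrite /Defs.hv modn_mod. Qed.

Lemma hvDN k : hv (k + N) = hv k.
Proof. by rewrite -hv_mod modnDr hv_mod. Qed.

Lemma hv_modD i k : hv (i %% N + k) = hv (i + k).
Proof. by rewrite -hv_mod modnDml hv_mod. Qed.

Lemma mem_hv k : hv k \in h.
Proof. by rewrite mem_nth // ltn_mod. Qed.

Lemma hv_onto z : z \in h -> exists2 t, t < N & z = hv t.
Proof.
move=> zh; exists (index z h); first by rewrite index_mem.
by rewrite /Defs.hv modn_small ?index_mem // nth_index.
Qed.

(** Unrolls the cycle: every vertex has a position in any window of [N] consecutive integers
    starting below [N], so positions can be compared without [%%]. *)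
Lemma hv_window z A : z \in h -> A < N -> exists2 t, A <= t < A + N & z = hv t.
Proof.
case/hv_onto=> t tN -> AN; case: (leqP A t) => At; first by exists t => //; move: AN tN At; clear; lia.
by exists (t + N); rewrite ?hvDN //; move: AN tN At; clear; lia.
Qed.

(* The sector runs from the last neighbour of [v] at a position at most [A + 1 + N] round to
   the first one at a position at least [A + 2]. *)
Lemma not_distant A B : 4 + A <= B -> B <= N -> major e x0 h v ->
  (forall t, A.+1 < t -> t.+1 < B -> ~~ g t) ->
  (g A.+1 -> g A) -> (g B.-1 -> g B) ->
  exists i m, [/\ sector e x0 h v i m, hv A \in ext_nbhd e x0 h v i m &
    hv B \in ext_nbhd e x0 h v i m].
Proof.
move=> AB BN [_ [/hasP[z0 z0h ez0] maj]] nog gA gB.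
have A2N : A.+2 < N by move: AB BN; clear; lia.
have [t0 t0P z0E] := hv_window z0h A2N.
have exP : exists t, (A.+2 <= t) && g t.
  by exists t0; rewrite -z0E ez0 andbT; case/andP: t0P.
have exQ : exists t, (t <= A.+1 + N) && g t.
  by exists t0; rewrite -z0E ez0 andbT; move: t0P; clear; lia.
have ubQ t : (t <= A.+1 + N) && g t -> t <= A.+1 + N by case/andP.
case: (ex_minnP exP) => f /andP[Af gf] minf.
case: (ex_maxnP exQ ubQ) => i /andP[iA gi] maxi.
have fB : B.-1 <= f.
  rewrite leqNgt; apply/negP => fB; have fB' : f.+1 < B by move: fB; clear; lia.
  by rewrite (negPf (nog f Af fB')) in gf.
have ft0 : f <= t0 by apply: minf; rewrite -z0E ez0 andbT; case/andP: t0P.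
have t0i : t0 <= i by apply: maxi; rewrite -z0E ez0 andbT; move: t0P; clear; lia.
(* Otherwise all neighbours of [v] stand at positions [f] and [f.+1], inside one three-vertex
   subpath, and [v] is not major. *)
have fi : f.+2 <= i.
  rewrite leqNgt; apply/negP => ifl.
  have [|z zh [ez]] := maj (f %% N); first by rewrite ltn_mod.
  have [t tP zE] := hv_window zh A2N.
  have ft : f <= t by apply: minf; rewrite -zE ez andbT; case/andP: tP.
  have ti : t <= i by apply: maxi; rewrite -zE ez andbT; move: tP; clear; lia.
  have : t = f \/ t = f.+1 by move: ft ti ifl; clear; lia.
  have E : hv (f %% N).+1 = hv f.+1 by rewrite -addn1 hv_modD addn1.
  rewrite zE !inE !negb_or E hv_mod.
  by case=> -> /and3P[_]; rewrite ?eqxx // => _; rewrite eqxx.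
(* The sector occupies the unrolled positions from [i] to [f + N]. *)
exists (i %% N), (f + N - i).+1.
have inarc k : k <= f + N - i -> hv (i + k) \in ext_nbhd e x0 h v (i %% N) (f + N - i).+1.
  move=> kf; rewrite inE; apply/orP; left; rewrite inE /arc; apply/mapP; exists k.
    by rewrite mem_iota add0n ltnS kf.
  by rewrite hv_modD.
split.
- split; first by rewrite ltn_mod.
  split; first by move: iA Af; clear; lia.
  split; first by move: fi Af iA; clear; lia.
  split; first by rewrite hv_mod.
  split.
    rewrite hv_modD /= subnKC ?hvDN //; first by move: iA Af; clear; lia.
  move=> k k0 /= kf; rewrite hv_modD; apply/negP => gk.
  case: (leqP (i + k) (A.+1 + N)) => ikA.
    by have := maxi (i + k); rewrite ikA gk => /(_ isT); move: k0; clear; lia.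
  have E : i + k = (i + k - N) + N by move: ikA; clear; lia.
  have := minf (i + k - N); rewrite E hvDN in gk; rewrite gk andbT.
  by move: k0 kf ikA fi; clear; lia.
(* If the sector starts just after [A], then [A.+1] is a neighbour, hence so is [A] by [gA], and the
   extension contains it. The end at [B] is treated likewise. *)
- case: (ltnP (A + N) i) => iAN.
    have iE : i = A.+1 + N by move: iAN iA; clear; lia.
    have gA1 : g A.+1 by rewrite -hvDN -iE.
    rewrite !inE gA //; apply/orP; right; rewrite andbT; apply/orP; left.
    have -> : (i %% N + N).-1 = i %% N + N.-1 by move: h_gt0; clear; lia.
    rewrite hv_modD iE; have -> : A.+1 + N + N.-1 = A + N + N by move: h_gt0; clear; lia.
    by rewrite !hvDN.
  rewrite -hvDN; have -> : A + N = i + (A + N - i) by move: iAN; clear; lia.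
  by apply: inarc; move: Af; clear; lia.
case: (leqP B f) => Bf.
  rewrite -hvDN; have -> : B + N = i + (B + N - i) by move: AB iA; clear; lia.
  by apply: inarc; move: Bf; clear; lia.
have fE : f = B.-1 by move: Bf fB; clear; lia.
rewrite !inE gB -?fE //; apply/orP; right; rewrite andbT; apply/orP; right.
rewrite hv_modD; have -> : i + (f + N - i).+1 = B + N by rewrite fE; move: AB iA fi; clear; lia.
by rewrite hvDN.
Qed.

(** Positions are unrolled at most once. The last two cases are the vertices added before and after
    the sector. *)
Lemma ext_nbhdP i m p : uniq h -> p < N -> sector e x0 h v i m ->
  hv p \in ext_nbhd e x0 h v i m ->
  [\/ i <= p < i + m, i <= p + N < i + m,
     g p /\ ((i = p.+1) \/ (i = 0 /\ p.+1 = N)) |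
     g p /\ ((i + m = p) \/ (i + m = p + N))].
Proof.
move=> uh pN [iN [m2 [mN _]]].
have E k : k < N + N -> hv k = hv p -> k = p \/ k = p + N.
  move=> kN /eqP; rewrite /Defs.hv nth_uniq ?ltn_mod // (modn_small pN) => /eqP kE.
  case: (ltnP k N) => kN'; first by left; rewrite modn_small in kE.
  right; rewrite -kE -{1}(subnK kN') -{2}(subnK kN') modnDr modn_small //.
  by move: kN kN'; clear; lia.
rewrite inE => /orP[|]; first rewrite inE /arc => /mapP[k].
  rewrite mem_iota add0n => /andP[_ km] /esym/E[|ik|ik]; first by move: iN mN km; clear; lia.
    by constructor 1; move: ik km; clear; lia.
  by constructor 2; move: ik km; clear; lia.
rewrite !inE => /andP[/orP[] /eqP /esym pE gp].
  have [|ik|ik] := E _ _ pE; first by move: iN mN; clear; lia.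
    by constructor 3; split=> //; move: ik h_gt0 iN pN; clear; lia.
  by constructor 3; split=> //; move: ik h_gt0 iN pN; clear; lia.
have [|ik|ik] := E _ _ pE; first by move: iN mN; clear; lia.
  by constructor 4; split=> //; left.
by constructor 4; split=> //; right.
Qed.

(** A sector reaching both 0 and [n.+1] runs along one side and cannot have [jL] or [jR] in its
    interior. So that neighbour ends the sector, and 0 or [n.+1] is reached only as an extension
    next to it, which the hypotheses exclude. *)
Lemma distant_pos n jL jR : uniq h -> n.+2 < N ->
  0 < jL <= n -> g jL -> ~~ ((jL == 1) && g 0) -> ~~ ((jL == n) && g n.+1) ->
  n.+1 < jR < N -> g jR -> ~~ ((jR == N.-1) && g 0) -> ~~ ((jR == n.+2) && g n.+1) ->
  distant e x0 h v (hv 0) (hv n.+1).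
Proof.
move=> uh nN jLn gL L0 Lb jRn gR R0 Rb i m sec [].
have n1N : n.+1 < N by apply: ltnW.
move=> /(ext_nbhdP uh h_gt0 sec) P0 /(ext_nbhdP uh n1N sec) Pb.
have [iN [m2 [mN [gi [gm inn]]]]] := sec.
have I t : t = jL \/ t = jL + N \/ t = jR \/ t = jR + N -> ~ (i < t /\ t.+1 < i + m).
  move=> tE [it tm]; have /negP[] : ~~ g (i + (t - i)).
    by apply: inn; move: it tm; clear; lia.
  rewrite subnKC; last by apply: ltnW.
  by case: tE => [->|[->|[->|->]]]; rewrite ?hvDN.
have I1 := I jL (or_introl erefl); have I2 := I (jL + N) (or_intror (or_introl erefl)).
have I3 := I jR (or_intror (or_intror (or_introl erefl))).
have I4 := I (jR + N) (or_intror (or_intror (or_intror erefl))).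
(* From here on the problem is linear arithmetic on positions, for each value of the two
   Booleans. *)
move: (g 0) (g n.+1) L0 Lb R0 Rb P0 Pb => g0 gb L0 Lb R0 Rb P0 Pb.
move: iN m2 mN I1 I2 I3 I4 L0 Lb R0 Rb P0 Pb jLn jRn nN; clear.
by case: g0 gb => [] []; rewrite ?andbT ?andbF => *;
   repeat match goal with H : _ \/ _ |- _ => destruct H | H : or4 _ _ _ _ |- _ => destruct H | H : _ /\ false = true |- _ => destruct H end; lia.
Qed.

End Positions.

(** * Heaviness expressed on the two sides separately *)

Section Heavy.
Variables (T : finType) (e : rel T).
Hypotheses (e_sym : symmetric e) (e_irr : irreflexive e) (GC : in_classC e).

Notation ipath := (ipath e).
Notation hole_split := (hole_split e).
Notation sep_hole := (sep_hole e).

(* On a hole of a graph in the class whose sides have at least three vertices, [good] is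
   equivalent to heavy ([heavy_good], [good_heavy]); unlike the definition by sectors, it
   treats the two sides separately. *)
Definition side v (a b : T) (s : seq T) : bool :=
  has (fun y => [&& e v y, ~~ ((y == head a s) && e v a) & ~~ ((y == last a s) && e v b)]) s.

Definition good (a b : T) (s q : seq T) (v : T) : bool :=
  [&& v \notin [:: a, b & s ++ q], side v a b s & side v a b q].

Lemma side_rev v a b s : side v b a (rev s) = side v a b s.
Proof.
rewrite /side has_rev; apply: eq_in_has => y ys.
rewrite head_rev last_rev (head_irr b a (mem_ne ys)) (last_irr b a (mem_ne ys)).
by rewrite [_ && (~~ _)]andbC.
Qed.

Lemma good_rev v a b s q : good b a (rev s) (rev q) v = good a b s q v.
Proof.
by rewrite /good !side_rev !inE !mem_cat !mem_rev orbCA.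
Qed.

Lemma good_swap v a b s q : good a b q s v = good a b s q v.
Proof.
by rewrite /good !inE !mem_cat [(v \in q) || _]orbC [side _ _ _ q && _]andbC.
Qed.

Lemma nth_headE (x : T) r t : uniq r -> t < size r -> (nth x r t == head x r) = (t == 0).
Proof.
move=> ur tr; have r0 : 0 < size r by apply: leq_trans tr.
by rewrite -nth0 nth_uniq.
Qed.

Lemma nth_lastE (x : T) r t : uniq r -> t < size r ->
  (nth x r t == last x r) = (t == (size r).-1).
Proof.
move=> ur tr; have r0 : (size r).-1 < size r by move: tr; clear; lia.
by rewrite -nth_last nth_uniq.
Qed.

Section OneHole.
Variables (L R : {set T}) (a b : T) (s q : seq T).
Hypothesis H : sep_hole L R a b s q.
Notation h := (hole_of a b s q).
Notation n := (size s).
Notation m := (size q).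
Notation hv := (hv a h).

Lemma size_hole : size h = n + m + 2.
Proof. by rewrite /hole_of /= size_cat /= size_rev; clear; lia. Qed.

Lemma hv0 : hv 0 = a. Proof. by rewrite /Defs.hv mod0n. Qed.

Lemma hvs t : t < n -> hv t.+1 = nth a s t.
Proof.
move=> tn; rewrite /Defs.hv modn_small; last by rewrite size_hole; move: tn; clear; lia.
by rewrite /hole_of /= nth_cat tn.
Qed.

Lemma hvb : hv n.+1 = b.
Proof.
rewrite /Defs.hv modn_small; last by rewrite size_hole; clear; lia.
by rewrite /hole_of /= nth_cat ltnn subnn.
Qed.

Lemma hvq t : t < m -> hv (n.+2 + t) = nth a q (m - t.+1).
Proof.
move=> tm; rewrite /Defs.hv modn_small; last by rewrite size_hole; move: tm; clear; lia.
rewrite /hole_of addSn /= nth_cat ifF; last by apply/negbTE; clear; lia.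
by rewrite addSn subSn ?leq_addr // addKn /= nth_rev.
Qed.

Lemma hole_uniq : uniq h.
Proof.
have [H1 _ _ _ _] := H; have := hole_split_uniq e_irr H1.
rewrite /hole_of -cat_cons -rev_rcons !cat_uniq rev_uniq => /and3P[-> + ->].
by rewrite andbT /= => /hasPn nh; apply/hasPn => x; rewrite mem_rev; apply: nh.
Qed.

Lemma s_uniq : uniq s.
Proof. by have := hole_uniq; rewrite /hole_of cons_uniq cat_uniq => /and3P[_ -> _]. Qed.

Lemma q_uniq : uniq q.
Proof.
have := hole_uniq; rewrite /hole_of cons_uniq cat_uniq => /and4P[_ _ _].
by rewrite cons_uniq rev_uniq => /andP[].
Qed.

(** If one side has no suitable neighbour, [not_distant], applied to the positions of [a] and [b]
    around that side, contradicts distance. Three vertices on the side are its condition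
    [4 + A <= B]. *)
Lemma heavy_good v : 3 <= n -> 3 <= m -> heavy_wrt e h a b v -> good a b s q v.
Proof.
move=> n3 m3 [maj dis]; have N0 : 0 < size h by [].
have [vh _] := maj.
have -> : good a b s q v = side v a b s && side v a b q.
  rewrite /good (_ : v \notin _ = true) //; move: vh.
  by rewrite /hole_of !inE !mem_cat !inE mem_rev !negb_or => /and4P[-> -> -> ->].
have sE := size_hole.
have g0N : e v (hv (size h)) = e v a.
  by rewrite -[size h]add0n hvDN // hv0.
have nsP (r : seq T) : uniq r -> ~~ side v a b r -> forall t, t < size r -> e v (nth a r t) ->
    (t == 0) && e v a || (t == (size r).-1) && e v b.
  move=> ur /hasPn ns t tr gt; have := ns _ (mem_nth a tr).
  by rewrite gt (nth_headE a ur tr) (nth_lastE a ur tr) /= -negb_or negbK.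
apply/andP; split; apply/negPn/negP => noside.
  have ns := nsP _ s_uniq noside.
  have c1 : 4 + 0 <= n.+1 by move: n3; clear; lia.
  have c2 : n.+1 <= size h by rewrite sE; clear; lia.
  have c3 t : 1 < t -> t.+1 < n.+1 -> ~~ e v (hv t).
    case: t => // t t1 t2; rewrite hvs; last by move: t2; clear; lia.
    apply/negP => /ns; case/(_ _)/orP => [|/andP[/eqP]|/andP[/eqP]];
      by move: t1 t2 n3; clear; lia.
  have c4 : e v (hv 1) -> e v (hv 0).
    rewrite hv0 hvs => [/ns|]; last by move: n3; clear; lia.
    case/(_ _)/orP => [|/andP[_ //]|/andP[/eqP]]; by move: n3; clear; lia.
  have c5 : e v (hv n) -> e v (hv n.+1).
    rewrite hvb -(prednK (_ : 0 < n)); last by move: n3; clear; lia.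
    rewrite hvs => [/ns|]; last by move: n3; clear; lia.
    case/(_ _)/orP => [|/andP[/eqP]|/andP[_ //]]; by move: n3; clear; lia.
  have [i [k [sec]]] := not_distant N0 c1 c2 maj c3 c4 c5.
  by rewrite hv0 hvb => aE bE; case: (dis i k sec).
have ns := nsP _ q_uniq noside.
(* On the second side the window runs from [n.+1] to [size h], a position that denotes [a] again. *)
have c1 : 4 + n.+1 <= size h by rewrite sE; move: m3; clear; lia.
have hvq' t : n.+1 < t -> t < size h -> hv t = nth a q (m - (t - n.+1)) /\ m - (t - n.+1) < m.
  rewrite sE => t1 t2; have -> : t = n.+2 + (t - n.+2) by move: t1; clear; lia.
  rewrite hvq; last by move: t1 t2; clear; lia.
  by split; [congr nth|]; move: t1 t2; clear; lia.
have c3 t : n.+2 < t -> t.+1 < size h -> ~~ e v (hv t).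
  move=> t1 t2; have [||-> tm] := hvq' t; try by move: t1 t2; clear; lia.
  apply/negP => /(ns _ tm); rewrite sE in t2.
  by case/orP => /andP[/eqP]; move: t1 t2 m3; clear; lia.
have c4 : e v (hv n.+2) -> e v (hv n.+1).
  have [||-> tm] := hvq' n.+2; rewrite ?sE; try by move: m3; clear; lia.
  rewrite hvb => /(ns _ tm); case/orP=> /andP[/eqP] //.
  by move: m3; clear; lia.
have c5 : e v (hv (size h).-1) -> e v (hv (size h)).
  have [||-> tm] := hvq' (size h).-1; rewrite ?sE; try by move: m3; clear; lia.
  rewrite -sE g0N => /(ns _ tm); rewrite sE; case/orP=> /andP[/eqP] //.
  by move: m3; clear; lia.
have [i [k [sec]]] := not_distant N0 c1 (leqnn _) maj c3 c4 c5.
rewrite hvb -[size h]add0n hvDN // hv0 => bE aE; exact: (dis i k sec).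
Qed.

End OneHole.

(** The two neighbours of [b] on the hole are joined through [b], through [v] and through the rest
    of the hole. This is the one configuration, up to exchanging [a] and [b], in which a [good]
    vertex could fail to be major. *)
Lemma last_two_theta L R a b s q v : sep_hole L R a b s q -> v \notin [:: a, b & s ++ q] ->
  e v (last a s) -> e v (last a q) ->
  (forall z, z \in [:: a, b & s ++ q] -> e v z -> z = last a s \/ z = last a q) -> False.
Proof.
move=> H vn ey ey' ny; have [H1 sn qn sL qR] := H.
have Hp : hole_split (s ++ b :: rev q) [:: a].
  apply/(is_hole_split e_sym e_irr) => //; first by case: (s) sn.
  have := sep_hole_split00 e_sym e_irr H => /(is_hole_split e_sym e_irr).
  have -> : s ++ rev (a :: rcons q b) = (s ++ b :: rev q) ++ rev [:: a].
    by rewrite rev_cons rev_rcons -cats1 -catA.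
  by apply.
case/lastP: s sn H vn ey ny H1 sL Hp => // s y _ H vn ey ny H1 sL Hp.
case/lastP: q qn H vn ey' ny H1 qR Hp => // q y' _ H vn ey' ny H1 qR Hp.
rewrite !last_rcons in ey ey' ny.
rewrite rev_rcons cat_rcons in Hp.
have offv z : z \in [:: a, b & rcons s y ++ rcons q y'] -> v != z.
  by move=> zin; apply: contraNneq vn => ->.
have [c12 ec12] := sep_hole_nonadj e_sym e_irr H.
have mem z : z \in s ++ y :: b :: y' :: rev q -> z \in [:: a, b & rcons s y ++ rcons q y'].
  rewrite !(mem_cat, in_cons, mem_rcons, mem_rev).
  by case/or4P=> [->|->|->|/orP[->|->]]; rewrite ?orbT.
have ea : ~~ e v a.
  apply/negP => /(ny a); rewrite inE eqxx => /(_ isT) aE.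
  have := hole_split_uniq e_irr Hp; rewrite cat_uniq => /and3P[_ /hasPn/(_ a)].
  rewrite inE eqxx => /(_ isT) /negP[]; rewrite !(mem_cat, in_cons).
  by case: aE => ->; rewrite eqxx ?orbT.
apply: (no_theta GC); apply: (@two_nbrs_theta _ e e_sym e_irr s y [:: b] y' (rev q) [:: a] v) => //.
  move=> z /mem zin; split; first exact: offv.
  apply/idP/orP => [/(ny z zin) [->|->]|[/eqP->|/eqP->]] //.
    by left.
  by right.
move=> z; rewrite inE => /eqP->; split=> //; apply: offv; exact: mem_head.
Qed.

Lemma good_heavy L R a b s q v : sep_hole L R a b s q -> good a b s q v ->
  heavy_wrt e (hole_of a b s q) a b v.
Proof.
move=> H /and3P[vn /hasP[y ys /and3P[ey y1 y2]] /hasP[y' yq /and3P[ey' y1' y2']]].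
pose h := hole_of a b s q; pose n := size s; pose m := size q.
have sE : size h = n + m + 2 by apply: size_hole.
have N0 : 0 < size h by rewrite sE addn2.
have uh : uniq h := hole_uniq H.
pose t := index y s; pose u := index y' q.
have tn : t < n by rewrite index_mem.
have um : u < m by rewrite index_mem.
have yE : y = nth a s t by rewrite nth_index.
have yE' : y' = nth a q u by rewrite nth_index.
(* Positions of [y] and [y'] on the cycle, where [q] is traversed backwards. *)
pose jL := t.+1; pose jR := n.+2 + (m - u.+1).
have hL : hv a h jL = y by rewrite /jL hvs.
have hR : hv a h jR = y'.
  rewrite /jR hvq; last by move: um; rewrite -/m; clear; lia.
  by rewrite yE'; congr nth; move: um; rewrite -/m; clear; lia.
have h0 : hv a h 0 = a := hv0 _ _ _ _.
have hb : hv a h n.+1 = b := hvb _ _ _ _.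
have c1 : n.+2 < size h by rewrite sE; move: um; clear; lia.
have c2 : 0 < jL <= n by [].
have c3 : n.+1 < jR < size h by rewrite /jR sE; move: um; clear; lia.
have d1 : ~~ ((jL == 1) && e v (hv a h 0)).
  by move: y1; rewrite h0; have := nth_headE a (s_uniq H) tn; rewrite -yE => ->.
have d2 : ~~ ((jL == n) && e v (hv a h n.+1)).
  move: y2; rewrite hb; have := nth_lastE a (s_uniq H) tn; rewrite -yE => ->.
  by rewrite /jL -/n (_ : (t.+1 == n) = (t == n.-1)) //; move: tn; clear; lia.
have d3 : ~~ ((jR == (size h).-1) && e v (hv a h 0)).
  move: y1'; rewrite h0; have := nth_headE a (q_uniq H) um; rewrite -yE' => ->.
  by rewrite /jR (_ : (_ == (size h).-1) = (u == 0)) //; rewrite sE; move: um; clear; lia.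
have d4 : ~~ ((jR == n.+2) && e v (hv a h n.+1)).
  move: y2'; rewrite hb; have := nth_lastE a (q_uniq H) um; rewrite -yE' => ->.
  by rewrite /jR -/m (_ : (_ == n.+2) = (u == m.-1)) //; move: um; clear; lia.
have gL : e v (hv a h jL) by rewrite hL.
have gR : e v (hv a h jR) by rewrite hR.
have inh z : (z \in h) = (z \in [:: a, b & s ++ q]).
  rewrite /h /hole_of !(in_cons, mem_cat, mem_rev).
  by case: (z == a); case: (z == b); case: (z \in s); case: (z \in q).
split; last by have := distant_pos N0 uh c1 c2 gL d1 d2 c3 gR d3 d4; rewrite h0 hb.
split; first by rewrite inh.
split; first by apply/hasP; exists y; rewrite // inh !(in_cons, mem_cat) ys !orbT.
move=> i iN; rewrite -/h in iN *.
case: (boolP (has [pred z | e v z & z \notin [:: hv a h (i + size h).-1; hv a h i; hv a h i.+1]] h)).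
  by case/hasP=> z zh /andP[ez zw]; exists z.
move/hasPn=> nw; exfalso.
have W z : z \in h -> e v z -> z \in [:: hv a h (i + size h).-1; hv a h i; hv a h i.+1].
  by move=> zh ez; have := nw z zh; rewrite /= ez negbK.
have E k p : k < size h + size h -> p < size h -> hv a h p = hv a h k -> k = p \/ k = p + size h.
  move=> kN pN /esym /eqP; rewrite /Defs.hv nth_uniq ?ltn_mod // (modn_small pN) => /eqP kE.
  case: (ltnP k (size h)) => kN'; first by left; rewrite modn_small in kE.
  right; rewrite -kE -{1}(subnK kN') -{2}(subnK kN') modnDr modn_small //.
  by move: kN kN'; clear; lia.
have jLN : jL < size h by rewrite sE; move: c2; clear; lia.
have jRN : jR < size h by case/andP: c3.
have P p : p < size h -> e v (hv a h p) ->
    [\/ i = p.+1, (i = 0 /\ p.+1 = size h), i = p | (i.+1 = p \/ i.+1 = p + size h)].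
  move=> pN gp; have := W _ (mem_hv a N0 p) gp; rewrite !inE => /or3P[] /eqP/E [|//|k|k].
  - by move: iN; clear; lia.
  - by case: (i) iN k => [|i'] ? k; [constructor 2|constructor 1]; move: k N0 pN; clear; lia.
  - by constructor 1; move: k N0 pN; clear; lia.
  - by move: iN; clear; lia.
  - by constructor 3.
  - by move: iN k; clear; lia.
  - by move: iN N0; clear; lia.
  - by constructor 4; left.
  - by constructor 4; right.
(* Three consecutive vertices containing a vertex of each side must be centred at [b] or at [a]. *)
have cen : (i = n.+1 /\ jL = n /\ jR = n.+2) \/ (i = 0 /\ jL = 1 /\ jR = (size h).-1).
  have := P jL jLN gL; have := P jR jRN gR; move: c2 c3 c1 iN; clear.
  by move: jL jR => jL jR ? ? ? ? [] ? [] ?; lia.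
have gi : ~~ e v (hv a h i).
  case: cen => -[-> [jLE jRE]].
    by move: d2; rewrite jLE eqxx.
  by move: d1; rewrite jLE.
have only z : z \in h -> e v z -> z = y \/ z = y'.
  move=> zh ez; have := W z zh ez; rewrite -hL -hR !inE.
  case: cen => -[iE [-> ->]]; rewrite iE.
    case/or3P=> /eqP zE.
    - by left; rewrite zE addSn /= hvDN.
    - by case/negP: gi; rewrite iE -zE.
    - by right.
  case/or3P=> /eqP zE.
  - by right; rewrite zE add0n.
  - by case/negP: gi; rewrite iE -zE.
  - by left.
have only' z : z \in [:: a, b & s ++ q] -> e v z -> z = y \/ z = y'.
  by rewrite -inh; apply: only.
case: cen => -[_ [jLE jRE]].
  have yl : y = last a s.
    by rewrite yE -nth_last; congr nth; rewrite -/n; move: jLE; rewrite /jL; clear; lia.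
  have yl' : y' = last a q.
    rewrite yE' -nth_last; congr nth; rewrite -/m; move: jRE um; rewrite /jR; clear; lia.
  by apply: (last_two_theta H vn); rewrite -?yl -?yl'.
have yh : y = head a s by rewrite yE -nth0; congr nth; case: jLE.
have yh' : y' = head a q.
  by rewrite yE' -nth0; congr nth; move: jRE um; rewrite /jR sE; clear; lia.
have sn := mem_ne ys; have qn := mem_ne yq.
apply: (last_two_theta (sep_hole_rev e_sym e_irr H) (v := v)).
- by move: vn; rewrite !inE !mem_cat !mem_rev orbCA.
- by rewrite last_rev -(head_irr a) // -yh.
- by rewrite last_rev -(head_irr a) // -yh'.
- move=> z zin ez; rewrite !last_rev -!(head_irr a b) // -yh -yh'; apply: only' => //.
  by move: zin; rewrite !inE !mem_cat !mem_rev orbCA.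
Qed.

End Heavy.

(** * Same frames and rerouted holes *)

Section Transfer.
Variables (T : finType) (e : rel T).
Hypotheses (e_sym : symmetric e) (e_irr : irreflexive e) (GC : in_classC e).

Notation ipath := (ipath e).
Notation hole_split := (hole_split e).
Notation sep_hole := (sep_hole e).
Notation within := (within e).

Lemma ipath_ends a p b : ipath (a :: rcons p b) -> p != [::] ->
  forall x, x \in p -> e a x = (x == head a p) /\ e b x = (x == last b p).
Proof.
move=> ipp pn x xp; split.
  have := ipp; rewrite -cat1s => /(ipath_cat e_irr)[] //.
    by rewrite -size_eq0 size_rcons.
  move=> _ _ J; have [||_ ->] := J a x; rewrite ?mem_rcons ?inE ?eqxx ?xp ?orbT //=.
  by case: (p) pn.
have := ipp; rewrite -cats1 -cat_cons => /(ipath_cat e_irr)[] // _ _ J.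
have [||_ exb] := J x b; rewrite ?inE ?eqxx ?xp ?orbT //.
by rewrite e_sym exb /= eqxx andbT; case: (p) pn.
Qed.

Lemma ipath_conn (X : pred T) s u w : ipath s -> (forall y, y \in s -> X y) ->
  u \in s -> w \in s -> connect (within X) u w.
Proof.
case: s => // m t /ipath_path pm sX us ws.
have al : all X (m :: t) by apply/allP.
apply: connect_trans (path_within pm al ws).
by rewrite (within_sym e_sym); apply: path_within pm al us.
Qed.

Lemma good_notin L R a b s q v : anticomplete e L R -> sep_hole L R a b s q -> good e a b s q v ->
  v \notin L :|: R.
Proof.
move=> LR [_ _ _ sL qR] /and3P[_ /hasP[y ys /andP[ey _]] /hasP[z zq /andP[ez _]]].
rewrite inE; apply/norP; split; apply/negP => vin.
  by have [_ /negP[]] := LR v z vin (qR _ zq).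
by have [_ /negP[]] := LR y v (sL _ ys) vin; rewrite e_sym.
Qed.

(* Otherwise [v], followed by a path through the old side, attaches to the new hole inside
   the new side and outside it, at separated places. *)
Lemma same_frame_side (L R : {set T}) c1 c2 l1 l2 mid mid0 hr v :
  anticomplete e L R -> c1 \notin L :|: R -> c2 \notin L :|: R ->
  sep_hole L R c1 c2 (l1 :: rcons mid l2) hr -> sep_hole L R c1 c2 (l1 :: rcons mid0 l2) hr ->
  mid != [::] -> mid0 != [::] -> head c1 mid = head c1 mid0 -> last c1 mid = last c1 mid0 ->
  good e c1 c2 (l1 :: rcons mid0 l2) hr v -> side e v c1 c2 (l1 :: rcons mid l2).
Proof.
move=> LR n1 n2 H H0 mn mn0 hE lE gd; apply/negPn/negP => /hasPn bad.
have vLR := good_notin LR H0 gd.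
have [vn /hasP[y ys /and3P[ey y1 y2]] /hasP[z zr /andP[ez _]]] := and3P gd.
have [_ _ rn lL rR] := H; have [_ _ _ lL0 _] := H0.
have ipl := sep_hole_ip e_sym e_irr H; have ipl0 := sep_hole_ip e_sym e_irr H0.
have um : uniq (l1 :: rcons mid l2) := s_uniq e_irr H.
have um0 : uniq (l1 :: rcons mid0 l2) := s_uniq e_irr H0.
have badP x : x \in l1 :: rcons mid l2 -> e v x ->
    (x == l1) && e v c1 || (x == l2) && e v c2.
  by move=> xl ex; have := bad x xl; rewrite ex /= last_rcons -negb_or negbK.
have notmid x : x \in mid -> ~~ e v x.
  move=> xm; apply/negP => /(badP x _); rewrite inE mem_rcons inE xm !orbT => /(_ isT).
  have x1 : x != l1 by apply: contraTneq um => <-; rewrite /= mem_rcons inE xm orbT.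
  have x2 : x != l2 by apply: contraTneq um => <-; rewrite /= rcons_uniq xm andbF.
  by rewrite (negPf x1) (negPf x2).
have m0l x : x \in mid0 -> (x != l1) && (x != l2).
  move=> xm; apply/andP; split.
    by apply: contraTneq um0 => <-; rewrite /= mem_rcons inE xm orbT.
  by apply: contraTneq um0 => <-; rewrite /= rcons_uniq xm andbF.
have m0bad x : x \in mid0 -> x \in l1 :: rcons mid l2 -> ~~ e v x.
  move=> /m0l/andP[x1 x2] xl; apply/negP => /(badP x xl).
  by rewrite (negPf x1) (negPf x2).
(* [l1] and [l2] are common to both sides; as a witness for the old side either would be one for the
   new side. *)
have ym : y \in mid0.
  move: ys; rewrite inE mem_rcons inE => /or3P[/eqP yE|/eqP yE|//].
    have := badP y; rewrite {1}yE mem_head ey => /(_ isT isT); move: y1.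
    rewrite /= yE !eqxx /= => /negPf-> /= /andP[/eqP l12 _].
    by move: um; rewrite l12 /= mem_rcons mem_head.
  have := badP y; rewrite {1}yE inE mem_rcons mem_head orbT ey => /(_ isT isT); move: y2.
  rewrite /= last_rcons yE !eqxx /= => /negPf->; rewrite orbF => /andP[/eqP l12 _].
  by move: um; rewrite l12 /= mem_rcons mem_head.
(* Vertices of the new side itself are included because the old interior may meet it, for instance
   in the last vertex of [mid0]. *)
pose be u := (u \in l1 :: rcons mid l2) || has (e u) (l1 :: rcons mid l2).
have conn0 u w : u \in mid0 -> w \in mid0 -> connect (within (mem mid0)) u w.
  apply: ipath_conn => //; apply: (@ipath_catl _ e e_irr _ [:: l2; c2]) => //.
  apply: (@ipath_catr _ e e_irr [:: c1; l1]); first by case: (mid0).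
  by move: ipl0; rewrite /= -!cats1 -!catA.
have lm0 : last c1 mid0 \in mid0 by case: (mid0) mn0 => //= ? ? _; rewrite mem_last.
have lbe : be (last c1 mid0).
  rewrite /be -lE inE mem_rcons inE (_ : last c1 mid \in mid) ?orbT //.
  by case: (mid) mn => //= ? ? _; rewrite mem_last.
have [d0 [d [ipd fd [a0 bl] ua ub]]] := conn_ipath e_irr (conn0 _ _ ym lm0) ym ey lbe.
have dm x : x \in d0 :: d -> x \in mid0 by move=> /fd[].
(* A meeting point would be the last vertex of the path; its predecessor would already satisfy [be],
   or, lacking one, it would be a neighbour of [v] excluded by [m0bad]. *)
have dnl x : x \in d0 :: d -> x \notin l1 :: rcons mid l2.
  move=> xd; apply/negP => xl; have xE : x = last d0 d by apply: ub; rewrite // /be xl.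
  case/lastP: d ipd fd bl ua ub dm xd xE => [|d k] ipd fd bl ua ub dm xd xE.
    by move: xl; rewrite xE => xl; rewrite (negPf (m0bad d0 (dm _ (mem_head _ _)) xl)) in a0.
  rewrite last_rcons in xE ub; subst x.
  have := ipath_path ipd; rewrite rcons_path => /andP[_ ek].
  have kin : last d0 d \in d0 :: rcons d k by rewrite -rcons_cons mem_rcons inE mem_last orbT.
  have /(ub _ kin) kE : be (last d0 d) by apply/orP; right; apply/hasP; exists k.
  by move: ek; rewrite kE e_irr.
have dL x : x \in d0 :: d -> x \in L.
  by move=> /dm xm; apply: lL0; rewrite inE mem_rcons inE xm !orbT.
have ipm0 : ipath (l1 :: rcons mid0 l2).
  by apply: (@ipath_catr _ e e_irr [:: c1]) => //; apply: (@ipath_catl _ e e_irr _ [:: c2]); rewrite // cats1.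
have dnadj x : x \in d0 :: d -> [/\ ~~ e x c1, ~~ e x c2, ~~ e x l1 & ~~ e x l2].
  move=> xd; have xm := dm x xd; have /andP[x1 x2] := m0l x xm.
  have xl0 : x \in l1 :: rcons mid0 l2 by rewrite inE mem_rcons inE xm !orbT.
  have [] := ipath_ends ipl0 _ xl0 => //; rewrite /= last_rcons (negPf x1) (negPf x2).
  rewrite !(e_sym x) => -> ->.
  have [] := ipath_ends ipm0 mn0 xm; rewrite (head_irr l1 c1 mn0) (last_irr l2 c1 mn0) -hE -lE => -> ->.
  have xnl := dnl x xd; split=> //.
    apply: contraNneq xnl => ->; rewrite inE mem_rcons inE.
    by case: (mid) mn => //= ? ? _; rewrite inE eqxx !orbT.
  apply: contraNneq xnl => ->; rewrite inE mem_rcons inE.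
  by case: (mid) mn => //= ? ? _; rewrite mem_last !orbT.
(* Only [mid] is cut off: [v] sees nothing there, while it may see [l1], [c1], [l2] or [c2]. *)
have Hm : hole_split mid (l1 :: c1 :: rcons (rcons hr c2) l2).
  have H' : sep_hole L R c1 c2 ([:: l1] ++ mid ++ [:: l2]) hr by rewrite cats1.
  by have := sep_hole_middle e_sym e_irr H' mn; rewrite /= cats1.
have notv x : x \in L :|: R -> x != v by move=> xLR; apply: contraNneq vLR => <-.
have lmem x : x \in l1 :: c1 :: rcons (rcons hr c2) l2 ->
    [\/ x = c1, x = c2, x = l1 \/ x = l2 | x \in hr].
  rewrite !(in_cons, mem_rcons).
  by case/or4P=> [/eqP|/eqP|/eqP|/orP[/eqP|]] ?; [constructor 3; left|constructor 1|constructor 3; right|constructor 2|constructor 4].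
have lk : links e (l1 :: c1 :: rcons (rcons hr c2) l2) mid (v :: d0 :: d).
  split=> //.
  - apply: (ipath_consl e_sym e_irr) => // x xd; split.
      by apply: notv; rewrite inE dL.
    rewrite /= e_sym; apply/idP/eqP => [/(ua x xd) //|->//].
  - move=> x w; rewrite inE mem_cat => xin win.
    have {}win : [\/ w = c1, w = c2, w \in l1 :: rcons mid l2 | w \in hr].
      case/orP: win => [/lmem[->|->|[->|->]|wr]|wm]; rewrite ?inE ?mem_rcons ?inE ?eqxx ?orbT.
      - by constructor 1.
      - by constructor 2.
      - by constructor 3.
      - by constructor 3.
      - by constructor 4.
      - by constructor 3; rewrite wm !orbT.
    case/orP: xin => [/eqP->|xd].
      case: win => [->|->|wl|wr].
      - by apply: contraNneq vn => ->; rewrite mem_head.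
      - by apply: contraNneq vn => ->; rewrite !inE eqxx orbT.
      - by rewrite eq_sym notv // inE lL.
      - by rewrite eq_sym notv // inE rR // orbT.
    have xL := dL x xd; case: win => [->|->|wl|wr].
    - by apply: contraNneq n1 => <-; rewrite inE xL.
    - by apply: contraNneq n2 => <-; rewrite inE xL.
    - by apply: contraNneq (dnl x xd) => ->.
    - by have [] := LR x w xL (rR w wr).
  - move=> x w; rewrite inE => /orP[/eqP->//|xd] /lmem win exw; exfalso.
    have [] := dnadj x xd; rewrite /=.
    case: win exw => [->|->|[->|->]|wr] exw; rewrite ?exw //.
    by have [_ /negP[]] := LR x w (dL x xd) (rR w wr).
  - move=> x w; rewrite inE => /orP[/eqP->|xd] wm exw.
      by rewrite (negPf (notmid w wm)) in exw.
    apply: ub => //; apply/orP; right; apply/hasP; exists w => //.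
    by rewrite inE mem_rcons inE wm !orbT.
have zd : last d0 d \in d0 :: d by rewrite mem_last.
have hz : has (e (last d0 d)) mid.
  have := bl; rewrite /be (negPf (dnl _ zd)) /= has_rcons.
  have [_ _ /negPf-> /negPf->] := dnadj _ zd; done.
have := attach e_sym e_irr GC (hole_split_sym e_sym Hm) lk; case=> //.
  by apply/hasP; exists z; rewrite // !(in_cons, mem_rcons) zr !orbT.
move=> y0 [z0 [yin zin eyz Ny _]].
(* The unique neighbour of [v] must be [z], which lies in [R], whereas its partner in [mid] lies in
   [L]. *)
have := Ny z; rewrite !(in_cons, mem_rcons) zr !orbT ez => /(_ isT)/esym/eqP zE; subst y0.
have z0L : z0 \in L by apply: lL; rewrite inE mem_rcons inE zin !orbT.
by have [_ /negP[]] := LR z0 z z0L (rR _ zr); rewrite e_sym.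
Qed.

Lemma ends_decomp (s : seq T) : 3 <= size s -> exists l1 mid l2, s = l1 :: rcons mid l2 /\ mid != [::].
Proof.
case: s => // l1 s; case/lastP: s => // mid l2; rewrite /= size_rcons => sz.
by exists l1, mid, l2; split=> //; case: (mid) sz.
Qed.

Lemma side_frame_ends (x l1 l2 : T) mid : mid != [::] ->
  side_frame x (l1 :: rcons mid l2) = (l1, head x mid, l2, last x mid).
Proof.
move=> mn; rewrite /side_frame /= size_rcons /= last_rcons; congr (_, _, _, _).
  by case: (mid) mn.
by case/lastP: (mid) mn => // m y _; rewrite size_rcons /= !nth_rcons size_rcons ltnSn ltnn eqxx last_rcons.
Qed.

(** The sides are exchanged one after the other, through the hole with the new left side and the old
    right side. Sizes of at least three let the frame determine two vertices at each end of a
    side. *)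
Lemma same_frame_good (L R : {set T}) c1 c2 hl hr hl0 hr0 v :
  anticomplete e L R -> c1 \notin L :|: R -> c2 \notin L :|: R ->
  sep_hole L R c1 c2 hl hr -> sep_hole L R c1 c2 hl0 hr0 ->
  3 <= size hl -> 3 <= size hr -> 3 <= size hl0 -> 3 <= size hr0 ->
  frame_of c1 c2 hl hr = frame_of c1 c2 hl0 hr0 ->
  good e c1 c2 hl0 hr0 v -> good e c1 c2 hl hr v.
Proof.
move=> LR n1 n2 H H0 /ends_decomp[l1 [ml [l2 [El mln]]]] /ends_decomp[r1 [mr [r2 [Er mrn]]]].
move=> /ends_decomp[l1' [ml' [l2' [El' mln']]]] /ends_decomp[r1' [mr' [r2' [Er' mrn']]]].
rewrite El Er El' Er' in H H0 * => {El Er El' Er'}.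
rewrite /frame_of !side_frame_ends // => -[hlE ?]; subst l1' => ? hrE ll; subst r1' => ? lr ?; subst l2' r2'.
move=> gd; have LR' := anticomplete_sym e_sym LR.
have [_ ln rn lL rR] := H; have [_ ln0 rn0 lL0 rR0] := H0.
have H1 : sep_hole L R c1 c2 (l1 :: rcons ml l2) (r1 :: rcons mr' r2).
  apply: (sep_hole_intro e_irr LR) => //; first exact: (sep_hole_ip e_sym e_irr H).
  exact: (sep_hole_ip2 e_sym e_irr H0).
have vLR := good_notin LR H0 gd.
have s1 := same_frame_side LR n1 n2 H1 H0 mln mln' hlE ll gd.
have [vn _ s0] := and3P gd.
have vn2 : (v != c1) && (v != c2).
  by move: vn; rewrite !in_cons !negb_or => /and3P[-> ->].
have off X Y : {subset X <= L} -> {subset Y <= R} -> v \notin [:: c1, c2 & X ++ Y].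
  move=> XL YR; rewrite !in_cons !negb_or andbA vn2 /= mem_cat; apply/negP => /orP[/XL|/YR] vin;
    by move: vLR; rewrite inE vin ?orbT.
have gd1 : good e c1 c2 (l1 :: rcons ml l2) (r1 :: rcons mr' r2) v.
  by apply/and3P; split=> //; apply: off.
apply/and3P; split=> //; first exact: off.
apply: (same_frame_side LR' _ _ (sep_hole_swap e_sym e_irr H) (sep_hole_swap e_sym e_irr H1)) => //.
- by rewrite setUC.
- by rewrite setUC.
- by rewrite good_swap.
Qed.

(* The new side runs from [c3] along [rcons ps0 pk], enters [hl] at the neighbour [x]
   of [pk] closest to [c2], and follows [hl] to [c2]. *)
Definition arm (L : {set T}) (hl : seq T) (S : {set T}) c2 c3 ps0 pk pre x xs :=
  [/\ [/\ hl = pre ++ x :: xs, e pk x & forall y, y \in xs -> ~~ e pk y],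
    xs != [::] /\ ps0 != [::], ipath (c3 :: rcons ps0 pk), {subset rcons ps0 pk <= L} &
    [/\ forall u, u \in c3 :: ps0 -> free e S u /\ ~~ e c2 u, pk \notin S & ~~ e c2 pk]].

(** * The hole rerouted through [c3] *)

Section NewHole.
Variables (L R : {set T}) (c1 c2 : T) (hl hr : seq T) (c3 : T).
Hypothesis St : setup e L R c1 c2 hl hr c3.
Notation S := (hset hl hr).
Variables (ps0 : seq T) (pk : T) (pre : seq T) (x : T) (xs : seq T).
Hypothesis Al : arm L hl S c2 c3 ps0 pk pre x xs.
Notation hl' := (rcons ps0 pk ++ x :: xs).

Lemma arm_sub : {subset hl' <= L}.
Proof.
have [_ [_ _ _ lL _] _ _ _] := St; have [[E _ _] _ _ pL _] := Al.
move=> u; rewrite mem_cat => /orP[/pL //|uxs]; apply: lL.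
by rewrite E mem_cat uxs orbT.
Qed.

Lemma arm_x : [/\ x \in hl, {subset xs <= hl}, {subset pre <= hl} & uniq hl].
Proof.
have [_ H _ _ _] := St; have [[E _ _] _ _ _ _] := Al; rewrite {1 2 3}E.
split; first by rewrite mem_cat inE eqxx orbT.
- by move=> u; rewrite mem_cat inE => ->; rewrite !orbT.
- by move=> u; rewrite mem_cat => ->.
exact: (s_uniq e_irr H).
Qed.

(** As [x] is the last neighbour of [pk] on [hl], the edge from [pk] to [x] is the only one between
    the leg and the kept tail. *)
Lemma arm_ipath : ipath (c3 :: rcons hl' c2).
Proof.
have [LR H [n1 n2 n3] f3 _] := St; have [[E ekx nxs] [xsn psn] ipp pL [fp kS ek2]] := Al.
have [_ _ _ lL rR] := H; have [xhl xshl prehl uhl] := arm_x.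
have ipx : ipath (rcons (x :: xs) c2).
  have ipl := sep_hole_ip e_sym e_irr H; rewrite E rcons_cat in ipl.
  by apply: (@ipath_catr _ e e_irr (c1 :: pre)).
rewrite -cats1 -catA cats1 -cat_cons; apply/(ipath_cat e_irr) => //; split=> // u w.
rewrite inE mem_rcons inE => uin.
have uP : u = pk \/ u \in c3 :: ps0.
  by move: uin; rewrite inE => /or3P[/eqP->|/eqP->|->]; [right|left|right]; rewrite ?eqxx ?orbT.
have uLR : u \notin hl /\ u != c2.
  case: uP => [->|/fp[fu _]].
    split; first by move: kS; rewrite inE mem_cat => /norP[].
    by apply: contraNneq n2 => <-; rewrite inE pL ?mem_rcons ?mem_head.
  split; last exact: free_neq2 St _ fu.
  by case/freeP: fu; rewrite inE mem_cat => /norP[].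
rewrite mem_rcons in_cons => win.
have wP : w = c2 \/ w \in hl.
  case/orP: win => [/eqP->|]; first by left.
  by rewrite inE => /orP[/eqP->|/xshl]; right.
split; first by case: wP => [->|wl]; [case: uLR|apply: contraNneq (uLR.1) => ->].
have hE : head w (rcons (x :: xs) c2) = x by [].
rewrite hE [last _ _]/= last_rcons.
have [-> {uP}|[uk fu e2u]] : u = pk \/ [/\ (u == pk) = false, free e S u & ~~ e c2 u].
    case: uP => [->|up]; first by left.
    have [fu e2] := fp u up; right; split=> //; apply/negbTE/eqP => uE.
    by move: (ipath_uniq e_irr ipp); rewrite -rcons_cons rcons_uniq -uE up.
  rewrite eqxx /=; case/orP: win => [/eqP->|].
    rewrite e_sym (negPf ek2); apply/esym/negbTE.
    by apply: contraNneq n2 => ->; rewrite inE lL.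
  rewrite inE; case: eqP => [->|_] //= wxs; exact/negbTE/nxs.
rewrite uk /=; case: wP => [->|wl]; first by rewrite e_sym (negPf e2u).
exact/negbTE/(free_hl fu).
Qed.

End NewHole.

Section NewHole2.
Variables (L R : {set T}) (c1 c2 : T) (hl hr : seq T) (c3 : T).
Hypothesis St : setup e L R c1 c2 hl hr c3.
Notation S := (hset hl hr).
Variables (ps0 : seq T) (pk : T) (pre : seq T) (x : T) (xs : seq T).
Hypothesis Al : arm L hl S c2 c3 ps0 pk pre x xs.
Variables (qs0 : seq T) (qk : T) (preR : seq T) (xR : T) (xsR : seq T).
Hypothesis Ar : arm R hr S c2 c3 qs0 qk preR xR xsR.
Notation hl' := (rcons ps0 pk ++ x :: xs).
Notation hr' := (rcons qs0 qk ++ xR :: xsR).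

Let Ar' : arm R hr (hset hr hl) c2 c3 qs0 qk preR xR xsR.
Proof. by rewrite hsetC. Qed.

Lemma new_chole : sep_hole L R c3 c2 hl' hr'.
Proof.
have [LR _ _ _ _] := St; have St' := setup_swap e_sym e_irr St.
apply: (sep_hole_intro e_irr LR).
- by case: (ps0).
- by case: (qs0).
- by move=> u; apply: (arm_sub St Al).
- by move=> u; apply: (arm_sub St' Ar').
- exact: (arm_ipath St Al).
- exact: (arm_ipath St' Ar').
Qed.

Lemma transfer_side v : good e c1 c2 hl hr v -> side e v c3 c2 hl'.
Proof.
move=> gd; apply/negPn/negP => /hasPn bad.
have [LR H [n1 n2 n3] f3 _] := St; have [_ ln rn lL rR] := H.
have [[E ekx nxs] [xsn psn] ipp pL [fp kS ek2]] := Al.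
have [[E' eqx nxsR] [xsRn qsn] ipq qR [fq qS eq2]] := Ar.
have vLR := good_notin LR H gd.
have [vn /hasP[y ys /and3P[ey y1 y2]] /hasP[z zr /and3P[ez z1 z2]]] := and3P gd.
have H' := new_chole.
have ipl := sep_hole_ip e_sym e_irr H; have ipr := sep_hole_ip2 e_sym e_irr H.
have [xhl xshl prehl uhl] := arm_x St Al; have St' := setup_swap e_sym e_irr St.
have [xhr xshr prehr uhr] := arm_x St' Ar'.
have ul' : uniq hl' := s_uniq e_irr H'.
have psh : head c3 hl' \in ps0 by case: (ps0) psn => //= ? ? _; rewrite inE eqxx.
have lasth : last c3 hl' \in xs by rewrite last_cat; case: (xs) xsn => //= ? ? _; rewrite mem_last.
have lastE : last c3 hl' = last c1 hl by rewrite E !last_cat /=; case: (xs) xsn.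
have psnhl u : u \in rcons ps0 pk -> u \notin hl.
  rewrite mem_rcons inE => /orP[/eqP->|up]; first by move: kS; rewrite inE mem_cat => /norP[].
  have [|/freeP[uS _] _] := fp u; first by rewrite inE up orbT.
  by move: uS; rewrite inE mem_cat => /norP[].
have badP u : u \in hl' -> e v u -> (u == head c3 hl') && e v c3 || (u == last c3 hl') && e v c2.
  by move=> ul eu; have := bad u ul; rewrite eu /= -negb_or negbK.
have ypre : y \in pre.
  move: ys; rewrite E mem_cat => /orP[//|yxs].
  have yl' : y \in hl' by rewrite mem_cat yxs orbT.
  case/orP: (badP y yl' ey) => /andP[/eqP yE e2].
    have := psnhl y; rewrite mem_rcons inE yE psh orbT => /(_ isT) /negP[].
    by rewrite -yE E mem_cat yxs orbT.
  by move: y2; rewrite yE lastE eqxx e2.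
pose P := rev ps0 ++ (c3 :: rcons hr' c2) ++ rev xs.
(* One part is just the edge from [pk] to [x], where the discarded part [pre] touches the new
   hole. *)
have Hm : hole_split [:: pk; x] P.
  have H'' : sep_hole L R c3 c2 (ps0 ++ [:: pk; x] ++ xs) hr' by move: H'; rewrite cat_rcons.
  exact: (sep_hole_middle e_sym e_irr H'').
have PP u : u \in P -> [\/ u \in ps0 \/ u \in xs, u = c3, u = c2 | u \in hr'].
  rewrite mem_cat mem_rev mem_cat mem_rev in_cons mem_rcons in_cons.
  case/or3P=> [up|/or3P[/eqP|/eqP|]|uxs]; [by constructor 1; left|by constructor 2|by constructor 3|by constructor 4|].
  by constructor 1; right.
have inP u : [\/ u \in ps0 \/ u \in xs, u = c3, u = c2 | u \in hr'] -> u \in P.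
  by case=> [[up|up]|->|->|up]; rewrite /P mem_cat mem_rev mem_cat mem_rev in_cons mem_rcons in_cons ?up ?eqxx ?orbT.
have hr'R u : u \in hr' -> u \in R by apply: (arm_sub St' Ar').
have hl'L u : u \in hl' -> u \in L by apply: (arm_sub St Al).
(* The path is sought in [v] and the discarded parts of the two sides. [c1] is left out, as it may
   be adjacent to [pk] and [qk]. *)
pose X := [pred u | [|| u \in pre, u == v | u \in preR]].
pose al u := e u pk || e u x.
pose be u := has (e u) P.
have preL u : u \in pre -> u \in L by move=> /prehl /lL.
have preRR u : u \in preR -> u \in R by move=> /prehr /rR.
have ipre : ipath (pre ++ x :: xs).
  rewrite -E; apply: (@ipath_catr _ e e_irr [:: c1]) => //.
  by apply: (@ipath_catl _ e e_irr _ [:: c2]); rewrite // cats1.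
have pn : pre != [::] := mem_ne ypre.
have /(ipath_cat e_irr)[//|//|ippre ipxxs Jp] := ipre.
have xnxs : x \notin xs by have := ipath_uniq e_irr ipxxs; rewrite cons_uniq => /andP[].
have preP u w : u \in pre -> w \in P -> ~~ e u w.
  move=> up /PP[[wp|wxs]|->|->|wr].
  - have [|fw _] := fp w; first by rewrite inE wp orbT.
    by rewrite e_sym; apply: free_hl fw (prehl _ up).
  - have [||_ ->] := Jp u w => //; first by rewrite inE wxs orbT.
    by rewrite negb_and /=; apply/orP; right; apply: contraNneq xnxs => <-.
  - by rewrite e_sym; apply: free_hl f3 (prehl _ up).
  - have [_ ec2] := ipath_ends ipl ln (prehl _ up).
    rewrite e_sym ec2; apply/eqP => uE; have := uhl; rewrite E.
    move/uniq_cat_notin/(_ up); apply; rewrite uE E last_cat /=.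
    by rewrite inE; case: (xs) xsn => //= k l _; rewrite mem_last orbT.
  - by have [] := LR u w (preL _ up) (hr'R _ wr).
have pkx u : u \in [:: pk; x] -> [/\ u \in hl', u \notin ps0 & u \notin xs].
  rewrite !inE => /orP[]/eqP->.
    rewrite mem_cat mem_rcons inE eqxx; split=> //.
      by have := ipath_uniq e_irr ipp; rewrite cons_uniq rcons_uniq => /and3P[].
    apply/negP => /xshl; apply/negP/psnhl; by rewrite mem_rcons mem_head.
  rewrite mem_cat inE eqxx orbT; split=> //.
  by apply/negP => xp; have := psnhl x; rewrite mem_rcons inE xp orbT xhl => /(_ isT).
have vpkx u : u \in [:: pk; x] -> ~~ e v u.
  move=> /pkx[ul up uxs]; apply/negP => /(badP u ul).
  case/orP=> /andP[/eqP uE _]; first by rewrite uE psh in up.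
  by rewrite uE lasth in uxs.
have preRn u w : u \in preR -> w \in [:: pk; x] -> ~~ e u w.
  by move=> up /pkx[wl _ _]; have [] := LR w u (hl'L _ wl) (preRR _ up); rewrite e_sym.
have alP u : al u = has (e u) [:: pk; x] by rewrite /al /= orbF.
have Xpre u : u \in pre -> X u by rewrite /X /= => ->.
have Xv : X v by rewrite /X /= eqxx orbT.
have XpreR u : u \in preR -> X u by rewrite /X /= => ->; rewrite !orbT.
have lpre : last c1 pre \in pre by case: (pre) pn => //= ? ? _; rewrite mem_last.
have allast : al (last c1 pre).
  rewrite /al; have [||_ ->] := Jp (last c1 pre) x => //; first by rewrite inE eqxx.
  by rewrite (last_irr (last c1 pre) c1 pn) /= !eqxx orbT.
have cv : connect (within X) (last c1 pre) v.
  apply: connect_trans (ipath_conn ippre Xpre lpre ypre) _.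
  by apply: connect1; rewrite /within e_sym ey Xv Xpre.
(* Either [z] is on the kept part of [hr] and [v] itself sees [P], or [z] is in [preR], whose last
   vertex is adjacent to [xR]. *)
have [w0 bw0 cw0] : exists2 w0, be w0 & connect (within X) (last c1 pre) w0.
  move: zr; rewrite E' mem_cat => /orP[zp|zx].
    have iprR : ipath (preR ++ xR :: xsR).
      rewrite -E'; apply: (@ipath_catr _ e e_irr [:: c1]) => //.
      by apply: (@ipath_catl _ e e_irr _ [:: c2]); rewrite // cats1.
    have pRn := mem_ne zp.
    have /(ipath_cat e_irr)[//|//|ipR _ JR] := iprR.
    have lpR : last c1 preR \in preR by case: (preR) pRn => //= ? ? _; rewrite mem_last.
    exists (last c1 preR).
      apply/hasP; exists xR; first by apply: inP; constructor 4; rewrite mem_cat inE eqxx orbT.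
      have [||_ ->] := JR (last c1 preR) xR => //; first by rewrite inE eqxx.
      by rewrite (last_irr (last c1 preR) c1 pRn) /= !eqxx.
    apply: connect_trans cv _; apply: connect_trans (ipath_conn ipR XpreR zp lpR).
    by apply: connect1; rewrite /within ez Xv XpreR.
  exists v => //; apply/hasP; exists z => //; apply: inP; constructor 4.
  by rewrite mem_cat zx orbT.
have [d0 [d [ipd fd [a0 bl] ua ub]]] := conn_ipath e_irr cw0 (Xpre _ lpre) allast bw0.
have dX u : u \in d0 :: d -> [\/ u \in pre, u = v | u \in preR].
  by move=> /fd[/or3P[|/eqP|] ? _]; [constructor 1|constructor 2|constructor 3].
have vc3 : v != c3 by apply: contraTneq ey => ->; apply: free_hl f3 ys.
have vc2 : v != c2 by apply: contraNneq vn => ->; rewrite !inE eqxx orbT.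
have d1 : 1 < size (d0 :: d).
  case: (d) bl fd => //= bl fd; case: (dX d0) => [|dp|dv|dp]; first exact: mem_head.
  - by have [w wP edw] := hasP bl; rewrite (negPf (preP _ _ dp wP)) in edw.
  - by move: a0; rewrite alP dv => /hasP[w /vpkx/negPf->].
  - by move: a0; rewrite alP => /hasP[w wpk]; rewrite (negPf (preRn _ _ dp wpk)).
have lk : links e [:: pk; x] P (d0 :: d).
  split=> //.
  - move=> u w ud; rewrite mem_cat => win.
    have {}win : [\/ w \in hl', w = c3, w = c2 | w \in hr'].
      case/orP: win => [/pkx[wl _ _]|/PP[[wp|wxs]|->|->|wr]]; first by constructor 1.
      - by constructor 1; rewrite mem_cat mem_rcons inE wp orbT.
      - by constructor 1; rewrite mem_cat inE wxs !orbT.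
      - by constructor 2.
      - by constructor 3.
      - by constructor 4.
    case: (dX u ud) => [up|->|up].
    + case: win => [wl|->|->|wr].
      * apply: contraTneq wl => <-; rewrite mem_cat; apply/norP; split.
          apply/negP => /psnhl; by rewrite prehl.
        by apply/negP; apply: uniq_cat_notin up; rewrite -E.
      * by apply: contraNneq n3 => <-; rewrite inE preL.
      * by apply: contraNneq n2 => <-; rewrite inE preL.
      * by have [] := LR u w (preL _ up) (hr'R _ wr).
    + case: win => [wl|->|->|wr] //.
      * by apply: contraNneq vLR => ->; rewrite inE hl'L.
      * by apply: contraNneq vLR => ->; rewrite inE hr'R // orbT.
    case: win => [wl|->|->|wr].
    + by rewrite eq_sym; have [] := LR w u (hl'L _ wl) (preRR _ up).
    + by apply: contraNneq n3 => <-; rewrite inE preRR // orbT.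
    + by apply: contraNneq n2 => <-; rewrite inE preRR // orbT.
    + apply: contraTneq wr => <-; rewrite mem_cat; apply/norP; split.
        apply/negP; rewrite mem_rcons inE => /orP[/eqP uE|uq].
          by move: qS; rewrite -uE inE mem_cat prehr // orbT.
        have [|/freeP[+ _] _] := fq u; first by rewrite inE uq orbT.
        by rewrite inE mem_cat prehr // orbT.
      by apply/negP; apply: uniq_cat_notin up; rewrite -E'.
  - by move=> u w ud wpk euw; apply: ua; rewrite // alP; apply/hasP; exists w.
  - by move=> u w ud wP euw; apply: ub => //; apply/hasP; exists w.
have a0' : has (e d0) [:: pk; x] by rewrite -alP.
have [y0 [z0 [yin zin eyz _ Nz]]] := attach e_sym e_irr GC Hm lk a0' bl.
(* The nonempty [ps0] separates [pk] from [c3], and the nonempty [xs] separates [x] from [c2]. *)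
have z0L : z0 \in ps0 \/ z0 \in xs.
  have [yl ynp ynx] := pkx _ yin.
  case: (PP _ zin) => // [zE|zE|zr'].
  - move: yin; rewrite !inE => /orP[]/eqP yE; last first.
      by move: eyz; rewrite zE yE e_sym (negPf (free_hl f3 xhl)).
    move: ipp; case: (ps0) psn => // k l _; rewrite rcons_cons ipath2 => /and3P[_ /allP/(_ pk)].
    rewrite mem_rcons mem_head => /(_ isT) /andP[_]; rewrite e_sym; move: eyz.
    by rewrite yE zE => ->.
  - move: yin; rewrite !inE => /orP[]/eqP yE.
      by move: eyz; rewrite zE yE e_sym (negPf ek2).
    have [_ ec2] := ipath_ends ipl ln xhl; move: eyz; rewrite zE yE e_sym ec2 => /eqP xE.
    by move: xnxs; rewrite xE E last_cat /=; case: (xs) xsn => //= k l _; rewrite mem_last.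
  - by have [_ /negP[]] := LR y0 z0 (hl'L _ yl) (hr'R _ zr').
have z0l : z0 \in hl'.
  by rewrite mem_cat mem_rcons !inE; case: z0L => ->; rewrite !orbT.
have zc3 : z0 != c3 by apply: contraNneq n3 => <-; rewrite inE hl'L.
have zc2 : z0 != c2 by apply: contraNneq n2 => <-; rewrite inE hl'L.
have ez0 : e (last d0 d) z0 by rewrite Nz.
(* Vertices of [pre] see nothing in [P], and those of [preR] do not see [L]. If the end is [v], then
   [z0] is an end of the new side that does not count, so [v] also sees [c3] or [c2]: two neighbours
   in [P]. *)
case: (dX (last d0 d) (mem_last _ _)) => [up|uv|up].
- by rewrite (negPf (preP _ _ up zin)) in ez0.
- rewrite uv in ez0 Nz; case/orP: (badP z0 z0l ez0) => /andP[_ ec].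
    have := Nz c3; rewrite ec => /(_ _)/esym/eqP c3E.
    by move: zc3; rewrite -c3E ?eqxx //; apply: inP; constructor 2.
  have := Nz c2; rewrite ec => /(_ _)/esym/eqP c2E.
  by move: zc2; rewrite -c2E ?eqxx //; apply: inP; constructor 3.
by have [_ /negP[]] := LR z0 _ (hl'L _ z0l) (preRR _ up); rewrite e_sym.
Qed.

(** Neither contact vertex is an end of the new side, so seeing one of them suffices for [side]. *)
Lemma arm_contact u : u \in [:: pk; x] ->
  [/\ u \in hl', u != head c3 hl' & u != last c3 hl'].
Proof.
have [_ H _ _ _] := St; have [[E ekx nxs] [xsn psn] ipp pL [fp kS ek2]] := Al.
have [xhl xshl prehl uhl] := arm_x St Al.
have psh : head c3 hl' \in ps0 by case: (ps0) psn => //= ? ? _; rewrite inE eqxx.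
have lasth : last c3 hl' \in xs by rewrite last_cat; case: (xs) xsn => //= ? ? _; rewrite mem_last.
have kh : pk \notin hl by move: kS; rewrite inE mem_cat => /norP[].
rewrite !inE => /orP[]/eqP->.
  rewrite mem_cat mem_rcons mem_head; split=> //.
    have := ipath_uniq e_irr ipp; rewrite cons_uniq rcons_uniq => /and3P[_ kp _].
    by apply: contraNneq kp => ->.
  by apply: contraNneq kh => ->; apply: xshl.
rewrite mem_cat mem_head orbT; split=> //.
  apply: contraTneq xhl => ->.
  have [|/freeP[+ _] _] := fp (head c3 hl'); first by rewrite inE psh orbT.
  by rewrite inE mem_cat => /norP[].
have : uniq (x :: xs) by move: uhl; rewrite E cat_uniq => /and3P[].
by rewrite cons_uniq => /andP[xn _]; apply: contraNneq xn => ->.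
Qed.

Lemma inner_side : e c1 pk \/ (forall y, y \in hl -> e pk y = (y == head c1 hl)) ->
  side e c1 c3 c2 hl'.
Proof.
have [_ H _ _ _] := St; have [[E ekx nxs] [xsn psn] ipp pL [fp kS ek2]] := Al.
have [xhl _ _ _] := arm_x St Al.
have [_ nc] := sep_hole_nonadj e_sym e_irr H; have [_ ln _ _ _] := H => att.
have [y yin ey] : exists2 y, y \in [:: pk; x] & e c1 y.
  case: att => [ek|att]; first by exists pk; rewrite ?mem_head.
  exists x; first by rewrite !inE eqxx orbT.
  have [-> _] := ipath_ends (sep_hole_ip e_sym e_irr H) ln xhl.
  by rewrite -att.
have [yl y1 y2] := arm_contact yin; apply/hasP; exists y => //.
by rewrite ey (negPf y1) (negPf nc) andbF.
Qed.

End NewHole2.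

Lemma transfer_good L R c1 c2 hl hr c3 ps0 pk pre x xs qs0 qk preR xR xsR v :
  setup e L R c1 c2 hl hr c3 ->
  arm L hl (hset hl hr) c2 c3 ps0 pk pre x xs ->
  arm R hr (hset hl hr) c2 c3 qs0 qk preR xR xsR ->
  good e c1 c2 hl hr v ->
  good e c3 c2 (rcons ps0 pk ++ x :: xs) (rcons qs0 qk ++ xR :: xsR) v.
Proof.
move=> St Al Ar gd; have St' := setup_swap e_sym e_irr St.
have [LR H [n1 n2 n3] f3 _] := St.
apply/and3P; split; last 2 first.
- exact: (transfer_side St Al Ar gd).
- have [Al' Ar'] := (Al, Ar); rewrite hsetC in Al' Ar'.
  by apply: (transfer_side St' Ar' Al'); rewrite good_swap.
have vLR := good_notin LR H gd.
have [vn /hasP[y ys /and3P[ey _ _]] _] := and3P gd.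
rewrite !inE !negb_or mem_cat; apply/and3P; split.
- by apply: contraTneq ey => ->; apply: free_hl f3 ys.
- by apply: contraNneq vn => ->; rewrite !inE eqxx orbT.
apply: contra vLR; rewrite inE => /orP[vl|vr].
  by rewrite (arm_sub St Al).
rewrite hsetC in Ar; by rewrite (arm_sub St' Ar) // orbT.
Qed.

Lemma inner_good L R c1 c2 hl hr c3 ps0 pk pre x xs qs0 qk preR xR xsR :
  setup e L R c1 c2 hl hr c3 ->
  arm L hl (hset hl hr) c2 c3 ps0 pk pre x xs ->
  arm R hr (hset hl hr) c2 c3 qs0 qk preR xR xsR ->
  e c1 pk \/ (forall y, y \in hl -> e pk y = (y == head c1 hl)) ->
  e c1 qk \/ (forall y, y \in hr -> e qk y = (y == head c1 hr)) ->
  good e c3 c2 (rcons ps0 pk ++ x :: xs) (rcons qs0 qk ++ xR :: xsR) c1.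
Proof.
move=> St Al Ar a1 a2; have St' := setup_swap e_sym e_irr St.
have Ar' : arm R hr (hset hr hl) c2 c3 qs0 qk preR xR xsR by rewrite hsetC.
have [LR H [n1 n2 n3] f3 _] := St.
apply/and3P; split; last 2 first.
- exact: (inner_side St Al a1).
- exact: (inner_side St' Ar' a2).
have [c12 _] := sep_hole_nonadj e_sym e_irr H.
rewrite !inE !negb_or mem_cat; apply/and3P; split=> //.
  by rewrite eq_sym; apply: (free_neq1 e_sym e_irr St f3).
apply: contra n1; rewrite inE => /orP[vl|vr].
  by rewrite (arm_sub St Al).
by rewrite (arm_sub St' Ar') // orbT.
Qed.

Lemma LR_path_swap L R c1 c2 p : LR_path e L R c1 c2 p <-> LR_path e R L c1 c2 p.
Proof. by split=> -[H ipp]; split=> //; case: H; [right|left|right|left]. Qed.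

(** The point is that [xs] is nonempty: if [x] were next to [c2], then [x] alone, or [pk] and [x],
    would be the interior of a path from [c1] to [c2] that is too short. *)
Lemma arm_exists L R c1 c2 hl hr c3 ps : setup e L R c1 c2 hl hr c3 ->
  path_through e L hl c3 ps -> ~ linked e (hset hl hr) c3 c2 -> ~~ e c2 (last c3 ps) ->
  e c1 (last c3 ps) \/ (forall y, y \in hl -> e (last c3 ps) y = (y == head c1 hl)) ->
  (forall p, LR_path e L R c1 c2 p -> 3 <= size p) ->
  exists ps0 pre x xs, arm L hl (hset hl hr) c2 c3 ps0 (last c3 ps) pre x xs.
Proof.
move=> St /(reach_facts e_sym e_irr St)[ps0 [pk [E pn ipp pL [fp kS khl]]]] nl2.
rewrite E last_rcons => e2 att long.
have [LR H [n1 n2 n3] f3 _] := St; have [_ ln rn lL rR] := H.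
have ipl := sep_hole_ip e_sym e_irr H; have [c12 nc] := sep_hole_nonadj e_sym e_irr H.
have [pre [x [xs [El ekx nxs]]]] := split_last khl.
exists ps0, pre, x, xs; rewrite E in ipp pL; split=> //; last first.
  split=> // u up; have [fu cu] := fp u up; split=> //.
  by apply/negP => e2u; apply: nl2; exists u.
split=> //; apply/eqP => xs0; rewrite xs0 in El.
have xhl : x \in hl by rewrite El mem_cat mem_head orbT.
have [e1x e2x] := ipath_ends ipl ln xhl.
have e2x' : e c2 x by rewrite e2x El last_cat /=.
have n1x : ~~ e c1 x.
  apply/negP => e1x'; have /long // : LR_path e L R c1 c2 [:: x].
  split; first by left; rewrite /= lL.
  by apply/(indpathP e_sym e_irr); rewrite /= e1x' /nonadj c12 nc e_sym e2x'.
have e1k : e c1 pk.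
  by case: att => // att; case/negP: n1x; rewrite e1x -att.
have kL : pk \in L by rewrite pL // mem_rcons mem_head.
have /long // : LR_path e L R c1 c2 [:: pk; x].
split; first by left; apply/allP => u; rewrite !in_cons => /or3P[/eqP->|/eqP->|//] //; apply: lL.
apply/(indpathP e_sym e_irr); rewrite /= e1k ekx /nonadj c12 nc n1x (e_sym x) e2x' (e_sym pk) e2.
rewrite !andbT /=; apply/andP; split.
  by apply: contraNneq n1 => ->; rewrite inE lL.
by apply: contraNneq n2 => <-; rewrite inE kL.
Qed.
End Transfer.

(** * Separators and potentials *)

Section Separators.
Variables (T : finType) (e : rel T).
Hypotheses (e_sym : symmetric e) (e_irr : irreflexive e) (GC : in_classC e).

Notation ipath := (ipath e).
Notation hole_split := (hole_split e).
Notation sep_hole := (sep_hole e).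
Notation setup := (setup e).
Notation linked := (linked e).

Lemma pboolE P : pbool P <-> P.
Proof. by rewrite /pbool; case: excluded_middle_informative. Qed.

Lemma componentE (S K : {set T}) : is_component e S K ->
  exists x, [/\ x \in S & K =i connect (within e (mem S)) x].
Proof. by case=> x [xS ->]; exists x; split=> // y; rewrite inE. Qed.

Lemma component_sub (S K : {set T}) : is_component e S K -> {subset K <= S}.
Proof.
case/componentE=> x [xS KE] y; rewrite KE => xy; exact: within_closed xy xS.
Qed.

Lemma components_anticomplete (S K K' : {set T}) : is_component e S K -> is_component e S K' ->
  K != K' -> anticomplete e K K'.
Proof.
move=> cK cK'; have sK := component_sub cK; have sK' := component_sub cK'.
have [x [xS KE]] := componentE cK; have [x' [xS' KE']] := componentE cK'.
have meet y z : y \in K -> z \in K' -> connect (within e (mem S)) y z -> K = K'.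
  rewrite KE KE' => xy xz yz; apply/setP=> w; rewrite KE KE'.
  have xx : connect (within e (mem S)) x x'.
    by apply: connect_trans xy _; apply: connect_trans yz _; rewrite (within_sym e_sym).
  apply/idP/idP => cw; last exact: connect_trans xx cw.
  by apply: connect_trans cw; rewrite (within_sym e_sym).
move=> nKK y z yK zK'; split; apply/negP => H; case/negP: nKK; apply/eqP.
  by apply: meet yK zK' _; rewrite (eqP H) connect0.
apply: (meet y z) => //; apply: connect1; rewrite /within H /=; apply/andP; split; [exact: (sK _ yK)|exact: (sK' _ zK')].
Qed.

(** [CHole] admits an empty side, which would make [c1] and [c2] consecutive on the hole; hence the
    hypothesis of non-adjacency. *)
Lemma CHole_sep_hole (C L R : {set T}) c1 c2 hl hr : anticomplete e L R -> ~~ e c1 c2 ->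
  CHole e C L R c1 c2 hl hr <-> [/\ c1 \in C, c2 \in C & sep_hole L R c1 c2 hl hr].
Proof.
move=> LR nc; have hE : hole_of c1 c2 hl hr = (c1 :: hl) ++ rev (rcons hr c2).
  by rewrite rev_rcons.
have rn : rcons hr c2 != [::] by rewrite -size_eq0 size_rcons.
split.
  case=> c1C [c2C [hh [/allP aL /allP aR]]]; split=> //.
  rewrite hE in hh; have H := (is_hole_split e_sym e_irr _ rn).1 hh; split; last 2 first.
  - exact: aL.
  - exact: aR.
  - exact: H.
  - apply: contra nc => /eqP h0; have [_ _ _ J] := H isT.
    by have [||_ ->] := J c1 c2; rewrite ?mem_head ?mem_rcons ?mem_head ?h0 ?last_rcons //= !eqxx orbT.
  apply: contra nc => /eqP h0; have [_ _ _ J] := H isT.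
  by have [||_ ->] := J c1 c2; rewrite ?mem_head ?mem_rcons ?mem_head ?h0 //= !eqxx.
case=> c1C c2C [H _ _ lL rR]; split=> //; split=> //; split.
  by rewrite hE; apply/(is_hole_split e_sym e_irr).
by split; apply/allP.
Qed.

Definition oriented L R c1 c2 hl hr c3 ps qs := [/\ setup L R c1 c2 hl hr c3,
  ~ linked (hset hl hr) c3 c2, path_through e L hl c3 ps, path_through e R hr c3 qs &
  linked (hset hl hr) c3 c1 \/
    ~ linked (hset hl hr) c3 c1 /\ e c1 (last c3 ps) && e c1 (last c3 qs)].

Lemma path_through_rev Y Z p0 ps : path_through e Y Z p0 ps -> path_through e Y (rev Z) p0 ps.
Proof.
case=> ipp [aY [al hz]]; split=> //; split=> //; split; last by rewrite has_rev.
by apply: sub_all al => x; rewrite has_rev.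
Qed.

(** At most one of [c1], [c2] is linked, by [both_linked]. If neither is, [unlinked_reach] gives one
    that the ends of both legs see, and it takes the role of [c1]. *)
Lemma orient L R c1 c2 hl hr c3 ps qs : setup L R c1 c2 hl hr c3 ->
  path_through e L hl c3 ps -> path_through e R hr c3 qs ->
  oriented L R c1 c2 hl hr c3 ps qs \/ oriented L R c2 c1 (rev hl) (rev hr) c3 ps qs.
Proof.
move=> St Rp Rq.
have rev_case : ~ linked (hset hl hr) c3 c1 -> linked (hset hl hr) c3 c2 \/
    ~ linked (hset hl hr) c3 c2 /\ e c2 (last c3 ps) && e c2 (last c3 qs) ->
    oriented L R c2 c1 (rev hl) (rev hr) c3 ps qs.
  by move=> nl H; split; rewrite ?hset_rev //; [exact: setup_rev|exact: path_through_rev|exact: path_through_rev].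
case: (classic (linked (hset hl hr) c3 c2)) => l2.
  right; apply: rev_case; last by left.
  by move=> l1; apply: both_linked l1 l2; eauto.
case: (classic (linked (hset hl hr) c3 c1)) => l1; first by left; split=> //; left.
have /orP[H|H] := unlinked_reach e_sym e_irr GC St l1 l2 Rp Rq.
  by left; split=> //; right.
by right; apply: rev_case => //; right.
Qed.

Lemma LR_path_side L R c1 c2 hl hr : sep_hole L R c1 c2 hl hr -> LR_path e L R c1 c2 hl.
Proof.
move=> H; split; first by left; have [_ _ _ lL _] := H; apply/allP.
by apply/(indpathP e_sym e_irr); rewrite cats1; apply: sep_hole_ip H.
Qed.

Lemma long_sizes L R c1 c2 hl hr : sep_hole L R c1 c2 hl hr ->
  (forall p, LR_path e L R c1 c2 p -> 3 <= size p) -> 3 <= size hl /\ 3 <= size hr.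
Proof.
move=> H long; split; first exact: long (LR_path_side H).
by apply/long/LR_path_swap/(LR_path_side (sep_hole_swap e_sym e_irr H)).
Qed.

Lemma frame_of_ends (c1 c2 : T) hl hr c1' c2' hl' hr' :
  frame_of c1 c2 hl hr = frame_of c1' c2' hl' hr' -> c1 = c1' /\ c2 = c2'.
Proof.
rewrite /frame_of; case: (side_frame c1 hl) => [[[? ?] ?] ?]; case: (side_frame c1 hr) => [[[? ?] ?] ?].
by case: (side_frame c1' hl') => [[[? ?] ?] ?]; case: (side_frame c1' hr') => [[[? ?] ?] ?] [].
Qed.

(** The hole witnessing heaviness is only known to have the same frame, so [same_frame_good] is
    needed to pass to the given one. *)
Lemma F_heavy_good (C L R : {set T}) c1 c2 hl hr v : anticomplete e L R ->
  c1 \notin L :|: R -> c2 \notin L :|: R -> sep_hole L R c1 c2 hl hr ->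
  (forall p, LR_path e L R c1 c2 p -> 3 <= size p) ->
  F_heavy e C L R (frame_of c1 c2 hl hr) v -> good e c1 c2 hl hr v.
Proof.
move=> LR n1 n2 H long [c1' [c2' [hl0 [hr0 [CH [fE hv]]]]]].
have [? ?] := frame_of_ends fE; subst c1' c2'.
have [_ nc] := sep_hole_nonadj e_sym e_irr H.
have [_ _ H0] := (CHole_sep_hole C hl0 hr0 LR nc).1 CH.
have [sl sr] := long_sizes H long; have [sl0 sr0] := long_sizes H0 long.
apply: (same_frame_good e_sym e_irr GC LR n1 n2 H H0) => //.
exact: (heavy_good e_irr H0).
Qed.

Lemma long_pairP L R c1 c2 : c1 != c2 ->
  (forall p, LR_path e L R c1 c2 p -> 3 <= size p) -> long_pair e L R c1 c2.
Proof. by move=> nc H; split=> // p /H. Qed.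

(* Rerouting the hole through [c3] keeps all the heavy vertices and makes [c1] heavy. *)
Lemma potential_grows (C L R : {set T}) c1 c2 hl hr c3 ps qs F :
  oriented L R c1 c2 hl hr c3 ps qs -> c2 \in C -> c3 \in C ->
  (forall p, LR_path e L R c1 c2 p -> 3 <= size p) ->
  (forall v, F_heavy e C L R F v -> good e c1 c2 hl hr v) ->
  exists F', [/\ is_frame e C L R c3 c2 F', long_pair e L R c3 c2 &
    potential e C L R F < potential e C L R F'].
Proof.
move=> [St nl2 Rp Rq Hl] c2C c3C long GF.
have [LR H [n1 n2 n3] f3 _] := St; have St' := setup_swap e_sym e_irr St.
have CF : common_free e L R c1 c2.
  move=> u uLR; apply/negP => /andP[e1 e2].
  have [c12 nc] := sep_hole_nonadj e_sym e_irr H.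
  have /long // : LR_path e L R c1 c2 [:: u].
  split; first by move: uLR; rewrite inE => /orP[]uu; [left|right]; apply/allP => w; rewrite inE => /eqP->.
  by apply/(indpathP e_sym e_irr); rewrite /= e1 (e_sym u) e2 /nonadj c12 nc.
have [e2p e2q a1 a2 far] := far_pair e_sym e_irr GC St CF nl2 Rp Rq Hl.
have [ps0 [pre [x [xs Al]]]] := arm_exists e_sym e_irr St Rp nl2 e2p a1 long.
have [qs0 [preR [xR [xsR Ar]]]] : exists qs0 preR xR xsR, arm e R hr (hset hr hl) c2 c3 qs0 (last c3 qs) preR xR xsR.
  apply: (arm_exists e_sym e_irr St' Rq) => //; first by rewrite hsetC.
  by move=> p /LR_path_swap; apply: long.
rewrite hsetC in Ar.
have H' := new_chole e_sym e_irr St Al Ar.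
set hl' := rcons ps0 _ ++ _ in H'; set hr' := rcons qs0 _ ++ _ in H'.
have [c32 nc'] := sep_hole_nonadj e_sym e_irr H'.
have CH : CHole e C L R c3 c2 hl' hr' by apply/CHole_sep_hole.
exists (frame_of c3 c2 hl' hr'); split.
- by exists hl', hr'.
- exact: long_pairP.
have heavy v : good e c3 c2 hl' hr' v -> F_heavy e C L R (frame_of c3 c2 hl' hr') v.
  by move=> gv; exists c3, c2, hl', hr'; split=> //; split=> //; apply: good_heavy H' gv.
apply/proper_card/properP; split.
  apply/subsetP => v; rewrite !inE => /pboolE /GF gv; apply/pboolE/heavy.
  exact: (transfer_good e_sym e_irr GC St Al Ar).
exists c1; rewrite inE.
  by apply/pboolE/heavy; apply: (inner_good e_sym e_irr St Al Ar).
(* [c1] lies on the old hole, so it is not counted in the old potential. *)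
by apply/negP => /pboolE /GF /and3P[]; rewrite mem_head.
Qed.

Lemma far_long L R c1 c2 hl hr c3 ps qs : oriented L R c1 c2 hl hr c3 ps qs ->
  common_free e L R c1 c2 -> long_pair e L R c3 c2.
Proof.
move=> [St nl2 Rp Rq Hl] CF; apply: long_pairP.
  by have [_ _ _ f3 _] := St; apply: (free_neq2 e_sym e_irr St f3).
by have [_ _ _ _] := far_pair e_sym e_irr GC St CF nl2 Rp Rq Hl.
Qed.

Lemma central_setup (C L R : {set T}) c1 c2 hl hr c3 ps qs :
  anticomplete e L R -> [disjoint C & L :|: R] -> ~~ e c1 c2 ->
  CHole e C L R c1 c2 hl hr -> c3 \in C -> butterfly e L R hl hr c3 ps qs ->
  central ps qs -> setup L R c1 c2 hl hr c3.
Proof.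
move=> LR /pred0P dC nc /(CHole_sep_hole _ _ _ LR nc)[c1C c2C H] c3C [_ [[Rp minp] [Rq minq]]] [sp sq].
have nC c : c \in C -> c \notin L :|: R.
  by move=> cC; apply/negP => cLR; have := dC c; rewrite /= cC cLR.
have [_ _ _ lL rR] := H.
have first_free (Y : {set T}) (Z : seq T) ss : path_through e Y Z c3 ss -> 1 < size ss -> ~~ has (e c3) Z.
  by case=> _ [_ [al _]]; case: ss al => // y ss /andP[].
have pn := first_free _ _ _ Rp sp; have qn := first_free _ _ _ Rq sq.
(* A neighbour of [c3] touching the side would be a leg of length one, shorter than the given
   shortest leg. *)
have one (Y : {set T}) (Z : seq T) y : y \in Y -> e c3 y -> ~~ has (e c3) Z -> has (e y) Z -> path_through e Y Z c3 [:: y].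
  move=> yY e3y nZ yZ; split; first by apply/(indpathP e_sym e_irr); rewrite /= e3y.
  by split; [apply/allP => w; rewrite inE => /eqP->|rewrite /= nZ].
split=> //.
- by split; apply: nC.
- apply/freeP; split.
    rewrite inE mem_cat; apply/negP => c3h; have := nC c3 c3C; rewrite inE.
    by case/orP: c3h => [/lL->|/rR->]; rewrite ?orbT.
  by move=> y; rewrite inE mem_cat => /orP[/(hasPn pn)|/(hasPn qn)].
split=> y yL e3y; apply/negP => hy.
  by have := minp _ (one _ _ _ yL e3y pn hy); rewrite leqNgt sp.
by have := minq _ (one _ _ _ yL e3y qn hy); rewrite leqNgt sq.
Qed.

End Separators.

Theorem theorem3p9 (T : finType) (e : rel T)
  (e_sym : symmetric e) (e_irr : irreflexive e)
  (GinC : in_classC e)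
  (C L R : {set T}) (sepC : proper_separator e C L R)
  (c1 c2 : T) (F : seq T) (Fopt : optimal_frame e C L R c1 c2 F)
  (hl hr : seq T) (HF : CHole e C L R c1 c2 hl hr /\ frame_of c1 c2 hl hr = F)
  (c3 : T) (c3C : c3 \in C) (c3n1 : c3 != c1) (c3n2 : c3 != c2)
  (c3light : F_light e C L R F c3)
  (ps qs : seq T) (Pbut : butterfly e L R hl hr c3 ps qs) :
  ~ central ps qs.
Proof.
move=> cen; have [cL [cR [LnR _]]] := sepC; have [CH FE] := HF.
have LR := components_anticomplete e_sym cL cR LnR.
have dC : [disjoint C & L :|: R].
  apply/pred0P => x /=; apply/negP => /andP[xC]; rewrite inE => /orP[/(component_sub cL)|/(component_sub cR)];
    by rewrite inE xC.
have nc : ~~ e c1 c2.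
  case: Fopt => _ [[_ [[c12 lp] _]]|[_ [//]]]; apply/negP => ec.
  have /lp // : LR_path e L R c1 c2 [::].
  by split; [left|apply/(indpathP e_sym e_irr); rewrite /= ec].
have St := central_setup e_sym e_irr LR dC nc CH c3C Pbut cen.
have [_ H [n1 n2 n3] f3 _] := St; have [_ [[Rp _] [Rq _]]] := Pbut.
have [c1C [c2C _]] := CH; have [c12 _] := sep_hole_nonadj e_sym e_irr H.
have LRsym a b p : LR_path e L R a b p -> LR_path e L R b a (rev p).
  case=> al ipp; split; first by case: al => al; [left|right]; rewrite all_rev.
  have -> : b :: rev p ++ [:: a] = rev (a :: p ++ [:: b]).
    by rewrite rev_cons rev_cat -cats1.
  by apply/(indpathP e_sym e_irr); rewrite (ipath_rev e_sym e_irr); apply/(indpathP e_sym e_irr).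
case: Fopt => _ [[_ [[_ lp] maxF]]|[nrich [_ [d [[_ mind] maxd]]]]].
  have long p : LR_path e L R c1 c2 p -> 3 <= size p by move=> /lp.
  have GF v : F_heavy e C L R F v -> good e c1 c2 hl hr v.
    by rewrite -FE; apply: F_heavy_good.
  have [O|O] := orient e_sym e_irr GinC St Rp Rq.
    have [F' [fr lg]] := potential_grows e_sym e_irr GinC O c2C c3C long GF.
    by rewrite ltnNge (maxF _ _ _ fr lg).
  have [|v /GF gv|F' [fr lg]] := potential_grows e_sym e_irr GinC (F := F) O c1C c3C.
  - by move=> p /LRsym /long; rewrite size_rev.
  - by rewrite good_rev.
  by rewrite ltnNge (maxF _ _ _ fr lg).
have poor c c' hl' hr' : oriented e L R c c' hl' hr' c3 ps qs -> c' \in C -> c3 != c' ->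
    (forall p, LR_path e L R c c' p -> d <= (size p).+1) -> False.
  move=> O cC n3c min; have [Sto nl _ _ _] := O.
  have nc3 : ~~ e c3 c'.
    by apply/negP => ec; apply: nl; exists c3; rewrite ?connect0 // e_sym.
  (* The pair is not long, as [C] is poor, and [far_dist] gives at least two interior vertices; so
     its distance is exactly three, and [d] is maximal. *)
  have d3 : 3 <= d.
    case: (classic (long_pair e L R c3 c')) => lg; first by case: nrich; exists c3, c'.
    have [p [pp sp]] : exists p, LR_path e L R c3 c' p /\ size p <= 2.
      apply: NNPP => np; apply: lg; apply: long_pairP => // p pp; rewrite leqNgt.
      by apply/negP => sp; apply: np; exists p.
    have sp2 : size p = 2.
      by have [p2 _] := far_dist e_sym e_irr Sto nl pp; apply/eqP; rewrite eqn_leq sp p2.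
    apply: (maxd c3 c' 3) => //; split; first by exists p; rewrite sp2.
    by move=> q /(far_dist e_sym e_irr Sto nl)[q2 _].
  (* A common neighbour of [c] and [c'] would put them at distance two, below [d]. So [far_long]
     applies and makes the pair long. *)
  apply: nrich; exists c3, c'; split=> //; split=> //; apply: far_long O _ => //.
  move=> u uLR; apply/negP => /andP[e1 e2].
  have [_ Ho _ _ _] := Sto; have [cc ncc] := sep_hole_nonadj e_sym e_irr Ho.
  have /min : LR_path e L R c c' [:: u].
    split; first by move: uLR; rewrite inE => /orP[]uu; [left|right]; apply/allP => w; rewrite inE => /eqP->.
    by apply/(indpathP e_sym e_irr); rewrite /= e1 (e_sym u) e2 /nonadj cc ncc.
  by rewrite leqNgt d3.
have [O|O] := orient e_sym e_irr GinC St Rp Rq.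
  exact: poor O c2C c3n2 mind.
apply: poor O c1C c3n1 _ => p /LRsym /mind; by rewrite size_rev.
Qed.
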